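(* Let $0 < a < \frac12$ and, for $m > \max \left\{ \frac{6}{a}, \frac{2}{1-2a} \right\}$, define $$\hat{\psi}_m(\gamma) = \hat{\varphi}_m \left(\gamma + \tfrac{3a}{4}\right) + \hat{\varphi}_m\left(\gamma - \tfrac{3a}{4}\right),\qquad \hat\psi_m \in C_c^\infty (\widehat{\mathbb{R}}),$$ and let $\psi_m$ be the inverse Fourier transform of $\hat\psi_m$. Then $\psi_m \in \mathscr{S} (\mathbb{R})$ and $\mathcal{W}(\psi_m)$ is a frame for $L^2(\mathbb{R})$, with (optimal) lower and upper frame bounds $A_m$ and $B_m$. For all such $m$, $A_m \leq \frac12$, but $B_m \to 1$ as $m \to \infty$.
   Context: Let $f:\mathbb{R}\to\mathbb{R}$ be $f(\gamma)=e^{-1/\gamma}$ for $\gamma>0$ and $f(\gamma)=0$ for $\gamma\le0$. For $b,m>0$ with $b-\frac1m>0$ define $$\hat{\varphi}_{b,m}(\gamma)=\frac{f\left(b+\frac1m-|\gamma|\right)}{f\left(b+\frac1m-|\gamma|\right)+f\left(|\gamma|-b+\frac1m\right)}.$$ For $a>\frac4m$ write $\hat{\varphi}_m=\hat{\varphi}_{\frac a4,m}$. $\widehat{\mathbb{R}}$ denotes $\mathbb{R}$ as frequency domain, and $\mathscr{S}(\mathbb{R})$ is the Schwartz space. The Fourier transform is $\hat g(\gamma)=\int g(x)e^{-2\pi i x\gamma}\,dx$, extended unitarily to $L^2$. For $\psi\in L^2(\mathbb{R})$, the dyadic wavelet system is $\mathcal{W}(\psi)=\{2^{n/2}\psi(2^n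 x-k): n\in\mathbb{Z},k\in\mathbb{Z}\}$. A family $\{e_j\}_{j\in J}$ in a separable Hilbert space $\mathcal{H}$ is a frame for $\mathcal{H}$ if there are constants $0<A\le B<\infty$ with $A\|f\|^2\le\sum_{j}|\langle f,e_j\rangle|^2\le B\|f\|^2$ for all $f\in\mathcal{H}$; the lower frame bound is the maximal such $A$ and the upper frame bound is the minimal such $B$. *)

(* Defs.v *)
From mathcomp Require Import all_boot all_order all_algebra.
From mathcomp Require Import all_classical all_reals all_analysis.
Set Implicit Arguments.
Unset Strict Implicit.
Unset Printing Implicit Defensive.
Import Order.TTheory GRing.Theory Num.Theory.
Import numFieldNormedType.Exports.
From mathcomp Require Import complex.
Local Open Scope classical_set_scope.
Local Open Scope ring_scope.
Local Open Scope complex_scope.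

Definition smooth (R : realType) (g : R -> R) : Prop :=
  forall (k : nat) (x : R), derivable (derive1n k g) x 1.

Definition smooth_compact_support (R : realType) (g : R -> R) : Prop :=
  smooth g /\ compact (closure [set x | g x != 0]).

Definition rapidly_decreasing (R : realType) (g : R -> R) : Prop :=
  forall j k : nat,
    exists C : R, forall x : R, `|x ^+ j * derive1n k g x| <= C.

Definition schwartz (R : realType) (g : R -> R[i]) : Prop :=
  [/\ smooth (fun x => Re (g x)), smooth (fun x => Im (g x)),
      rapidly_decreasing (fun x => Re (g x)) &
      rapidly_decreasing (fun x => Im (g x))].

Definition cintegral (R : realType) (g : R -> R[i]) : R[i] :=
  (\int[@lebesgue_measure R]_x Re (g x))%R +i*
  (\int[@lebesgue_measure R]_x Im (g x))%R.

(* Elements of L^2(R) are represented by functions; all the notions below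
   depend only on almost-everywhere classes. *)
Definition L2 (R : realType) (g : R -> R[i]) : Prop :=
  (fun x => Re (g x) : R) \in Lfun (@lebesgue_measure R) 2%:E /\
  (fun x => Im (g x) : R) \in Lfun (@lebesgue_measure R) 2%:E.

Definition L2_sqnorm (R : realType) (g : R -> R[i]) : \bar R :=
  \int[@lebesgue_measure R]_x (ComplexField.Normc.normc (g x) ^+ 2)%:E.

Definition L2_inner (R : realType) (g h : R -> R[i]) : R[i] :=
  cintegral (fun x => g x * (h x)^*).

Definition frame_bounds (R : realType) (J : choiceType) (e : J -> R -> R[i])
    (A B : R) : Prop :=
  [/\ 0 < A, A <= B &
      forall g : R -> R[i], L2 g ->
        let S := (\esum_(j in [set: J])
                    (ComplexField.Normc.normc (L2_inner g (e j)) ^+ 2)%:E)%E in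
        (A%:E * L2_sqnorm g <= S)%E /\ (S <= B%:E * L2_sqnorm g)%E].

Definition is_frame (R : realType) (J : choiceType) (e : J -> R -> R[i]) :
    Prop :=
  (forall j, L2 (e j)) /\ exists A B : R, frame_bounds e A B.

Definition is_lower_frame_bound (R : realType) (J : choiceType)
    (e : J -> R -> R[i]) (A : R) : Prop :=
  (exists B, frame_bounds e A B) /\
  forall A' B', frame_bounds e A' B' -> A' <= A.

Definition is_upper_frame_bound (R : realType) (J : choiceType)
    (e : J -> R -> R[i]) (B : R) : Prop :=
  (exists A, frame_bounds e A B) /\
  forall A' B', frame_bounds e A' B' -> B <= B'.

Definition inverse_fourier (R : realType) (g : R -> R[i]) (x : R) : R[i] :=
  cintegral (fun y => g y * (cos (2 * pi * x * y) +i* sin (2 * pi * x * y))).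

Definition wavelet_system (R : realType) (psi : R -> R[i]) (nk : int * int)
    (x : R) : R[i] :=
  ((2 : R) `^ (nk.1%:~R / 2))%:C * psi ((2 : R) ^ nk.1 * x - nk.2%:~R).

Definition exp_cutoff (R : realType) (x : R) : R :=
  if 0 < x then expR (- (1 / x)) else 0.

Definition phi_hat (R : realType) (b m x : R) : R :=
  exp_cutoff (b + 1 / m - `|x|) /
  (exp_cutoff (b + 1 / m - `|x|) + exp_cutoff (`|x| - b + 1 / m)).

Definition psi_hat (R : realType) (a m x : R) : R :=
  phi_hat (a / 4) m (x + 3 * a / 4) + phi_hat (a / 4) m (x - 3 * a / 4).

Definition psi (R : realType) (a m : R) : R -> R[i] :=
  inverse_fourier (fun y => (psi_hat a m y)%:C).

(* Main.v *)
(* Since [psi_hat] is supported in an interval of length less than 1, Parseval on a period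
   shows that the coefficients of g at scale n have total energy
   [int psi_hat(2^-n y)^2 |g^(y)|^2 dy]. Hence everything depends on the Calderon sum
   [k(y) = sum_n psi_hat(2^-n y)^2]: bounds on k are frame bounds, and testing on functions
   whose spectrum concentrates at [+-c] shows that frame bounds satisfy A <= k(c) <= B.
   Put r = 1/m. At c = 3a/4 one has k = 1, and at c = a the falling edge of one dilate
   meets the rising edge of the next one, twice as wide, at height 1/2, so that
   k(a) = 1/4 + 1/4 = 1/2. The two edges differ from complementary ones so little that
   their squares add up to at most 1 + 2 r^2, hence k <= 1 + 2 r^2, whereas k >= 1/4
   everywhere except at the origin.
   The spectrum concentrates by modulating and dilating a fixed smooth function, and the
   concentration is measured with the weight [(y^2 - c^2)^2], which corresponds to the
   differential operator [g'' + (2 pi c)^2 g]. *)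

Require Import Defs.
From mathcomp Require Import all_boot all_order all_algebra finmap.
From mathcomp Require Import all_classical all_reals all_analysis measurable_realfun.
Import Order.TTheory GRing.Theory Num.Theory.
Import numFieldNormedType.Exports.
From mathcomp Require Import complex zify ring lra.
Set Implicit Arguments.
Unset Strict Implicit.
Unset Printing Implicit Defensive.
Local Open Scope classical_set_scope.
Local Open Scope ring_scope.

(** * Continuous functions with compact support *)

Section cont_compact_support.
Context (R : realType).
Local Notation mu := (@lebesgue_measure R).
Implicit Types (u v g h : R -> R).

(** Square-integrable functions get no Fourier transform here. Transforms are taken only of
    continuous functions with compact support, where they are ordinary integrals, and the frame
    inequalities proved there pass to L^2 by density. Since [psi_hat] is real and even, the wavelets
    are real-valued, so cosine and sine integrals suffice. A nonzero test function of compact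
    support has a spectrum spread over the whole line, hence concentration at c holds only in the
    mean. This is why k is compared with k(c) by inequalities valid for every y, with an error term
    C (y^2 - c^2)^2 whose integral is then made small. The hypothesis on m amounts to r < a/6 and a
    + r < 1/2. The second is the length condition of Parseval. The first confines the overlap of
    consecutive dilates to the octave [2a/3, 4a/3), on which k has two terms only. The excess 2 r^2
    reflects the different widths of the two edges: written as logistic functions, they have
    arguments that match only up to third order once the wider edge is squared. *)

Definition supported (c : R) u := forall x, c <= `|x| -> u x = 0.

(** The working class for all Fourier computations: every integral below exists for it, and it is
    dense in L^2. *)
Definition cont_cs u := continuous u /\ exists c, supported c u.

Lemma cont_csMr u h : cont_cs u -> continuous h -> cont_cs (fun x => u x * h x).
Proof.
move=> [cu [c uc]] ch; split=> [x|]; first by apply: cvgM; [exact: cu|exact: ch].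
by exists c => x /uc ->; rewrite mul0r.
Qed.

Lemma cont_csZ k u : cont_cs u -> cont_cs (fun x => k * u x).
Proof.
move=> [cu [c uc]]; split=> [x|]; first by apply: cvgM; [exact: cvg_cst|exact: cu].
by exists c => x /uc ->; rewrite mulr0.
Qed.

Lemma cont_csN u : cont_cs u -> cont_cs (fun x => - u x).
Proof.
move=> [cu [c uc]]; split=> [x|]; first by apply: cvgN; exact: cu.
by exists c => x /uc ->; rewrite oppr0.
Qed.

Lemma cont_csD u v : cont_cs u -> cont_cs v -> cont_cs (fun x => u x + v x).
Proof.
move=> [cu [c uc]] [cv [d vd]]; split=> [x|].
  by apply: cvgD; [exact: cu|exact: cv].
by exists (Num.max c d) => x; rewrite ge_max => /andP[/uc -> /vd ->]; rewrite addr0.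
Qed.

Lemma cont_csB u v : cont_cs u -> cont_cs v -> cont_cs (fun x => u x - v x).
Proof. by move=> cu cv; apply: cont_csD => //; exact: cont_csN. Qed.

Lemma cont_cs_norm u : cont_cs u -> cont_cs (fun x => `|u x|).
Proof.
move=> [cu [c uc]]; split=> [x|]; first by apply: cvg_norm; exact: cu.
by exists c => x /uc ->; rewrite normr0.
Qed.

Lemma cont_cs_sqr u : cont_cs u -> cont_cs (fun x => u x ^+ 2).
Proof. by move=> uc; apply: cont_csMr => //; case: uc. Qed.

Lemma supported_le c d u : c <= d -> supported c u -> supported d u.
Proof. by move=> cd uc x dx; apply: uc; exact: le_trans dx. Qed.

Lemma supported_pos u : (exists c, supported c u) -> exists2 c, 0 < c & supported c u.
Proof.
move=> [c uc]; exists (Num.max 1 c); first by rewrite lt_max ltr01.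
by apply: supported_le uc; rewrite le_max lexx orbT.
Qed.

Lemma supported_restrict c u : supported c u -> u = u \_ `[-c, c].
Proof.
move=> uc; apply/funext => x; rewrite patchE.
case: ifPn => //; rewrite notin_setE /= in_itv/= -ler_norml => /negP.
by rewrite -ltNge => /ltW /uc ->.
Qed.

Lemma Rintegral_supported c u : supported c u ->
  \int[mu]_x u x = \int[mu]_(x in `[-c, c]) u x.
Proof. by move=> uc; rewrite [RHS]Rintegral_mkcond -supported_restrict. Qed.

Lemma continuous_integrable_itv u (a b : R) : continuous u ->
  mu.-integrable `[a, b] (EFin \o u).
Proof.
move=> cu; apply: continuous_compact_integrable; first exact: segment_compact.
exact: continuous_subspaceT.
Qed.

Lemma cont_cs_integrable u : cont_cs u -> mu.-integrable setT (EFin \o u).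
Proof.
move=> [cu [c uc]]; rewrite (supported_restrict uc).
have := @continuous_integrable_itv u (-c) c cu.
move=> iu; rewrite -restrict_EFin; apply/integrable_restrict => //=.
by rewrite setTI.
Qed.

Lemma cont_cs_bounded u : cont_cs u -> exists2 M, 0 < M & forall x, `|u x| <= M.
Proof.
move=> [cu [c uc]].
have /compact_bounded[M [_ Mu]] : compact (u @` `[-c, c]).
  by apply: continuous_compact; [exact: continuous_subspaceT|exact: segment_compact].
exists (Num.max 1 (M + 1)); first by rewrite lt_max ltr01.
move=> x; rewrite le_max; have [/uc ->|xc] := leP c `|x|; first by rewrite normr0 ler01.
apply/orP; right; apply: Mu; first by rewrite ltrDl.
by exists x => //=; rewrite in_itv/= -ler_norml ltW.
Qed.

(** Compactness of [[a, b]] gives the uniform [d]; only [x] is confined to the interval. In the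
    kernel estimate [x] lies in the support while [y] runs over a whole period. *)
Lemma continuous_uniform_itv u (a b e : R) : continuous u -> 0 < e ->
  exists2 d, 0 < d & forall x y, a <= x <= b -> `|x - y| < d -> `|u x - u y| < e.
Proof.
move=> cu e0.
have cK : compact `[a, b] by exact: segment_compact.
have /compact_near_coveringP nc := cK.
pose P (d : R) (x : R) := forall y, `|x - y| < d -> `|u x - u y| < e.
have : \forall d \near (0 : R)^'+, `[a, b]%classic `<=` P d.
  apply: nc => x _.
  have e2 : 0 < e / 2 by rewrite divr_gt0.
  have /cvgrPdist_lt/(_ _ e2) := cu x.
  move=> [d /= d0 dx].
  have d2 : 0 < d / 2 by rewrite divr_gt0.
  exists (ball x (d / 2), [set r | r < d / 2]) => /=.
    split; first exact: nbhsx_ballx.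
    exact: nbhs_right_lt.
  move=> [z r] /= [xz rd] y zy.
  have h1 : `|u x - u z| < e / 2.
    by apply: dx => /=; apply: lt_le_trans xz _; lra.
  have h2 : `|u x - u y| < e / 2.
    apply: dx => /=; rewrite -(subrKA z); apply: le_lt_trans (ler_normD _ _) _.
    have : `|x - z| < d / 2 by [].
    lra.
  rewrite -(subrKA (u x)); apply: le_lt_trans (ler_normD _ _) _.
  by rewrite (distrC (u z)); lra.
move=> [d /= d0 dP].
have d2 : 0 < d / 2 by rewrite divr_gt0.
exists (d / 2) => // x y xab xy.
apply: (dP (d / 2)) => //=.
by rewrite sub0r normrN gtr0_norm//; lra.
Qed.

Lemma le_Rintegral_cs u v : cont_cs u -> cont_cs v -> (forall x, u x <= v x) ->
  \int[mu]_x u x <= \int[mu]_x v x.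
Proof.
move=> cu cv uv; apply: le_Rintegral => //; exact: cont_cs_integrable.
Qed.

Lemma RintegralD_cs u v : cont_cs u -> cont_cs v ->
  \int[mu]_x (u x + v x) = \int[mu]_x u x + \int[mu]_x v x.
Proof. by move=> cu cv; rewrite RintegralD//; exact: cont_cs_integrable. Qed.

Lemma RintegralB_cs u v : cont_cs u -> cont_cs v ->
  \int[mu]_x (u x - v x) = \int[mu]_x u x - \int[mu]_x v x.
Proof. by move=> cu cv; rewrite RintegralB//; exact: cont_cs_integrable. Qed.

Lemma RintegralZ_cs k u : cont_cs u ->
  \int[mu]_x (k * u x) = k * \int[mu]_x u x.
Proof. by move=> cu; rewrite RintegralZl//; exact: cont_cs_integrable. Qed.

Lemma RintegralN_cs u : cont_cs u -> \int[mu]_x (- u x) = - \int[mu]_x u x.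
Proof.
move=> cu; rewrite -mulN1r -RintegralZ_cs//.
by congr fine; apply: eq_integral => x _; rewrite mulN1r.
Qed.

Lemma normr_Rintegral_cs u : cont_cs u -> `|\int[mu]_x u x| <= \int[mu]_x `|u x|.
Proof. by move=> cu; apply: le_normr_Rintegral => //; exact: cont_cs_integrable. Qed.

Lemma EFin_Rintegral D u : measurable D -> mu.-integrable D (EFin \o u) ->
  (\int[mu]_(x in D) u x)%:E = (\int[mu]_(x in D) (u x)%:E)%E.
Proof.
by move=> mD iu; rewrite /Rintegral fineK//; exact: integrable_fin_num.
Qed.

End cont_compact_support.

Section continuity_rules.
Context (R : realType).
Implicit Types (f g : R -> R).

Lemma cont_cst (k : R) : continuous (fun _ : R => k).
Proof. by move=> x; exact: cvg_cst. Qed.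

Lemma cont_id : continuous (fun x : R => x).
Proof. by move=> x; exact: cvg_id. Qed.

Lemma contD f g : continuous f -> continuous g -> continuous (fun x => f x + g x).
Proof. by move=> cf cg x; apply: cvgD; [exact: cf|exact: cg]. Qed.

Lemma contN f : continuous f -> continuous (fun x => - f x).
Proof. by move=> cf x; apply: cvgN; exact: cf. Qed.

Lemma contM f g : continuous f -> continuous g -> continuous (fun x => f x * g x).
Proof. by move=> cf cg x; apply: cvgM; [exact: cf|exact: cg]. Qed.

Lemma cont_norm f : continuous f -> continuous (fun x => `|f x|).
Proof. by move=> cf x; apply: cvg_norm; exact: cf. Qed.

Lemma cont_mull (k : R) : continuous (fun x : R => k * x).
Proof. by apply: contM; [exact: cont_cst|exact: cont_id]. Qed.

Lemma cont_addl (k : R) : continuous (fun x : R => k + x).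
Proof. by apply: contD; [exact: cont_cst|exact: cont_id]. Qed.

Lemma cont_normr : continuous (fun x : R => `|x|).
Proof. by apply: cont_norm; exact: cont_id. Qed.

Lemma cont_opp : continuous (fun x : R => - x).
Proof. by apply: contN; exact: cont_id. Qed.

Lemma contX f n : continuous f -> continuous (fun x => f x ^+ n).
Proof.
move=> cf; elim: n => [|n IH]; first exact: cont_cst.
by under eq_fun do rewrite exprS; exact: contM.
Qed.

Lemma cont_comp f g : continuous f -> continuous g -> continuous (fun x => f (g x)).
Proof. by move=> cf cg x; apply: (@continuous_comp _ _ _ g f); [exact: cg|exact: cf]. Qed.

Lemma cont_cos f : continuous f -> continuous (fun x => cos (f x)).
Proof. by move=> cf; apply: cont_comp => //; exact: continuous_cos. Qed.

Lemma cont_sin f : continuous f -> continuous (fun x => sin (f x)).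
Proof. by move=> cf; apply: cont_comp => //; exact: continuous_sin. Qed.

Lemma cont_sum (I : Type) (r : seq I) (P : pred I) (F : I -> R -> R) :
  (forall k, continuous (F k)) -> continuous (fun x => \sum_(k <- r | P k) F k x).
Proof.
move=> cF; elim: r => [|k r IH].
  by under eq_fun do rewrite big_nil; exact: cont_cst.
under eq_fun do rewrite big_cons.
by case: (P k) => //; apply: contD => //; exact: cF.
Qed.

End continuity_rules.

Ltac cont := repeat (lazymatch goal with
  | |- continuous (fun _ => ?k) => exact (@cont_cst _ k)
  | |- continuous (fun x => x) => exact (@cont_id _)
  | |- continuous ( *%R ?k) => exact (@cont_mull _ k)
  | |- continuous ( +%R ?k) => exact (@cont_addl _ k)
  | |- continuous -%R => exact (@cont_opp _)
  | |- continuous (Num.norm) => exact (@cont_normr _)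
  | |- continuous (fun x => @?f x + @?g x) => apply: contD
  | |- continuous (fun x => @?f x * @?g x) => apply: contM
  | |- continuous (fun x => - @?f x) => apply: contN
  | |- continuous (fun x => @?f x ^+ _) => apply: contX
  | |- continuous (fun x => cos (@?f x)) => apply: cont_cos
  | |- continuous (fun x => sin (@?f x)) => apply: cont_sin
  | |- continuous (fun x => `|@?f x|) => apply: cont_norm
  | |- continuous (fun x => \sum_(k < _) @?f x k) => apply: cont_sum => ?
  | |- continuous _ => first [assumption
      | match goal with H : forall _, continuous _ |- _ => exact (H _) end]
  end).

(** * Real Fourier integrals *)

Section fourier.
Context (R : realType).
Local Notation mu := (@lebesgue_measure R).
Implicit Types (u v g h : R -> R).

Lemma FTC2_C1 (F f : R -> R) (a b : R) : a < b -> continuous f ->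
  (forall x : R, is_derive x 1 F (f x)) ->
  \int[mu]_(x in `[a, b]) f x = F b - F a.
Proof.
move=> ab cf dF.
have cF : continuous F.
  move=> x; apply: differentiable_continuous; apply/derivable1_diffP.
  by have [] := dF x.
rewrite /Rintegral (@continuous_FTC2 _ f F a b) //.
- exact: continuous_subspaceT.
- split.
  + by move=> x _; have [] := dF x.
  + by apply: cvg_at_right_filter; exact: cF.
  + by apply: cvg_at_left_filter; exact: cF.
- by move=> x _; rewrite derive1E; have [_ ->] := dF x.
Qed.

(** Angular frequency, without the factor 2 pi: the transform of a real [u] at [s / (2 pi)] is
    [Fcos u s - i Fsin u s], and [Fsq u s] below is its squared modulus. *)
Definition Fcos u (s : R) : R := \int[mu]_y (u y * cos (s * y)).
Definition Fsin u (s : R) : R := \int[mu]_y (u y * sin (s * y)).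

Lemma FcosN u s : Fcos u (- s) = Fcos u s.
Proof. by apply: eq_Rintegral => y _; rewrite mulNr cosN. Qed.

Lemma FsinN u s : cont_cs u -> Fsin u (- s) = - Fsin u s.
Proof.
move=> cu; rewrite /Fsin -RintegralN_cs; last by apply: cont_csMr => //; cont.
by apply: eq_Rintegral => y _; rewrite mulNr sinN mulrN.
Qed.

Lemma continuous_paramint u (k : R -> R -> R) : cont_cs u ->
  (forall s, continuous (k s)) -> (forall y, continuous (k^~ y)) ->
  (forall s y, `|k s y| <= 1) ->
  continuous (fun s => \int[mu]_y (u y * k s y)).
Proof.
move=> cu ck1 ck2 kb s.
apply: (@continuity_under_integral _ _ _ mu (fun s y => u y * k s y) setT
  measurableT (s - 1) (s + 1) _ _ (fun y => `|u y|)).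
- by move=> x _; apply: cont_cs_integrable; apply: cont_csMr.
- apply: aeW => y _ x _; by apply: cvgM; [exact: cvg_cst|exact: ck2].
- by apply: cont_cs_integrable; exact: cont_cs_norm.
- by move=> x _; apply: aeW => y _; rewrite normrM ler_piMr.
- by rewrite inE/= in_itv/=; apply/andP; split; lra.
Qed.

Lemma sin_max (x : R) : `|sin x| <= 1.
Proof. by rewrite ler_norml sin_geN1 sin_le1. Qed.

Lemma continuous_Fcos u : cont_cs u -> continuous (Fcos u).
Proof.
move=> cu; apply: continuous_paramint => // [s|y|s y]; [cont|cont|exact: cos_max].
Qed.

Lemma continuous_Fsin u : cont_cs u -> continuous (Fsin u).
Proof.
move=> cu; apply: continuous_paramint => // [s|y|s y]; [cont|cont|exact: sin_max].
Qed.

Definition Fsq u (s : R) : R := Fcos u s ^+ 2 + Fsin u s ^+ 2.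

Lemma Fsq_ge0 u s : 0 <= Fsq u s.
Proof. by rewrite addr_ge0// sqr_ge0. Qed.

Lemma continuous_Fsq u : cont_cs u -> continuous (Fsq u).
Proof.
move=> cu; have cc := continuous_Fcos cu; have cs := continuous_Fsin cu.
by rewrite /Fsq; cont.
Qed.

(** Together with [Fcos_shift] this writes the squared modulus as the iterated integral of u(y) u(z)
    cos(s (y - z)), by linearity alone and without Fubini. *)
Lemma Fsq_integral u s : cont_cs u ->
  Fsq u s = \int[mu]_y (u y * (cos (s * y) * Fcos u s + sin (s * y) * Fsin u s)).
Proof.
move=> cu; rewrite /Fsq !expr2 {2}/Fcos {2}/Fsin.
rewrite -!RintegralZ_cs; try by apply: cont_csMr => //; cont.
rewrite -RintegralD_cs; try by apply: cont_csZ; apply: cont_csMr => //; cont.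
by apply: eq_Rintegral => y _; ring.
Qed.

Lemma Fcos_shift u s y : cont_cs u ->
  cos (s * y) * Fcos u s + sin (s * y) * Fsin u s =
  \int[mu]_z (u z * cos (s * (y - z))).
Proof.
move=> cu; rewrite /Fcos /Fsin -!RintegralZ_cs; try by apply: cont_csMr => //; cont.
rewrite -RintegralD_cs; try by apply: cont_csZ; apply: cont_csMr => //; cont.
by apply: eq_Rintegral => z _; rewrite mulrBr cosB; ring.
Qed.

End fourier.

(** * Parseval and Plancherel *)

Section fejer.
Context (R : realType).
Local Notation mu := (@lebesgue_measure R).
Implicit Types (u v g h : R -> R).

(* [f k] stands for the common value at [k] and [- k] of an even sequence indexed by the
   integers: [sym_sum f j] adds the terms of index at most [j] in absolute value. *)
Definition sym_sum (f : nat -> R) (j : nat) : R := f 0%N + 2 * \sum_(k < j) f k.+1.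
Definition fejer_sum (f : nat -> R) (N : nat) : R := \sum_(j < N) sym_sum f j.

Lemma fejer_sumZ (c : R) (f : nat -> R) N :
  fejer_sum (fun k => c * f k) N = c * fejer_sum f N.
Proof.
rewrite mulr_sumr; apply: eq_bigr => j _.
by rewrite /sym_sum mulrDr mulrCA -mulr_sumr.
Qed.

Lemma sym_sumS f j : sym_sum f j.+1 = sym_sum f j + 2 * f j.+1.
Proof. by rewrite /sym_sum big_ord_recr/= mulrDr addrA. Qed.

Lemma fejer_sumS f N : fejer_sum f N.+1 = fejer_sum f N + sym_sum f N.
Proof. by rewrite /fejer_sum big_ord_recr. Qed.

(** Two telescoping sums. The Dirichlet kernel times 1 - cos t is cos(j t) - cos((j+1) t), and
    summing over j leaves the two end terms. Keeping the factor 1 - cos t on the left avoids a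
    division by zero at the multiples of 2 pi. *)
Lemma fejer_closed (t : R) N :
  fejer_sum (fun k => cos (k%:R * t)) N * (1 - cos t) = 1 - cos (N%:R * t).
Proof.
have D j : sym_sum (fun k => cos (k%:R * t)) j * (1 - cos t) =
    cos (j%:R * t) - cos (j.+1%:R * t).
  elim: j => [|j IH]; first by rewrite /sym_sum big_ord0 mulr0 addr0 mul0r cos0 mul1r mul1r.
  rewrite sym_sumS mulrDl IH.
  rewrite (_ : j.+2%:R * t = j.+1%:R * t + t); last by rewrite -[in LHS]addn1 natrD mulrDl mul1r.
  rewrite (_ : j%:R * t = j.+1%:R * t - t); last by rewrite -[in RHS]addn1 natrD mulrDl mul1r addrK.
  by rewrite cosB cosD; ring.
elim: N => [|N IH]; first by rewrite /fejer_sum big_ord0 !mul0r cos0 subrr.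
by rewrite fejer_sumS mulrDl IH D; ring.
Qed.

Lemma fejer_ge0 (t : R) N : 0 <= fejer_sum (fun k => cos (k%:R * t)) N.
Proof.
(* At the zeros of 1 - cos t the closed form says nothing, but there every cosine in the sum equals
   1. *)
have := cos_le1 t; rewrite le_eqVlt => /predU1P[c1|c1].
  have s0 : sin t = 0.
    by apply/eqP; rewrite -sqrf_eq0 sin2cos2 c1 expr1n subrr.
  have ck k : cos (k%:R * t) = 1 /\ sin (k%:R * t) = 0.
    elim: k => [|k [IHc IHs]]; first by rewrite mul0r cos0 sin0.
    by rewrite -addn1 natrD mulrDl mul1r cosD sinD IHc IHs c1 s0; split; ring.
  apply: sumr_ge0 => j _; rewrite addr_ge0// ?(ck 0%N).1//.
  by rewrite mulr_ge0//; apply: sumr_ge0 => k _; rewrite (ck k.+1).1.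
have h : 0 <= fejer_sum (fun k => cos (k%:R * t)) N * (1 - cos t).
  by rewrite fejer_closed subr_ge0 cos_le1.
by rewrite -(pmulr_lge0 _ (_ : 0 < 1 - cos t))// subr_gt0.
Qed.

Lemma Rintegral_sum_itv (a b : R) n (F : nat -> R -> R) : (forall k, continuous (F k)) ->
  \int[mu]_(x in `[a, b]) (\sum_(k < n) F k x) = \sum_(k < n) \int[mu]_(x in `[a, b]) F k x.
Proof.
move=> cF; elim: n => [|n IH].
  rewrite big_ord0; under eq_Rintegral do rewrite big_ord0.
  by rewrite Rintegral_cst// mul0r.
rewrite big_ord_recr/= -IH -RintegralD//.
- by apply: eq_Rintegral => x _; rewrite big_ord_recr.
- by apply: continuous_integrable_itv; cont.
- exact: continuous_integrable_itv.
Qed.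

Lemma cont_sym_sum (F : nat -> R -> R) j : (forall k, continuous (F k)) ->
  continuous (fun x => sym_sum (F^~ x) j).
Proof. by move=> cF; rewrite /sym_sum; cont. Qed.

Lemma cont_fejer_sum (F : nat -> R -> R) N : (forall k, continuous (F k)) ->
  continuous (fun x => fejer_sum (F^~ x) N).
Proof. by move=> cF; rewrite /fejer_sum; apply: cont_sum => j; exact: cont_sym_sum. Qed.

Lemma Rintegral_fejer_itv (a b : R) N (F : nat -> R -> R) : (forall k, continuous (F k)) ->
  \int[mu]_(x in `[a, b]) fejer_sum (F^~ x) N =
  fejer_sum (fun k => \int[mu]_(x in `[a, b]) F k x) N.
Proof.
move=> cF; rewrite /fejer_sum (@Rintegral_sum_itv _ _ _ (fun j x => sym_sum (F^~ x) j)); last by move=> j; exact: cont_sym_sum.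
apply: eq_bigr => j _; rewrite /sym_sum RintegralD//; last 2 first.
- exact: continuous_integrable_itv.
- by apply: continuous_integrable_itv; cont.
rewrite RintegralZl//; last by apply: continuous_integrable_itv; cont.
by rewrite (@Rintegral_sum_itv _ _ _ (fun k => F k.+1)).
Qed.

Lemma Rintegral_fejer_cs u N (F : nat -> R -> R) : cont_cs u -> (forall k, continuous (F k)) ->
  \int[mu]_x (u x * fejer_sum (F^~ x) N) = fejer_sum (fun k => \int[mu]_x (u x * F k x)) N.
Proof.
move=> [cu [c uc]] cF.
have sM (h : R -> R) : supported c (fun x => u x * h x) by move=> x /uc ->; rewrite mul0r.
rewrite (Rintegral_supported (sM _)).
transitivity (\int[mu]_(x in `[-c, c]) (fejer_sum (fun k => u x * F k x) N)).
  by apply: eq_Rintegral => x _; rewrite fejer_sumZ.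
rewrite (@Rintegral_fejer_itv _ _ _ (fun k x => u x * F k x)); last by move=> k; cont.
congr (fejer_sum _ N); apply/funext => k.
by rewrite (Rintegral_supported (sM _)).
Qed.

Lemma Rintegral_cos_period (T y : R) k : 0 < T ->
  \int[mu]_(z in `[-(T / 2), T / 2]) cos (k%:R * (2 * pi / T * (y - z))) =
  if k == 0%N then T else 0.
Proof.
move=> T0; have T20 : - (T / 2) < T / 2 by lra.
case: eqVneq => [->|k0].
  under eq_Rintegral do rewrite mul0r cos0.
  rewrite Rintegral_cst//= lebesgue_measure_itv/= lte_fin T20/= mul1r; lra.
set w := 2 * pi / T.
have w0 : 0 < w by rewrite divr_gt0// mulr_gt0// pi_gt0.
have kw0 : k%:R * w != 0 by rewrite mulf_neq0 ?gt_eqF// ltr0n lt0n.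
have dF (x : R) : is_derive x 1 (fun z => - (k%:R * w)^-1 * sin (k%:R * (w * (y - z))))
    (cos (k%:R * (w * (y - x)))).
  have h : is_derive x 1 (fun z : R => k%:R * (w * (y - z))) (- (k%:R * w)).
    by apply: is_derive_eq; rewrite !(scaler0, add0r, addr0, scale0r)/= /GRing.scale/=; ring.
  have h2 : is_derive x 1 (fun z : R => sin (k%:R * (w * (y - z))))
      (cos (k%:R * (w * (y - x))) * - (k%:R * w)).
    exact: is_derive1_comp.
  apply: is_derive_eq; rewrite /GRing.scale/= mulrN mulrNN mulrCA mulVf ?mulr1//.
rewrite (FTC2_C1 T20 _ dF); last by cont.
have -> : k%:R * (w * (y - T / 2)) = k%:R * (w * (y - - (T / 2))) - (pi *+ 2) *+ k.
  by rewrite -[(pi *+ 2) *+ k]mulr_natl -[pi *+ 2]mulr_natl /w; field; exact: lt0r_neq0.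
set b := k%:R * (w * (y - - _)).
have -> : sin (b - (pi *+ 2) *+ k) = sin b.
  by rewrite -(periodicn (@sinD2pi R) k (b - _)) subrK.
by rewrite subrr.
Qed.

(** Every nonconstant cosine integrates to zero over a period, so each of the [N] partial sums
    contributes only its term of index 0, which is [T]. *)
Lemma Rintegral_fejer_period (T y : R) N : 0 < T ->
  \int[mu]_(z in `[-(T / 2), T / 2]) fejer_sum (fun k => cos (k%:R * (2 * pi / T * (y - z)))) N
  = T * N%:R.
Proof.
move=> T0; rewrite (@Rintegral_fejer_itv _ _ _ (fun k z => cos (k%:R * (2 * pi / T * (y - z))))).
  under eq_fun do rewrite Rintegral_cos_period//.
  rewrite /fejer_sum -[T * _]/(T *+ 1 * N%:R) mulr_natr -[in RHS](card_ord N) -sumr_const.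
  apply: eq_bigr => j _; rewrite /sym_sum/= big1 ?mulr0 ?addr0 ?mulr1n//.
by move=> k; cont.
Qed.

End fejer.

(** * Parseval on a period, by Fejér summation *)

Section parseval.
Context (R : realType).
Local Notation mu := (@lebesgue_measure R).
Implicit Types (u v g h : R -> R).

Lemma sym_sum_nondecreasing (f : nat -> R) i j : (forall k, 0 <= f k) ->
  (i <= j)%N -> sym_sum f i <= sym_sum f j.
Proof.
move=> f0 /subnK <-; elim: (j - i)%N => [//|k IH].
by rewrite addSn sym_sumS (le_trans IH)// lerDl mulr_ge0.
Qed.

Lemma sym_sum_ge0 (f : nat -> R) j : (forall k, 0 <= f k) -> 0 <= sym_sum f j.
Proof. by move=> f0; rewrite addr_ge0// mulr_ge0// sumr_ge0. Qed.

(** A Tauberian statement: for nonnegative terms, Cesàro convergence implies convergence. The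
    partial sums increase, so none can exceed [L] without dragging the means above [L], and the
    means are at most the last partial sum. The error N e + C leaves room for a bounded part,
    negligible after division by N. *)
Lemma cvg_sym_sum (f : nat -> R) (L : R) : (forall k, 0 <= f k) ->
  (forall e, 0 < e -> exists C, forall N, `|fejer_sum f N - N%:R * L| <= N%:R * e + C) ->
  sym_sum f j @[j --> \oo] --> L.
Proof.
move=> f0 H.
have SL j : sym_sum f j <= L.
  rewrite leNgt; apply/negP => Lj.
  have [C HC] := H ((sym_sum f j - L) / 2) ltac:(lra).
  set S := sym_sum f j in Lj HC *.
  (* From index [j] on each partial sum is at least [S], so the Fejér sum is at least (N - j) S; the
     size of [N] makes this exceed N L + N (S - L) / 2 + C. *)
  pose N := (j + (Num.truncn ((j%:R * S + `|C|) / ((S - L) / 2))).+1)%N.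
  have h1 : (N%:R - j%:R) * S <= fejer_sum f N.
    have : forall M, (M%:R) * S <= fejer_sum f (j + M).
      elim=> [|M IH]; first by rewrite mul0r sumr_ge0// => i _; exact: sym_sum_ge0.
      rewrite addnS fejer_sumS -natr1 mulrDl mul1r lerD//.
      by apply: sym_sum_nondecreasing => //; rewrite leq_addr.
    by move=> /(_ (N - j)%N); rewrite subnKC ?leq_addr// natrB// leq_addr.
  have := HC N; rewrite ler_norml => /andP[_ h2].
  have h3 : (j%:R * S + `|C|) < N%:R * ((S - L) / 2).
    rewrite -ltr_pdivrMr; last by lra.
    apply: lt_le_trans (truncnS_gt _) _.
    by rewrite ler_nat leq_addl.
  have := ler_norm C; lra.
apply/cvgrPdist_le => e e0.
have e2 : 0 < e / 2 by rewrite divr_gt0.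
have [C HC] := H _ e2.
exists (Num.truncn (`|C| / (e / 2))).+1 => // N /= hN.
have hN2 : `|C| < N%:R * (e / 2).
  rewrite -ltr_pdivrMr//; apply: lt_le_trans (truncnS_gt _) _.
  by rewrite ler_nat.
have N0 : 0 < N%:R :> R by rewrite ltr0n; exact: leq_trans hN.
have := HC N; rewrite ler_norml => /andP[h2 _].
have h3 : fejer_sum f N <= N%:R * sym_sum f N.
  apply: (@le_trans _ _ (\sum_(i < N) sym_sum f N)).
    by apply: ler_sum => i _; apply: sym_sum_nondecreasing => //; exact: ltnW.
  by rewrite sumr_const card_ord mulr_natl.
have := ler_norm C => hC.
rewrite ger0_norm ?subr_ge0// -(ler_pM2l N0); lra.
Qed.

Lemma cos_le_away (t d : R) : 0 <= d -> d <= `|t| -> `|t| <= 2 * pi - d -> cos t <= cos d.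
Proof.
move=> d0 dt td; rewrite -(cos_norm t).
have [tp|pt] := leP `|t| pi.
  by rewrite leNgt ltr_cos ?in_itv/= -?leNgt//; apply/andP; split; lra.
have -> : cos `|t| = cos (2 * pi - `|t|).
  by rewrite mulr_natl -[RHS]cosN opprB -[RHS]cosD2pi subrK.
by rewrite leNgt ltr_cos ?in_itv/= -?leNgt//; first [lra | apply/andP; split; lra].
Qed.

(** The closed form has right-hand side at most 2, and 1 - cos t is at least 1 - cos d away from the
    multiples of 2 pi: the bound does not depend on [N]. *)
Lemma fejer_away (t d : R) N : 0 < d -> d <= pi -> d <= `|t| -> `|t| <= 2 * pi - d ->
  fejer_sum (fun k => cos (k%:R * t)) N <= 2 / (1 - cos d).
Proof.
move=> d0 dp dt td.
have cd : cos d < 1 by rewrite -cos0 ltr_cos// in_itv/= ?lexx ?pi_ge0// (ltW d0).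
have ct := cos_le_away (ltW d0) dt td.
have D0 : 0 < 1 - cos d by lra.
rewrite ler_pdivlMr//.
apply: le_trans (_ : fejer_sum (fun k => cos (k%:R * t)) N * (1 - cos t) <= _).
  by rewrite ler_wpM2l ?fejer_ge0// lerD2l lerN2.
by rewrite fejer_closed; have := cos_geN1 (N%:R * t); lra.
Qed.

(** [T N] is the mass of the nonnegative kernel over a period, so the error is the integral of u(z)
    - u(y) against the kernel. For z near y uniform continuity bounds the difference by e/T;
    elsewhere the kernel is bounded and contributes only a constant. *)
Lemma cvg_fejer_pointwise u (c T e : R) : continuous u -> supported c u ->
  0 <= c -> c < T / 2 -> 0 < e ->
  exists C, forall N y, `|y| <= c ->
  `|\int[mu]_z (u z * fejer_sum (fun k => cos (k%:R * (2 * pi / T * (y - z)))) N)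
     - N%:R * (T * u y)| <= N%:R * e + C.
Proof.
move=> cu uc c0 cT e0.
have T0 : 0 < T by lra.
have cc : cont_cs u by split=> //; exists c.
have [M M0 Mu] := cont_cs_bounded cc.
have eT : 0 < e / T by rewrite divr_gt0.
have [d d0 dP] := continuous_uniform_itv (- c) c cu eT.
set w := 2 * pi / T.
have w0 : 0 < w by rewrite divr_gt0// mulr_gt0// pi_gt0.
(* The second bound in the minimum gives |y - z| <= c + T/2 <= T - d', which keeps y - z away from
   the next peaks of the kernel, at -T and T. *)
pose d' := Num.min d (T / 2 - c).
have d'0 : 0 < d' by rewrite lt_min d0/=; lra.
have d'd : d' <= d by rewrite ge_min lexx.
have d'T : d' <= T / 2 - c by rewrite ge_min lexx orbT.
have wT : w * T = 2 * pi by rewrite /w divfK// gt_eqF.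
pose C := 2 / (1 - cos (w * d')).
exists (2 * M * C * T) => N y yc.
pose K z := fejer_sum (fun k => cos (k%:R * (w * (y - z)))) N.
have cK : continuous K by apply: (@cont_fejer_sum _ (fun k z => _)) => k; cont.
have K0 z : 0 <= K z by exact: fejer_ge0.
have uT : supported (T / 2) u by apply: supported_le uc; lra.
have C0 : 0 <= C by rewrite divr_ge0// subr_ge0 cos_le1.
rewrite (@Rintegral_supported _ (T / 2)); last by move=> z /uT ->; rewrite mul0r.
have TT : - (T / 2) <= T / 2 by lra.
have -> : N%:R * (T * u y) = \int[mu]_(z in `[- (T / 2), T / 2]) (u y * K z).
  rewrite RintegralZl//; last exact: continuous_integrable_itv.
  by rewrite Rintegral_fejer_period//; ring.
rewrite -RintegralB//; try by apply: continuous_integrable_itv; cont.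
apply: le_trans (le_normr_Rintegral _ _) _ => //.
  by apply: continuous_integrable_itv; cont.
apply: (@le_trans _ _ (\int[mu]_(z in `[- (T / 2), T / 2]) (e / T * K z + 2 * M * C))).
  apply: le_Rintegral => //; try by apply: continuous_integrable_itv; cont.
  move=> z; rewrite /= in_itv/= -ler_norml => zT.
  rewrite -mulrBl normrM (ger0_norm (K0 z)).
  have [yz|yz] := ltP `|y - z| d'.
    have h : `|u z - u y| <= e / T.
      rewrite distrC ltW// dP//; first by rewrite -ler_norml.
      exact: lt_le_trans d'd.
    rewrite (le_trans (ler_wpM2r (K0 z) h))// lerDl.
    by rewrite !mulr_ge0// ltW.
  have h1 : `|u z - u y| <= 2 * M.
    by apply: le_trans (ler_normB _ _) _; have := Mu z; have := Mu y; lra.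
  have h2 : K z <= C.
    have yzT : `|y - z| <= T - d'.
      by apply: le_trans (ler_normB _ _) _; lra.
    apply: fejer_away.
    - by rewrite mulr_gt0.
    - have : w * d' <= w * (T / 2) by rewrite ler_pM2l//; lra.
      by lra.
    - by rewrite normrM (gtr0_norm w0) ler_pM2l.
    - rewrite normrM (gtr0_norm w0).
      have : w * `|y - z| <= w * (T - d') by rewrite ler_pM2l.
      by lra.
  apply: (@le_trans _ _ (2 * M * C)).
    by apply: ler_pM.
  by rewrite lerDr mulr_ge0// ltW.
rewrite RintegralD//; try by apply: continuous_integrable_itv; cont.
rewrite RintegralZl//; last exact: continuous_integrable_itv.
rewrite Rintegral_fejer_period// Rintegral_cst//= lebesgue_measure_itv/= lte_fin.
rewrite ifT; last by lra.
rewrite /= (_ : e / T * (T * N%:R) = N%:R * e); last by field; rewrite gt_eqF.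
by rewrite lerD2l (_ : T / 2 - - (T / 2) = T); [|lra].
Qed.

(** The Fejér sum of the squares is the integral of u(y) times the integral of u against the kernel
    centred at y. The pointwise estimate is uniform only for |y| <= c, and the factor u(y) discards
    the rest. *)
Lemma parseval_sym u (c T : R) : continuous u -> supported c u ->
  0 <= c -> c < T / 2 ->
  sym_sum (fun k => Fsq u (k%:R * (2 * pi / T))) j @[j --> \oo]
  --> T * \int[mu]_y (u y ^+ 2).
Proof.
move=> cu uc c0 cT.
have T0 : 0 < T by lra.
have cc : cont_cs u by split=> //; exists c.
apply: cvg_sym_sum => [k|e e0]; first exact: Fsq_ge0.
set I := \int[mu]_y `|u y|.
have I0 : 0 <= I by exact: Rintegral_ge0.
have e'0 : 0 < e / (I + 1) by rewrite divr_gt0//; lra.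
have [C HC] := cvg_fejer_pointwise cu uc c0 cT e'0.
exists (`|C| * I) => N.
pose J k y := cos (k%:R * (2 * pi / T) * y) * Fcos u (k%:R * (2 * pi / T)) +
  sin (k%:R * (2 * pi / T) * y) * Fsin u (k%:R * (2 * pi / T)).
have cJ k : continuous (J k) by rewrite /J; cont.
have -> : fejer_sum (fun k => Fsq u (k%:R * (2 * pi / T))) N =
    \int[mu]_y (u y * fejer_sum (J^~ y) N).
  rewrite Rintegral_fejer_cs//; congr (fejer_sum _ N); apply/funext => k.
  exact: Fsq_integral.
have JE y : fejer_sum (J^~ y) N =
    \int[mu]_z (u z * fejer_sum (fun k => cos (k%:R * (2 * pi / T * (y - z)))) N).
  rewrite (@Rintegral_fejer_cs _ u N (fun k z => cos (k%:R * (2 * pi / T * (y - z)))))//.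
    congr (fejer_sum _ N); apply/funext => k; rewrite /J Fcos_shift//.
    by apply: eq_Rintegral => z _; rewrite !mulrA.
  by move=> k; cont.
have cF : continuous (fun y => fejer_sum (J^~ y) N) by exact: cont_fejer_sum.
rewrite -RintegralZ_cs; last exact: cont_cs_sqr.
rewrite -RintegralZ_cs; last by apply: cont_csZ; exact: cont_cs_sqr.
rewrite -RintegralB_cs; last 2 first.
  exact: cont_csMr.
  by apply: cont_csZ; apply: cont_csZ; exact: cont_cs_sqr.
apply: le_trans (normr_Rintegral_cs _) _.
  apply: cont_csB; first exact: cont_csMr.
  by apply: cont_csZ; apply: cont_csZ; exact: cont_cs_sqr.
apply: (@le_trans _ _ (\int[mu]_y ((N%:R * (e / (I + 1)) + `|C|) * `|u y|))).
  apply: le_Rintegral_cs.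
  - apply: cont_cs_norm; apply: cont_csB; first exact: cont_csMr.
    by apply: cont_csZ; apply: cont_csZ; exact: cont_cs_sqr.
  - by apply: cont_csZ; exact: cont_cs_norm.
  move=> y; have [/uc ->|yc] := leP c `|y|.
    by rewrite normr0 expr0n/= !(mulr0, mul0r) subrr normr0.
  rewrite (_ : _ - _ = u y * (fejer_sum (J^~ y) N - N%:R * (T * u y))); last by ring.
  rewrite normrM mulrC ler_wpM2r// JE.
  apply: le_trans (HC N y (ltW yc)) _.
  by rewrite lerD2l ler_norm.
rewrite RintegralZ_cs; last exact: cont_cs_norm.
rewrite -/I mulrDl lerD2r -mulrA ler_wpM2l//.
by rewrite mulrAC ler_pdivrMr ?ler_pM2l//; lra.
Qed.

End parseval.

(** * Sums over the integers and the Plancherel identity *)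

Section parseval_int.
Context (R : realType).
Local Notation mu := (@lebesgue_measure R).
Implicit Types (u v g h : R -> R).

Lemma esum_int_split (a : int -> \bar R) : (forall k, (0 <= a k)%E) ->
  (\esum_(k in [set: int]) a k = \sum_(k <oo) (a (Posz k) + a (Negz k)))%E.
Proof.
move=> a0; rewrite nneseries_esumT; last by move=> k; rewrite adde_ge0.
rewrite esumD// (esumID (range Posz))// setTI setTI.
rewrite (_ : ~` range Posz = range Negz).
  by rewrite !esum_image// => x y _ _ [].
apply/seteqP; split=> [[k|k] /= h|_ [k _ <-] [j _]//].
  by exfalso; apply: h; exists k.
by exists k.
Qed.

Lemma esum_int_cvg (a : int -> R) (L : R) : (forall k, 0 <= a k) ->
  (a 0 + \sum_(k < j) (a k.+1%:Z + a (- k.+1%:Z))) @[j --> \oo] --> L ->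
  (\esum_(k in [set: int]) (a k)%:E = L%:E)%E.
Proof.
move=> a0; set S := (S in S @ \oo --> _) => SL.
rewrite esum_int_split; last by move=> k; rewrite lee_fin.
apply: cvg_lim => //.
(* Integers come in pairs [Posz k], [Negz k], and [Negz k] is -(k+1). The sum of the first j+1 pairs
   is the symmetric sum up to j plus one extra negative index, so it lies between two consecutive
   symmetric sums. *)
pose T j := \sum_(0 <= k < j) (a (Posz k) + a (Negz k)).
have -> : (fun n => \sum_(0 <= k < n) ((a (Posz k))%:E + (a (Negz k))%:E))%E = EFin \o T.
  apply/funext => n /=; rewrite /T -sumEFin; apply: eq_bigr => k _.
  by rewrite EFinD.
apply: cvg_EFin; first exact: nearW.
rewrite -cvg_shiftS/=.
have ST j : S j + a (Negz j) = T j.+1.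
  rewrite /S /T; elim: j => [|j IH].
    by rewrite big_ord0 big_nat1 addr0.
  by rewrite big_ord_recr/= [RHS]big_nat_recr//= -IH NegzE; ring.
have SS j : S j <= T j.+1 <= S j.+1.
  by rewrite -ST lerDl a0/= /S big_ord_recr/= NegzE; have := a0 j.+1; lra.
apply: (@squeeze_cvgr _ _ _ _ S (fun j => S j.+1)) => //; first exact: nearW.
by rewrite (cvg_shiftS S).
Qed.

(** Parseval for the complex function u + i v: the two squares are those of the real and imaginary
    parts of its transform. Their cross terms change sign with k, so they cancel when k and -k are
    added. *)
Lemma parseval_pair u v (c T : R) : continuous u -> supported c u ->
  continuous v -> supported c v -> 0 <= c -> c < T / 2 ->
  let w (k : int) : R := k%:~R * (2 * pi / T) in
  (\esum_(k in [set: int]) ((Fcos u (w k) + Fsin v (w k)) ^+ 2 +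
      (Fsin u (w k) - Fcos v (w k)) ^+ 2)%:E =
   (T * (\int[mu]_y (u y ^+ 2) + \int[mu]_y (v y ^+ 2)))%:E)%E.
Proof.
move=> cu uc cv vc c0 cT w; apply: esum_int_cvg.
  by move=> k; rewrite addr_ge0// sqr_ge0.
have ccu : cont_cs u by split=> //; exists c.
have ccv : cont_cs v by split=> //; exists c.
rewrite mulrDr.
apply: (cvg_trans _ (cvgD (parseval_sym cu uc c0 cT) (parseval_sym cv vc c0 cT))).
apply: near_eq_cvg; apply: nearW => j /=.
transitivity (sym_sum (fun k => Fsq u (k%:R * (2 * pi / T))) j +
  sym_sum (fun k => Fsq v (k%:R * (2 * pi / T))) j); first by [].
rewrite /sym_sum addrACA; congr (_ + _).
  have -> : w 0 = 0 by rewrite /w mul0r.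
  have F0 g : Fsin g 0 = 0.
    rewrite /Fsin; under eq_Rintegral do rewrite mul0r sin0 mulr0.
    by rewrite Rintegral_cst// mul0r.
  by rewrite mul0r /Fsq !F0; ring.
rewrite -mulrDr -big_split/= mulr_sumr; apply: eq_bigr => k _.
have -> : w (- k.+1%:Z) = - w k.+1 by rewrite /w rmorphN mulNr.
rewrite !FcosN !FsinN// /Fsq /w -pmulrn; ring.
Qed.

Lemma translation_itv g (a b r : R) : a < b -> continuous g ->
  (\int[mu]_(x in `[(a + r)%R, (b + r)%R]) (g x)%:E =
   \int[mu]_(x in `[a, b]) (g (x + r))%:E)%E.
Proof.
move=> ab cg.
have dF (x : R) : is_derive x 1 (fun x : R => x + r) 1.
  by apply: is_derive_eq; rewrite addr0.
have F1 : derive1 (fun x : R => x + r) = cst 1.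
  by apply/funext => x; rewrite derive1E; have [_ ->] := dF x.
rewrite (@integration_by_substitution_increasing _ (fun x => x + r) g a b) ?F1//.
- by apply: eq_integral => x _ /=; rewrite /GRing.mul/= mulr1.
- exact: ltW.
- by move=> x y _ _; rewrite ltrD2r.
- by move=> x _; exact: cst_continuous.
- exact: is_cvg_cst.
- exact: is_cvg_cst.
- have cF : continuous (fun x : R => x + r) by cont.
  split; first by move=> x _; have [] := dF x.
  + by apply: cvg_at_right_filter; exact: cF.
  + by apply: cvg_at_left_filter; exact: cF.
- exact: continuous_subspaceT.
Qed.

Lemma continuous_EFin_measurable (D : set (measurableTypeR R)) g : continuous g ->
  measurable D -> measurable_fun D (EFin \o g).
Proof.
move=> cg mD; apply/measurable_EFinP; apply: measurable_funTS.
exact: continuous_measurable_fun.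
Qed.

(** An enumeration of the integers that turns unordered sums into series, for which summation and
    integration can be exchanged. *)
Definition int_of_nat (n : nat) : int := if odd n then Negz n./2 else Posz n./2.

Lemma int_of_nat_bij : set_bij [set: nat] [set: int] int_of_nat.
Proof.
split=> //.
- move=> m n _ _; rewrite /int_of_nat.
  have := odd_double_half m; have := odd_double_half n.
  by case: (odd m); case: (odd n) => // + + [E]; rewrite E => -> ->.
- move=> [k|k] _.
    by exists k.*2 => //; rewrite /int_of_nat odd_double doubleK.
  exists k.*2.+1 => //; rewrite /int_of_nat/= odd_double/=.
  by rewrite uphalf_double.
Qed.

Lemma integral_esum_itv g (d : R) : 0 < d -> continuous g -> (forall x, 0 <= g x) ->
  (\int[mu]_x (g x)%:E =
   \int[mu]_(x in `[0%R, d]) (\esum_(k in [set: int]) (g (x + k%:~R * d))%:E))%E.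
Proof.
move=> d0 cg g0.
pose e := int_of_nat.
pose I n := `[(e n)%:~R * d, ((e n)%:~R + 1) * d[%classic : set R.
have UI : \bigcup_n I n = [set: R].
  rewrite -subTset => x _.
  have [n _ en] : (e @` [set: nat]) (Num.floor (x / d)).
    by have [_ _] := int_of_nat_bij; exact.
  exists n => //; rewrite /I /= in_itv/= en.
  rewrite -ler_pdivlMr// -ltr_pdivrMr//.
  by rewrite floor_le_tmp/= -[X in _ + X]/(1%:~R) -intrD floorD1_gt.
have tI : trivIset [set: nat] I.
  apply/trivIsetP => m n _ _ mn; rewrite -subset0 => x [] /=.
  rewrite /I /= !in_itv/= -!ler_pdivlMr// -!ltr_pdivrMr// => /andP[h1 h2] /andP[h3 h4].
  have h (k : int) : k%:~R <= x / d -> x / d < k%:~R + 1 -> Num.floor (x / d) = k.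
    by move=> ? ?; apply: floor_def; rewrite intrD; apply/andP; split.
  have [_ inj _] := int_of_nat_bij.
  move/eqP : mn; apply; apply: inj; rewrite ?inE//.
  by rewrite -/e -(h _ h1 h2) -(h _ h3 h4).
rewrite -[in LHS]UI ge0_integral_bigcup//; last 3 first.
  by move=> k; exact: measurable_itv.
  by rewrite UI; exact: continuous_EFin_measurable.
  by move=> x _; rewrite lee_fin.
transitivity (\sum_(0 <= n <oo) \int[mu]_(x in `[0%R, d]) (g (x + (e n)%:~R * d))%:E)%E.
  apply: eq_eseriesr => n _.
  rewrite integral_itv_bndo_bndc; last first.
    exact: continuous_EFin_measurable.
  rewrite -translation_itv//.
  by congr integral; congr [set` _]; rewrite add0r mulrDl mul1r addrC.
rewrite -integral_nneseries//; last 2 first.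
  move=> n; apply: (@continuous_EFin_measurable _ (fun x => g (x + (e n)%:~R * d))) => //.
  by apply: cont_comp => //; cont.
  by move=> n x _; rewrite lee_fin.
apply: eq_integral => x _.
rewrite (reindex_esum _ _ _ _ int_of_nat_bij) nneseries_esumT// => n.
by rewrite lee_fin.
Qed.

(** Modulation: moving the frequency by t multiplies g by cos(t y) - i sin(t y), and the two parts
    of this product are the pair fed to [parseval_pair]. *)
Lemma Fcos_add g s t : cont_cs g -> Fcos g (s + t) =
  Fcos (fun y => g y * cos (t * y)) s + Fsin (fun y => - (g y * sin (t * y))) s.
Proof.
move=> cg; rewrite /Fcos /Fsin -RintegralD_cs.
- by apply: eq_Rintegral => y _; rewrite mulrDl cosD; ring.
- by do 2 (apply: cont_csMr; last by cont).
- by apply: cont_csMr; [apply: cont_csN; apply: cont_csMr => //|]; cont.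
Qed.

Lemma Fsin_add g s t : cont_cs g -> Fsin g (s + t) =
  Fsin (fun y => g y * cos (t * y)) s - Fcos (fun y => - (g y * sin (t * y))) s.
Proof.
move=> cg; rewrite /Fcos /Fsin -RintegralB_cs.
- by apply: eq_Rintegral => y _; rewrite mulrDl sinD; ring.
- by do 2 (apply: cont_csMr; last by cont).
- by apply: cont_csMr; [apply: cont_csN; apply: cont_csMr => //|]; cont.
Qed.

(** For each t the samples of the transform at t + k/T are the Fourier coefficients of a modulated g
    on a period T, so their squares sum to T times the integral of g^2, whatever t is. Integrating
    over t in [0, 1/T] covers the frequency axis once. *)
Theorem plancherel g : cont_cs g ->
  (\int[mu]_y (Fsq g (2 * pi * y))%:E = (\int[mu]_x (g x ^+ 2))%:E)%E.
Proof.
move=> cg; have [cg1 /supported_pos[c c0 gc]] := cg.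
pose T := 3 * c.
have T0 : 0 < T by rewrite /T; lra.
have cT : c < T / 2 by rewrite /T; lra.
rewrite (@integral_esum_itv _ T^-1) ?invr_gt0//; last 2 first.
  by apply: cont_comp; [exact: continuous_Fsq|cont].
  by move=> x; exact: Fsq_ge0.
pose u t y := g y * cos (t * y).
pose v t y := - (g y * sin (t * y)).
have H t : (\esum_(k in [set: int]) (Fsq g (2 * pi * (t + k%:~R * T^-1)))%:E =
    (T * \int[mu]_x (g x ^+ 2))%:E)%E.
  have uc : supported c (u (2 * pi * t)) by move=> y /gc gy; rewrite /u gy mul0r.
  have vc : supported c (v (2 * pi * t)) by move=> y /gc gy; rewrite /v gy mul0r oppr0.
  have cu : continuous (u (2 * pi * t)) by rewrite /u; cont.
  have cv : continuous (v (2 * pi * t)) by rewrite /v; cont.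
  have := parseval_pair cu uc cv vc (ltW c0) cT => /= E.
  rewrite (_ : \int[mu]_x (g x ^+ 2) = \int[mu]_y (u (2 * pi * t) y ^+ 2) +
      \int[mu]_y (v (2 * pi * t) y ^+ 2)).
    rewrite -E; apply: eq_esum => k _.
    rewrite (_ : 2 * pi * (t + k%:~R / T) = k%:~R * (2 * pi / T) + 2 * pi * t); last by ring.
    by rewrite /Fsq Fcos_add// Fsin_add.
  rewrite -RintegralD_cs; last 2 first.
    by apply: cont_cs_sqr; split => //; exists c.
    by apply: cont_cs_sqr; split => //; exists c.
  apply: eq_Rintegral => y _; rewrite /u /v sqrrN !exprMn sin2cos2; ring.
under eq_integral do rewrite H.
rewrite integral_cst//= lebesgue_measure_itv/= lte_fin invr_gt0 T0 -EFinB -EFinM.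
by congr EFin; field; rewrite gt_eqF.
Qed.

End parseval_int.

(** * Energy of the wavelet coefficients at one scale *)

Section wavelet_energy.
Context (R : realType).
Local Notation mu := (@lebesgue_measure R).
Implicit Types (u v g h : R -> R).

Lemma Fubini_cs g h (K : R -> R -> R) : cont_cs g -> cont_cs h ->
  (forall x, continuous (K x)) -> (forall y, continuous (K^~ y)) ->
  measurable_fun setT (fun z : measurableTypeR R * measurableTypeR R => K z.1 z.2) ->
  (forall x y, `|K x y| <= 1) ->
  \int[mu]_x (g x * \int[mu]_y (h y * K x y)) =
  \int[mu]_y (h y * \int[mu]_x (g x * K x y)).
Proof.
move=> cg ch cK1 cK2 mK K1.
pose f (z : measurableTypeR R * measurableTypeR R) : \bar R :=
  (g z.1 * h z.2 * K z.1 z.2)%:E.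
have mg : measurable_fun setT (g : measurableTypeR R -> measurableTypeR R).
  by apply: continuous_measurable_fun; case: cg.
have mh : measurable_fun setT (h : measurableTypeR R -> measurableTypeR R).
  by apply: continuous_measurable_fun; case: ch.
have mf : measurable_fun setT f.
  apply/measurable_EFinP; apply: measurable_funM => //.
  apply: measurable_funM.
    exact: (measurableT_comp mg measurable_fst).
  exact: (measurableT_comp mh measurable_snd).
have intf : (mu \x mu)%E.-integrable setT f.
  apply/integrable12ltyP => //.
  apply: (@le_lt_trans _ _ (\int[mu]_x (`|g x| * \int[mu]_y `|h y|)%:E)%E).
    apply: ge0_le_integral => //.
    - by move=> x _; exact: integral_ge0.
    - apply: (@measurable_fun_fubini_tonelli_F _ _ _ _ _ mu (fun z => `|f z|%E)) => //.
      exact: measurableT_comp.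
    - apply: continuous_EFin_measurable => //.
      by apply: contM; [apply: cont_norm; case: cg|cont].
    move=> x _; rewrite -RintegralZ_cs; last exact: cont_cs_norm.
    rewrite EFin_Rintegral//; last first.
      by apply: cont_cs_integrable; apply: cont_csZ; exact: cont_cs_norm.
    apply: ge0_le_integral => //.
    - apply: measurableT_comp => //; apply/measurable_EFinP.
      by apply: continuous_measurable_fun => /=; apply: contM => //; apply: contM; [cont|case: ch].
    - apply: continuous_EFin_measurable => //.
      by apply: contM; [cont|apply: cont_norm; case: ch].
    - by move=> y _; rewrite /f /= lee_fin !normrM ler_piMr// mulr_ge0.
  have cgn : cont_cs (fun x => `|g x| * \int[mu]_y `|h y|).
    by apply: cont_csMr; [exact: cont_cs_norm|cont].
  by rewrite -EFin_Rintegral ?ltry//; exact: cont_cs_integrable.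
rewrite /Rintegral; congr fine.
transitivity (\int[mu]_x \int[mu]_y f (x, y))%E.
  apply: eq_integral => x _; rewrite -RintegralZ_cs; last exact: cont_csMr.
  rewrite EFin_Rintegral//; last by apply: cont_cs_integrable; apply: cont_csZ; exact: cont_csMr.
  by apply: eq_integral => y _; rewrite /f /= mulrA.
rewrite Fubini//; apply: eq_integral => y _.
rewrite -RintegralZ_cs; last by apply: cont_csMr.
rewrite EFin_Rintegral//; last by apply: cont_cs_integrable; apply: cont_csZ; exact: cont_csMr.
by apply: eq_integral => x _; rewrite /f /= mulrCA mulrA.
Qed.

Lemma Rintegral_oppr u : cont_cs u -> \int[mu]_y u (- y) = \int[mu]_y u y.
Proof.
move=> [cu /supported_pos[c c0 uc]].
rewrite (Rintegral_supported uc).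
rewrite (@Rintegral_supported _ c); last by move=> x cx; apply: uc; rewrite normrN.
rewrite /Rintegral -[in RHS](opprK c) opprK; congr fine.
have := @integration_by_substitution_oppr _ u (- c) c.
rewrite opprK => -> //; first by lra.
exact: continuous_subspaceT.
Qed.

Lemma Rintegral_odd u : cont_cs u -> (forall y, u (- y) = - u y) -> \int[mu]_y u y = 0.
Proof.
move=> cu ou; have := Rintegral_oppr cu.
under eq_Rintegral do rewrite ou.
by rewrite RintegralN_cs//; lra.
Qed.

Lemma integral_scale u (l : R) : 0 < l -> continuous u -> (forall x, 0 <= u x) ->
  (\int[mu]_x (u x)%:E = \int[mu]_x (l * u (l * x))%:E)%E.
Proof.
move=> l0 cu u0.
have dF (x : R) : is_derive x 1 (fun x : R => l * x) l.
  by apply: is_derive_eq; rewrite /GRing.scale/= mulr1.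
have F1 : derive1 (fun x : R => l * x) = cst l.
  by apply/funext => x; rewrite derive1E; have [_ ->] := dF x.
rewrite (@increasing_ge0_integration_by_substitutionT _ (fun x => l * x) u) ?F1//.
- by apply: eq_integral => x _ /=; rewrite mulrC.
- by move=> x y; rewrite ltr_pM2l.
- by move=> x; exact: cvg_cst.
- exact: is_cvg_cst.
- exact: is_cvg_cst.
- by apply/gt0_cvgMrNy => //; exact: cvg_id.
- by apply/gt0_cvgMry => //; exact: cvg_id.
Qed.

Lemma esumZl_int (r : R) (a : int -> R) : 0 <= r -> (forall k, 0 <= a k) ->
  (\esum_(k in [set: int]) (r%:E * (a k)%:E) = r%:E * \esum_(k in [set: int]) (a k)%:E)%E.
Proof.
move=> r0 a0; rewrite !(reindex_esum _ _ _ _ int_of_nat_bij).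
rewrite -!nneseries_esumT.
- by rewrite nneseriesZl// => k _; rewrite lee_fin.
- by move=> k; rewrite lee_fin.
- by move=> k; rewrite mule_ge0// lee_fin.
Qed.

(** The real form of the wavelets: [Fcos h (2 * pi * x)] is the inverse Fourier transform of an even
    [h]. *)
Definition wave h (n k : int) (x : R) : R :=
  (2 : R) `^ (n%:~R / 2) * Fcos h (2 * pi * ((2 : R) ^ n * x - k%:~R)).

(** Integrating in x first, the coefficient becomes a Fourier integral over frequencies: [h] times
    the transform of g dilated by [l], evaluated at the translation [t]. *)
Lemma wave_coef g h (l t : R) : cont_cs g -> cont_cs h ->
  \int[mu]_x (g x * Fcos h (2 * pi * (l * x - t))) =
  Fcos (fun y => h y * Fcos g (2 * pi * l * y)) (2 * pi * t) +
  Fsin (fun y => h y * Fsin g (2 * pi * l * y)) (2 * pi * t).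
Proof.
move=> cg ch.
have cG : continuous (fun y => Fcos g (2 * pi * l * y)).
  by apply: cont_comp; [exact: continuous_Fcos|cont].
have cG' : continuous (fun y => Fsin g (2 * pi * l * y)).
  by apply: cont_comp; [exact: continuous_Fsin|cont].
have H y : \int[mu]_x (g x * cos (2 * pi * (l * x - t) * y)) =
    cos (2 * pi * t * y) * Fcos g (2 * pi * l * y) +
    sin (2 * pi * t * y) * Fsin g (2 * pi * l * y).
  rewrite /Fcos /Fsin -!RintegralZ_cs; try by apply: cont_csMr => //; cont.
  rewrite -RintegralD_cs; try by apply: cont_csZ; apply: cont_csMr => //; cont.
  apply: eq_Rintegral => x _.
  rewrite (_ : 2 * pi * (l * x - t) * y = 2 * pi * l * y * x - 2 * pi * t * y); last by ring.
  by rewrite cosB; ring.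
transitivity (\int[mu]_x (g x * \int[mu]_y (h y * cos (2 * pi * (l * x - t) * y)))); first by [].
rewrite (Fubini_cs (K := fun x y => cos (2 * pi * (l * x - t) * y))) //.
- under eq_Rintegral do rewrite H.
  rewrite [X in _ = X + _]/Fcos [X in _ = _ + X]/Fsin -RintegralD_cs; last 2 first.
    by apply: cont_csMr; [exact: cont_csMr|cont].
    by apply: cont_csMr; [exact: cont_csMr|cont].
  by apply: eq_Rintegral => y _; ring.
- by move=> x; cont.
- by move=> y; cont.
- apply: measurableT_comp; first exact: (continuous_measurable_fun (@continuous_cos R)).
  apply: measurable_funM => //; apply: measurable_funM => //.
  by apply: measurable_funB => //; apply: measurable_funM.
- by move=> x y; exact: cos_max.
Qed.

(** A support of half-length below 1/2 makes the translations k the Fourier frequencies of a period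
    1, so Parseval applies without aliasing. The factor 2^n of the normalization is absorbed by
    dilating the frequency variable. *)
Lemma wave_energy g h (c : R) (n : int) : cont_cs g -> continuous h ->
  supported c h -> 0 <= c -> c < 1 / 2 -> (forall y, h (- y) = h y) ->
  (\esum_(k in [set: int]) ((\int[mu]_x (g x * wave h n k x)) ^+ 2)%:E =
   \int[mu]_y (h ((2 : R) ^ (- n) * y) ^+ 2 * Fsq g (2 * pi * y))%:E)%E.
Proof.
move=> cg ch hc c0 c12 eh.
have csh : cont_cs h by split=> //; exists c.
pose l : R := 2 ^ n.
have l0 : 0 < l by rewrite exprz_gt0.
pose U y := h y * Fcos g (2 * pi * l * y).
pose V y := h y * Fsin g (2 * pi * l * y).
have cU : continuous U.
  by apply: contM => //; apply: cont_comp; [exact: continuous_Fcos|cont].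
have cV : continuous V.
  by apply: contM => //; apply: cont_comp; [exact: continuous_Fsin|cont].
have sU : supported c U by move=> y /hc; rewrite /U => ->; rewrite mul0r.
have sV : supported c V by move=> y /hc; rewrite /V => ->; rewrite mul0r.
have csU : cont_cs U by split=> //; exists c.
have csV : cont_cs V by split=> //; exists c.
(* [U] is even and [V] is odd, so one of the two squares in Parseval vanishes and the other is, up
   to normalization, that of the coefficient. *)
have FU s : Fsin U s = 0.
  apply: Rintegral_odd; first by apply: cont_csMr => //; cont.
  by move=> y; rewrite /U !mulrN FcosN eh sinN mulrN.
have FV s : Fcos V s = 0.
  apply: Rintegral_odd; first by apply: cont_csMr => //; cont.
  by move=> y; rewrite /V !mulrN FsinN// eh cosN mulrN mulNr.
have := parseval_pair cU sU cV sV c0 c12 => /= P.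
transitivity (l%:E * (\esum_(k in [set: int]) ((Fcos U (2 * pi * k%:~R) + Fsin V (2 * pi * k%:~R)) ^+ 2)%:E))%E.
  rewrite -esumZl_int ?(ltW l0)//; last by move=> k; exact: sqr_ge0.
  apply: eq_esum => k _.
  under eq_Rintegral do rewrite /wave mulrCA.
  rewrite RintegralZ_cs; last first.
    by apply: cont_csMr => //; apply: cont_comp; [exact: continuous_Fcos|cont].
  rewrite wave_coef// exprMn EFinM; congr (_%:E * _)%E.
  rewrite -powR_mulrn ?powR_ge0// -powRrM divfK//.
  by rewrite powR_intmul.
rewrite (_ : \esum_(k in _) _ = (\int[mu]_y (U y ^+ 2) + \int[mu]_y (V y ^+ 2))%:E); last first.
  rewrite -[X in X%:E]mul1r -P; apply: eq_esum => k _.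
  by rewrite divr1 FU FV subrr expr0n/= addr0 mulrC.
rewrite -RintegralD_cs; try exact: cont_cs_sqr.
rewrite -EFinM -RintegralZ_cs; last by apply: cont_csD; exact: cont_cs_sqr.
have cF : continuous (fun y : R => Fsq g (2 * pi * y)).
  by apply: cont_comp; [exact: continuous_Fsq|cont].
have chl : continuous (fun y : R => h (2 ^ (- n) * y)) by apply: cont_comp => //; cont.
rewrite (@integral_scale (fun y => h (2 ^ (- n) * y) ^+ 2 * Fsq g (2 * pi * y)) _ l0); last 2 first.
  by cont.
  by move=> x; rewrite mulr_ge0 ?sqr_ge0 ?Fsq_ge0.
transitivity (\int[mu]_y (l * (U y ^+ 2 + V y ^+ 2))%:E)%E.
  apply: EFin_Rintegral; first exact: measurableT.
  by apply: cont_cs_integrable; apply: cont_csZ; apply: cont_csD; exact: cont_cs_sqr.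
apply: eq_integral => y _; congr (_ * _)%:E.
rewrite /U /V /l [2 ^ (- n) * _]mulrA -expfzDr ?gt_eqF// addNr expr0z mul1r.
by rewrite /Fsq !exprMn -mulrDr !mulrA.
Qed.

End wavelet_energy.

(** * Reduction to continuous functions with compact support *)

Section square_integrable.
Context (R : realType).
Local Notation mu := (@lebesgue_measure R).
Implicit Types (f g h u v : R -> R).

Definition sqint g := measurable_fun setT (g : measurableTypeR R -> measurableTypeR R) /\
  mu.-integrable setT (EFin \o (fun x => g x ^+ 2)).

Definition ip f g : R := \int[mu]_x (f x * g x).
Definition nsq f : R := \int[mu]_x (f x ^+ 2).

Lemma sqintP g : g \in Lfun mu 2%:E <-> sqint g.
Proof.
split=> [gL|[mg ig]].
  split; last exact: Lfun2_integrable_sqr.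
  by move: gL => /sub_Lfun_mfun; rewrite inE.
rewrite inE; apply/andP; split; first by rewrite inE.
rewrite inE/= /finite_norm unlock/= poweR_lty//.
case/integrableP : ig => _; apply: le_lt_trans.
rewrite le_eqVlt; apply/orP; left; apply/eqP; apply: eq_integral => x _.
by rewrite /= powR_mulrn// real_normK ?num_real// ger0_norm ?sqr_ge0.
Qed.

Lemma integrableZ_EFin k (w : R -> R) : mu.-integrable setT (EFin \o w) ->
  mu.-integrable setT (EFin \o (fun x => k * w x)).
Proof.
move=> iw; have -> : EFin \o (fun x => k * w x) = (fun x => k%:E * (EFin \o w) x)%E.
  by apply/funext => x.
exact: integrableZl.
Qed.

Lemma integrableD_EFin (w z : R -> R) : mu.-integrable setT (EFin \o w) ->
  mu.-integrable setT (EFin \o z) -> mu.-integrable setT (EFin \o (fun x => w x + z x)).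
Proof. by move=> iw iz; exact: (integrableD measurableT iw iz). Qed.

Lemma sqint_dominated g (h : R -> R) :
  measurable_fun setT (g : measurableTypeR R -> measurableTypeR R) ->
  mu.-integrable setT (EFin \o h) -> (forall x, g x ^+ 2 <= h x) -> sqint g.
Proof.
move=> mg ih gh; split=> //.
apply: (le_integrable measurableT _ _ ih).
  by apply/measurable_EFinP; apply: measurable_funX.
move=> x _ /=; rewrite lee_fin ger0_norm ?sqr_ge0// (le_trans (gh x))//.
exact: ler_norm.
Qed.

Lemma sqint_mul_integrable f g : sqint f -> sqint g ->
  mu.-integrable setT (EFin \o (fun x => f x * g x)).
Proof.
move=> [mf if2] [mg ig2].
apply: (le_integrable measurableT _ _ (integrableD measurableT if2 ig2)).
  by apply/measurable_EFinP; apply: measurable_funM.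
move=> x _ /=; rewrite lee_fin normrM [leRHS]ger0_norm ?addr_ge0 ?sqr_ge0//.
rewrite -(real_normK (num_real (f x))) -(real_normK (num_real (g x))).
have := sqr_ge0 (`|f x| - `|g x|); have := sqr_ge0 (`|f x|); have := sqr_ge0 (`|g x|).
by rewrite sqrrB; lra.
Qed.

Lemma sqintZ k g : sqint g -> sqint (fun x => k * g x).
Proof.
move=> [mg ig]; split; first by apply: measurable_funM.
by under [X in _ \o X]eq_fun do rewrite exprMn; exact: integrableZ_EFin.
Qed.

Lemma sqintD f g : sqint f -> sqint g -> sqint (fun x => f x + g x).
Proof.
move=> [mf if2] [mg ig2].
apply: (@sqint_dominated _ (fun x => 2 * f x ^+ 2 + 2 * g x ^+ 2)).
- exact: measurable_funD.
- by apply: integrableD_EFin; exact: integrableZ_EFin.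
- by move=> x; have := sqr_ge0 (f x - g x); rewrite sqrrB sqrrD; lra.
Qed.

Lemma sqintN g : sqint g -> sqint (fun x => - g x).
Proof. by move=> /(sqintZ (-1)); under [X in sqint X]eq_fun do rewrite mulN1r. Qed.

Lemma sqintB f g : sqint f -> sqint g -> sqint (fun x => f x - g x).
Proof. by move=> sf sg; apply: sqintD => //; exact: sqintN. Qed.

Lemma cont_cs_sqint g : cont_cs g -> sqint g.
Proof.
move=> cg; split; first by apply: continuous_measurable_fun; case: cg.
by apply: cont_cs_integrable; exact: cont_cs_sqr.
Qed.

Lemma nsq_ge0 g : 0 <= nsq g.
Proof. by apply: Rintegral_ge0 => x _; exact: sqr_ge0. Qed.

Lemma ipDl f g h : sqint f -> sqint g -> sqint h ->
  ip (fun x => f x + g x) h = ip f h + ip g h.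
Proof.
move=> sf sg sh; rewrite /ip -RintegralD//; try exact: sqint_mul_integrable.
by apply: eq_Rintegral => x _; rewrite mulrDl.
Qed.

Lemma nsq_lin f g (s t : R) : sqint f -> sqint g ->
  nsq (fun x => s * f x + t * g x) = s ^+ 2 * nsq f + 2 * s * t * ip f g + t ^+ 2 * nsq g.
Proof.
move=> sf sg.
have iff : mu.-integrable setT (EFin \o (fun x => f x * f x)) by exact: sqint_mul_integrable.
have igg : mu.-integrable setT (EFin \o (fun x => g x * g x)) by exact: sqint_mul_integrable.
have ifg : mu.-integrable setT (EFin \o (fun x => f x * g x)) by exact: sqint_mul_integrable.
rewrite /nsq /ip.
under [X in _ = _ * X + _ + _]eq_Rintegral do rewrite expr2.
under [X in _ = _ + _ + _ * X]eq_Rintegral do rewrite expr2.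
rewrite -!RintegralZl// -!RintegralD//;
  try by repeat first [exact: integrableZ_EFin | apply: integrableD_EFin].
by apply: eq_Rintegral => x _; ring.
Qed.

Lemma cauchy_schwarz f g : sqint f -> sqint g -> ip f g ^+ 2 <= nsq f * nsq g.
Proof.
move=> sf sg.
have H s t : 0 <= s ^+ 2 * nsq f + 2 * s * t * ip f g + t ^+ 2 * nsq g.
  by rewrite -nsq_lin//; exact: nsq_ge0.
have := nsq_ge0 g; rewrite le_eqVlt => /predU1P[g0|g0].
  rewrite -g0 mulr0.
  have [->|i0] := eqVneq (ip f g) 0; first by rewrite expr0n.
  (* With [nsq g] equal to 0 the form is affine in its second coefficient, which is chosen to bring
     the value down to -1. *)
  have := H 1 (- (nsq f + 1) / (2 * ip f g)).
  rewrite -g0 mulr0 addr0 expr1n mul1r mulr1.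
  by rewrite (_ : 2 * _ * _ = - (nsq f + 1)); [lra|field].
have := H (nsq g) (- ip f g).
rewrite (_ : _ + _ = nsq g * (nsq f * nsq g - ip f g ^+ 2)); last by ring.
by rewrite pmulr_rge0// subr_ge0.
Qed.

(** The difference of the two sides is n (x - y/n)^2. The point is a factor 1 + n close to 1 on the
    main term, at the price of a large one on the perturbation. *)
Lemma sqrD_le (x y n : R) : 0 < n ->
  (x + y) ^+ 2 <= (1 + n) * x ^+ 2 + (1 + n^-1) * y ^+ 2.
Proof.
move=> n0; rewrite -subr_ge0.
have -> : (1 + n) * x ^+ 2 + (1 + n^-1) * y ^+ 2 - (x + y) ^+ 2 = n * (x - y / n) ^+ 2.
  by field; rewrite gt_eqF.
by rewrite mulr_ge0 ?sqr_ge0// ltW.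
Qed.

Lemma nsqD_le f g (n : R) : sqint f -> sqint g -> 0 < n ->
  nsq (fun x => f x + g x) <= (1 + n) * nsq f + (1 + n^-1) * nsq g.
Proof.
move=> sf sg n0.
have := @nsq_lin f g 1 1 sf sg; under [X in nsq X]eq_fun do rewrite !mul1r.
move=> ->; have := nsq_lin n (- 1) sf sg => E.
have := nsq_ge0 (fun x => n * f x + -1 * g x); rewrite E => H.
rewrite -(ler_pM2l n0).
have -> : n * ((1 + n) * nsq f + (1 + n^-1) * nsq g) =
  (n + n ^+ 2) * nsq f + (n + 1) * nsq g by field; rewrite gt_eqF.
by move: H; rewrite !expr1n sqrrN expr1n; lra.
Qed.

End square_integrable.

(** * Density in L^2 of continuous functions with compact support *)

Section density.
Context (R : realType).
Local Notation mu := (@lebesgue_measure R).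
Implicit Types (f g h u v : R -> R).

Lemma sqint_truncate g (e : R) : sqint g -> 0 < e ->
  exists2 t, sqint t /\ (exists2 N, 0 < N & (forall x, `|t x| <= N) /\ supported N t) &
    nsq (fun x => g x - t x) <= e.
Proof.
move=> [mg ig] e0.
pose D (n : nat) : set (measurableTypeR R) :=
  [set x | `|g x| <= n%:R] `&` `]-(n%:R), n%:R[%classic.
have mD n : measurable (D n).
  apply: measurableI => //.
  rewrite (_ : [set x | _] = setT `&` g @^-1` `[-(n%:R), n%:R]); last first.
    by rewrite setTI; apply/seteqP; split=> x /=; rewrite in_itv/= -ler_norml.
  by apply: mg => //; exact: measurable_itv.
pose t n : R -> R := g \_ (D n).
have mt n : measurable_fun setT (t n : measurableTypeR R -> measurableTypeR R).
  by apply/(measurable_restrictT _ _).1 => //; exact: measurable_funTS.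
have tg n x : (g x - t n x) ^+ 2 <= g x ^+ 2.
  rewrite /t patchE; case: ifPn => _; last by rewrite subr0.
  by rewrite subrr expr0n/= sqr_ge0.
have tg' n x : t n x ^+ 2 <= g x ^+ 2.
  rewrite /t patchE; case: ifPn => // _.
  by rewrite expr0n/= sqr_ge0.
have m1 n : measurable_fun setT (fun x : measurableTypeR R => ((g x - t n x) ^+ 2)%:E).
  by apply/measurable_EFinP; apply: measurable_funX; apply: measurable_funB => //; exact: mt.
have cv : {ae mu, forall x, setT x -> ((g x - t n x) ^+ 2)%:E @[n --> \oo] --> (cst 0%E : R -> \bar R) x}.
  apply: aeW => x _; apply: cvg_near_cst.
  exists (Num.truncn (`|g x| + `|x|)).+1 => // n /= hn.
  rewrite /t patchE ifT ?subrr ?expr0n//.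
  have H : `|g x| + `|x| < n%:R.
    by apply: lt_le_trans (truncnS_gt _) _; rewrite ler_nat.
  rewrite inE; split => /=.
    by apply/ltW; apply: le_lt_trans H; rewrite lerDl.
  by rewrite in_itv/= -ltr_norml; apply: le_lt_trans H; rewrite lerDr.
have dm : {ae mu, forall x n, setT x -> (`|((g x - t n x) ^+ 2)%:E| <= (EFin \o (fun x => g x ^+ 2)%R) x)%E}.
  by apply: aeW => x n _; rewrite /= lee_fin ger0_norm ?sqr_ge0.
have [_ _] := dominated_convergence measurableT m1 (measurable_cst 0%E) cv ig dm.
rewrite integral0 => /fine_cvgP[_] /cvgrPdist_le /(_ _ e0)[N _ /(_ N.+1 (leqnSn N))] /=.
rewrite sub0r normrN => H.
exists (t N.+1); last by apply: le_trans H; exact: ler_norm.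
split; first by apply: (sqint_dominated _ ig).
exists N.+1%:R; first by rewrite ltr0n.
split=> x; rewrite /t patchE; case: ifPn => //.
- by rewrite inE => -[].
- by rewrite normr0 ler0n.
- by rewrite inE /D /= in_itv/= -ltr_norml => -[_ +] /(lt_le_trans _) h => /h; rewrite ltxx.
Qed.

(** Continuous functions approximate [t] in mean on [-N-1, N+1]. Clamping to [-N, N] and cutting off
    outside do not increase the distance to [t], and the difference is then at most 2N, so its
    square is at most 2N times the distance in mean. *)
Lemma bounded_cs_approx t (N e : R) : 0 < N -> 0 < e ->
  measurable_fun setT (t : measurableTypeR R -> measurableTypeR R) ->
  (forall x, `|t x| <= N) -> supported N t ->
  exists2 v, cont_cs v & nsq (fun x => t x - v x) <= e.
Proof.
move=> N0 e0 mt tN st.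
pose c := N + 1.
pose E : set (measurableTypeR R) := `[- c, c]%classic.
have mE : measurable E by exact: measurable_itv.
have fE : (mu E < +oo)%E.
  by rewrite /E lebesgue_measure_itv/= lte_fin; case: ifP => // _; rewrite -EFinB ltry.
have it : mu.-integrable E (EFin \o t).
  apply: measurable_bounded_integrable => //; first exact: measurable_funTS.
  exists N; split; first exact: num_real.
  by move=> M NM x _ /=; rewrite (le_trans (tN x))// ltW.
have [g_ [cg ig /fine_cvgP[_ /cvgrPdist_le H]]] := approximation_continuous_integrable mE fE it.
have d0 : 0 < e / (2 * N) by rewrite divr_gt0// mulr_gt0.
have [n _ /(_ n (leqnn n))] := H _ d0.
rewrite /= sub0r normrN => {}H.
pose w := g_ n.
(* The projection onto [-N, N], then a trapezoid equal to 1 on [-N, N] and to 0 beyond [c]; both are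
   written with absolute values, which makes continuity immediate. *)
pose clamp (y : R) := (`|y + N| - `|y - N|) / 2.
pose cut (x : R) := (`|c - `|x| | - `|c - `|x| - 1| + 1) / 2.
pose v x := clamp (w x) * cut x.
have cw : continuous w by exact: cg.
have cv : continuous v by rewrite /v /clamp /cut; cont.
have cut1 x : `|x| <= N -> cut x = 1.
  by move=> xN; rewrite /cut [ `|c - `|x| |]ger0_norm ?[ `|c - `|x| - 1|]ger0_norm /c; [field|lra|lra].
have cut0 x : c <= `|x| -> cut x = 0.
  by move=> xN; rewrite /cut [ `|c - `|x| |]ler0_norm ?[ `|c - `|x| - 1|]ler0_norm; [field|lra|lra].
have cut01 x : 0 <= cut x <= 1.
  rewrite /cut; have [h1|h1] := ler0P (c - `|x|); have [h2|h2] := ler0P (c - `|x| - 1);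
    apply/andP; split; lra.
have sv : supported c v by move=> x /cut0; rewrite /v => ->; rewrite mulr0.
have csv : cont_cs v by split=> //; exists c.
have tc x : t x = t x * cut x.
  have [xN|xN] := leP `|x| N; first by rewrite cut1// mulr1.
  by rewrite st ?mul0r// ltW.
have clampN (y : R) : - N <= clamp y <= N.
  rewrite /clamp; have [h1|h1] := ler0P (y + N); have [h2|h2] := ler0P (y - N);
    apply/andP; split; lra.
have clamp_lip x : `|t x - clamp (w x)| <= `|t x - w x|.
  have := tN x; rewrite ler_norml /clamp => /andP[t1 t2].
  have [h1|h1] := ler0P (w x + N); have [h2|h2] := ler0P (w x - N).
  - rewrite (_ : _ / 2 = - N); last by field.
    by rewrite !ger0_norm; lra.
  - lra.
  - by rewrite (_ : _ / 2 = w x); last by field.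
  - rewrite (_ : _ / 2 = N); last by field.
    by rewrite !ler0_norm; lra.
exists v => //.
have tv x : (t x - v x) ^+ 2 <= 2 * N * `|t x - w x|.
  rewrite [in leLHS]tc /v -mulrBl exprMn -(real_normK (num_real (t x - _))).
  have h1 := clamp_lip x.
  have h2 : `|t x - clamp (w x)| <= 2 * N.
    have := tN x; rewrite !ler_norml; have := clampN (w x).
    by move=> /andP[? ?] /andP[? ?]; apply/andP; split; lra.
  have h3 : cut x ^+ 2 <= 1 by have /andP[? ?] := cut01 x; exact: exprn_ile1.
  apply: (@le_trans _ _ (`|t x - clamp (w x)| ^+ 2)).
    by rewrite ler_piMr// sqr_ge0.
  by rewrite expr2; apply: ler_pM.
have stv : supported c (fun x => (t x - v x) ^+ 2).
  move=> x cx; rewrite sv// st ?subrr ?expr0n//.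
  by apply: le_trans cx; rewrite /c; lra.
have itw : mu.-integrable E (EFin \o (fun x => `|t x - w x|)).
  have := integrable_abse (integrableB mE it (ig n)).
  by apply: eq_integrable => // x _ /=.
rewrite /nsq (Rintegral_supported stv) -/E.
apply: (@le_trans _ _ (\int[mu]_(x in E) (2 * N * `|t x - w x|))).
  have i2 : mu.-integrable E (EFin \o (fun x => 2 * N * `|t x - w x|)).
    by have := integrableZl mE (2 * N) itw; apply: eq_integrable => // x _ /=.
  apply: le_Rintegral => //.
  apply: (le_integrable mE _ _ i2).
    apply/measurable_EFinP; apply: measurable_funTS; apply: measurable_funX.
    by apply: measurable_funB => //; exact: continuous_measurable_fun.
  move=> x _ /=; rewrite lee_fin [leLHS]ger0_norm ?sqr_ge0// (le_trans (tv x))//.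
  exact: ler_norm.
rewrite RintegralZl//.
rewrite -ler_pdivlMl ?mulr_gt0// mulrC.
by apply: le_trans H; exact: ler_norm.
Qed.

Lemma sqint_dense g (e : R) : sqint g -> 0 < e ->
  exists2 v, cont_cs v & nsq (fun x => g x - v x) <= e.
Proof.
move=> sg e0.
have e4 : 0 < e / 4 by rewrite divr_gt0.
have [t [st [N N0 [tN sNt]]] gt] := sqint_truncate sg e4.
have [v cv tv] := bounded_cs_approx N0 e4 st.1 tN sNt.
exists v => //.
have := nsqD_le (sqintB sg st) (sqintB st (cont_cs_sqint cv)) (@ltr01 R).
under [X in nsq X <= _]eq_fun do rewrite subrKA.
by rewrite invr1; lra.
Qed.

End density.

(** * Extension of coefficient bounds to L^2 by density *)

Section frame_extension.
Context (R : realType) (J : choiceType).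
Local Notation mu := (@lebesgue_measure R).
Implicit Types (f g h u v : R -> R) (X Y A B : R).

Definition coef_sum (e : J -> R -> R) g : \bar R :=
  (\esum_(j in [set: J]) (ip g (e j) ^+ 2)%:E)%E.

(** [K] may depend on [n]: the distance [d] tends to 0 first, for a fixed [n], and [n] only
    afterwards. The order matters because the perturbation carries the factor 1 + 1/n. *)
Lemma le_of_perturbation X Y : 0 <= Y ->
  (forall n, 0 < n -> exists2 K, 0 <= K & forall d, 0 < d -> X <= (1 + n) ^+ 2 * Y + K * d) ->
  X <= Y.
Proof.
move=> Y0 H; rewrite leNgt; apply/negP => XY.
(* Since n <= 1, this choice bounds (2n + n^2) Y by 3/8 of X - Y, and K d takes at most another
   quarter. *)
pose n := Num.min 1 ((X - Y) / (8 * (Y + 1))).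
have Y1 : 0 < 8 * (Y + 1) by lra.
have n0 : 0 < n by rewrite lt_min ltr01 divr_gt0//; lra.
have n1 : n <= 1 by rewrite ge_min lexx.
have n2 : n <= (X - Y) / (8 * (Y + 1)) by rewrite ge_min lexx orbT.
have n3 : n * (8 * (Y + 1)) <= X - Y by rewrite -ler_pdivlMr.
have [K K0 HK] := H n n0.
have d0 : 0 < (X - Y) / (4 * (K + 1)) by rewrite divr_gt0//; lra.
have := HK _ d0.
have : K * ((X - Y) / (4 * (K + 1))) <= (X - Y) / 4.
  rewrite (_ : K * _ = (X - Y) / 4 * (K / (K + 1))); last by field; lra.
  rewrite ler_piMr//; first by lra.
  by rewrite ler_pdivrMr; lra.
have : n ^+ 2 * Y <= n * Y by rewrite ler_wpM2r// expr2 ler_piMr// ltW.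
have : 0 <= n * Y by rewrite mulr_ge0// ltW.
rewrite sqrrD expr1n mul1r mulrDl mulrDl mul1r -mulr_natl -mulrA; lra.
Qed.

Context (e : J -> R -> R) (se : forall j, sqint (e j)).

Let F (D : set J) g := \sum_(j <- fset_set D) ip g (e j) ^+ 2.

Let F_le_coef_sum (D : set J) g : finite_set D ->
  ((F D g)%:E <= coef_sum e g)%E.
Proof.
move=> fD; apply: esum_ge; exists D; first by split.
by rewrite fsbig_finite//= sumEFin.
Qed.

Let coef_sum_le g X : (forall D : set J, finite_set D -> F D g <= X) -> (coef_sum e g <= X%:E)%E.
Proof.
move=> H; apply: ge_ereal_sup => _ [D [fD _] <-].
by rewrite fsbig_finite//= sumEFin lee_fin; exact: H.
Qed.

Let F_split s f g n : sqint f -> sqint g -> 0 < n ->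
  F s (fun x => f x + g x) <= (1 + n) * F s f + (1 + n^-1) * F s g.
Proof.
move=> sf sg n0; rewrite !mulr_sumr -big_split/=; apply: ler_sum => j _.
by rewrite ipDl//; exact: sqrD_le.
Qed.

(** Cauchy-Schwarz on finitely many terms. The constant grows with the finite set, which is harmless
    since the set is fixed while the approximation improves. *)
Let F_bounded s : exists2 C, 0 <= C & forall g, sqint g -> F s g <= C * nsq g.
Proof.
exists (\sum_(j <- fset_set s) nsq (e j)); first by apply: sumr_ge0 => j _; exact: nsq_ge0.
move=> g sg; rewrite mulr_suml; apply: ler_sum => j _.
by rewrite mulrC; exact: cauchy_schwarz.
Qed.

(** The infinite sum is not yet known to be finite at g, so the comparison is made on each finite
    subfamily, where the sum is continuous in g. *)
Lemma coef_sum_upper B : 0 <= B ->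
  (forall v, cont_cs v -> (coef_sum e v <= (B * nsq v)%:E)%E) ->
  forall g, sqint g -> (coef_sum e g <= (B * nsq g)%:E)%E.
Proof.
move=> B0 HB g sg; apply: coef_sum_le => D fD.
apply: le_of_perturbation; first by rewrite mulr_ge0// nsq_ge0.
move=> n n0; have [C C0 HC] := F_bounded D.
have in0 : 0 < n^-1 by rewrite invr_gt0.
exists ((1 + n) * B * (1 + n^-1) + (1 + n^-1) * C).
  by rewrite addr_ge0// !mulr_ge0//; lra.
move=> d d0; have [v cv vd] := sqint_dense sg d0.
have sv := cont_cs_sqint cv.
have sgv := sqintB sg sv.
have h1 := F_split D sv sgv n0.
rewrite (_ : (fun x => v x + (g x - v x)) = g) in h1; last by apply/funext => x; rewrite addrC subrK.
have h2 : F D v <= B * nsq v.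
  by rewrite -lee_fin; apply: le_trans (HB v cv); exact: F_le_coef_sum.
have h3 := HC _ sgv.
have h4 := nsqD_le sg (sqintN sgv) n0.
rewrite (_ : (fun x => g x + - (g x - v x)) = v) in h4; last by apply/funext => x; rewrite opprB addrC subrK.
rewrite (_ : nsq (fun x => - (g x - v x)) = nsq (fun x => g x - v x)) in h4; last first.
  by apply: eq_Rintegral => x _; rewrite sqrrN.
set a := nsq g in h4 *; set b := nsq v in h2 h4; set w := nsq _ in vd h3 h4.
set m := n^-1 in in0 h1 h4 *.
have k1 : (1 + m) * w <= (1 + m) * d by rewrite ler_pM2l//; lra.
have k2 : (1 + n) * F D v <= (1 + n) * (B * ((1 + n) * a + (1 + m) * d)).
  rewrite ler_pM2l; last by lra.
  by rewrite (le_trans h2)// ler_wpM2l//; lra.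
have k3 : (1 + m) * F D (fun x => g x - v x) <= (1 + m) * (C * d).
  rewrite ler_pM2l; last by lra.
  by rewrite (le_trans h3)// ler_wpM2l.
apply: le_trans h1 _; apply: le_trans (lerD k2 k3) _.
by rewrite le_eqVlt; apply/orP; left; apply/eqP; ring.
Qed.

(** A lower bound concerns the whole sum, so the perturbation g - v has to be controlled over the
    whole family; this is done by the upper bound, already extended to L^2. *)
Lemma coef_sum_lower A B : 0 <= A -> 0 <= B ->
  (forall v, cont_cs v -> ((A * nsq v)%:E <= coef_sum e v <= (B * nsq v)%:E)%E) ->
  forall g, sqint g -> ((A * nsq g)%:E <= coef_sum e g)%E.
Proof.
move=> A0 B0 HAB g sg.
have HB v : cont_cs v -> (coef_sum e v <= (B * nsq v)%:E)%E by move=> /HAB/andP[].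
have SB := coef_sum_upper B0 HB.
have S0 h : (0 <= coef_sum e h)%E by apply: esum_ge0 => j _; rewrite lee_fin sqr_ge0.
have [s gs] : exists s, coef_sum e g = s%:E.
  exists (fine (coef_sum e g)); rewrite fineK// ge0_fin_numE//.
  exact: le_lt_trans (SB _ sg) (ltry _).
have s0 : 0 <= s by rewrite -lee_fin -gs.
rewrite gs lee_fin; apply: le_of_perturbation => // n n0.
have in0 : 0 < n^-1 by rewrite invr_gt0.
exists ((1 + n) * ((1 + n^-1) * B) + A * (1 + n^-1)).
  by rewrite addr_ge0// !mulr_ge0//; lra.
move=> d d0; have [v cv vd] := sqint_dense sg d0.
have sv := cont_cs_sqint cv.
have sgv := sqintB sg sv.
have svg : sqint (fun x => - (g x - v x)) by exact: sqintN.
have nN : nsq (fun x => - (g x - v x)) = nsq (fun x => g x - v x).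
  by apply: eq_Rintegral => x _; rewrite sqrrN.
have h0 : A * nsq v <= (1 + n) * s + (1 + n^-1) * (B * d).
  rewrite -lee_fin; have /andP[+ _] := HAB v cv.
  move/le_trans; apply; apply: coef_sum_le => D fD.
  have h1 := F_split D sg svg n0.
  rewrite (_ : (fun x => g x + - (g x - v x)) = v) in h1; last by apply/funext => x; rewrite opprB addrC subrK.
  apply: le_trans h1 _; apply: lerD.
    rewrite ler_pM2l; last by lra.
    by rewrite -lee_fin -gs; exact: F_le_coef_sum.
  rewrite ler_pM2l; last by lra.
  rewrite -lee_fin; apply: (@le_trans _ _ (coef_sum e (fun x => - (g x - v x)))).
    exact: F_le_coef_sum.
  by rewrite (le_trans (SB _ svg))// nN lee_fin ler_wpM2l.
have h4 := nsqD_le sv sgv n0.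
rewrite (_ : (fun x => v x + (g x - v x)) = g) in h4; last by apply/funext => x; rewrite addrC subrK.
set m := n^-1 in in0 h0 h4 *.
have k1 : A * nsq g <= A * ((1 + n) * nsq v + (1 + m) * d).
  by rewrite ler_wpM2l// (le_trans h4)// lerD2l ler_pM2l//; lra.
have k2 : (1 + n) * (A * nsq v) <= (1 + n) * ((1 + n) * s + (1 + m) * (B * d)).
  by rewrite ler_pM2l//; lra.
apply: le_trans k1 _.
rewrite (_ : A * _ = (1 + n) * (A * nsq v) + A * (1 + m) * d); last by ring.
rewrite (le_trans (lerD k2 (lexx _)))//.
by rewrite le_eqVlt; apply/orP; left; apply/eqP; ring.
Qed.

End frame_extension.

(** * Reduction to real coefficients, and summation over all scales *)

Section wave_frames.
Context (R : realType).
Local Notation mu := (@lebesgue_measure R).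
Implicit Types (f g u v : R -> R) (A B : R).

Lemma L2_sqint (G : R -> R[i]) :
  L2 G <-> sqint (fun x => Re (G x)) /\ sqint (fun x => Im (G x)).
Proof.
split=> -[h1 h2]; split.
- exact: (sqintP _).1 h1.
- exact: (sqintP _).1 h2.
- exact: (sqintP _).2 h1.
- exact: (sqintP _).2 h2.
Qed.

Lemma normc_sqr (z : R[i]) : ComplexField.Normc.normc z ^+ 2 = Re z ^+ 2 + Im z ^+ 2.
Proof. by case: z => a b /=; rewrite sqr_sqrtr// addr_ge0// sqr_ge0. Qed.

Lemma nsq_integral g : sqint g -> (\int[mu]_x (g x ^+ 2)%:E)%E = (nsq g)%:E.
Proof. by move=> [mg ig]; rewrite /nsq EFin_Rintegral. Qed.

Lemma L2_sqnormE (G : R -> R[i]) : L2 G ->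
  L2_sqnorm G = (nsq (fun x => Re (G x)) + nsq (fun x => Im (G x)))%:E.
Proof.
move=> /L2_sqint[sr si]; rewrite /L2_sqnorm EFinD -!nsq_integral//.
rewrite -integralD//; [|by case: sr|by case: si].
by apply: eq_integral => x _; rewrite normc_sqr EFinD.
Qed.

Lemma L2_innerE (G : R -> R[i]) (E : R -> R[i]) (e : R -> R) :
  (forall x, E x = (e x)%:C%C) ->
  ComplexField.Normc.normc (L2_inner G E) ^+ 2 =
  ip (fun x => Re (G x)) e ^+ 2 + ip (fun x => Im (G x)) e ^+ 2.
Proof.
move=> Ee; rewrite normc_sqr /L2_inner /cintegral /ip /=.
congr (_ ^+ 2 + _ ^+ 2); apply: eq_Rintegral => x _; rewrite Ee; case: (G x) => a b /=; ring.
Qed.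

(* The system is real, so the coefficient sum of [G] is the one of [Re G] plus the one
   of [Im G]. *)
Lemma frame_boundsP (J : choiceType) (E : J -> R -> R[i]) (e : J -> R -> R) A B :
  (forall j x, E j x = (e j x)%:C%C) ->
  frame_bounds E A B <-> [/\ 0 < A, A <= B & forall g, sqint g ->
    ((A * nsq g)%:E <= coef_sum e g <= (B * nsq g)%:E)%E].
Proof.
move=> Ee.
have SE G : (\esum_(j in [set: J]) (ComplexField.Normc.normc (L2_inner G (E j)) ^+ 2)%:E =
    coef_sum e (fun x => Re (G x)) + coef_sum e (fun x => Im (G x)))%E.
  rewrite -esumD; [|by move=> j _; rewrite lee_fin sqr_ge0..].
  by apply: eq_esum => j _; rewrite (L2_innerE _ (Ee j)) EFinD.
split=> -[A0 AB H]; split=> //.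
- move=> g sg.
  have s0 : sqint (fun _ : R => 0 : R).
    by apply: cont_cs_sqint; split; [exact: cont_cst|exists 0].
  have n0 : nsq (fun _ : R => 0 : R) = 0.
    by rewrite /nsq expr0n/= Rintegral_cst//= mul0r.
  have c0 : coef_sum e (fun _ : R => 0 : R) = 0%E.
    apply: esum1 => j _; rewrite /ip.
    by under eq_Rintegral do rewrite mul0r; rewrite Rintegral_cst// mul0r expr0n.
  (* Tested on a real-valued function, the imaginary contribution is zero throughout. *)
  have LG : L2 (fun x => (g x)%:C%C) by apply/L2_sqint.
  have := H _ LG; rewrite SE L2_sqnormE//= n0 c0 addr0 adde0 -!EFinM.
  by move=> [-> ->].
- move=> G LG; have [sr si] := (L2_sqint G).1 LG.
  rewrite SE L2_sqnormE// -!EFinM !mulrDr !EFinD.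
  have /andP[? ?] := H _ sr; have /andP[? ?] := H _ si.
  by split; exact: leeD.
Qed.

Definition waves h (nk : int * int) : R -> R := wave h nk.1 nk.2.

Section fixed_generator.
Context (h : R -> R) (c : R) (ch : continuous h) (hc : supported c h)
  (c0 : 0 <= c) (c12 : c < 1 / 2) (eh : forall y, h (- y) = h y).

Lemma coef_sum_waves g : cont_cs g -> coef_sum (waves h) g =
  (\esum_(n in [set: int])
     \int[mu]_y (h ((2 : R) ^ (- n) * y) ^+ 2 * Fsq g (2 * pi * y))%:E)%E.
Proof.
move=> cg; rewrite /coef_sum.
rewrite (_ : [set: int * int] = [set: int] `*`` (fun=> [set: int])); last first.
  by apply/seteqP; split.
rewrite -(@esum_esum _ _ _ _ _ (fun n k => (ip g (waves h (n, k)) ^+ 2)%:E)).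
  by apply: eq_esum => n _; rewrite -(wave_energy n cg ch hc c0 c12 eh).
by move=> n k _ _; rewrite lee_fin sqr_ge0.
Qed.

Let q g y : R := Fsq g (2 * pi * y).

Let cq g : cont_cs g -> continuous (q g).
Proof. by move=> cg; apply: cont_comp; [exact: continuous_Fsq|cont]. Qed.

Let chl (n : int) : continuous (fun y : R => h (2 ^ (- n) * y)).
Proof. by apply: cont_comp => //; cont. Qed.

(** The sum over scales is a supremum over finite sets, so pointwise bounds on finite sums suffice
    and only finite additivity of the integral is used. *)
Lemma coef_sum_waves_le g (w : R -> R) : cont_cs g -> continuous w ->
  (forall (D : set int) y, finite_set D ->
     \sum_(n <- fset_set D) h ((2 : R) ^ (- n) * y) ^+ 2 <= w y) ->
  (coef_sum (waves h) g <= \int[mu]_y (w y * q g y)%:E)%E.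
Proof.
move=> cg cw Hw; rewrite coef_sum_waves//; apply: ge_ereal_sup => _ [D [fD _] <-].
rewrite fsbig_finite//= -ge0_integral_sum//; last 2 first.
- move=> n; apply: continuous_EFin_measurable => //.
  by apply: contM; [apply: contX; exact: chl|exact: cq].
- by move=> n y _; rewrite lee_fin mulr_ge0 ?sqr_ge0 ?Fsq_ge0.
have cqg := cq cg.
apply: ge0_le_integral => //.
- by move=> y _; rewrite sumEFin lee_fin sumr_ge0// => n _; rewrite mulr_ge0 ?sqr_ge0 ?Fsq_ge0.
- under eq_fun do rewrite sumEFin; apply: continuous_EFin_measurable => //.
  by apply: cont_sum => n; apply: contM; [apply: contX; exact: chl|exact: cq].
- by apply: continuous_EFin_measurable => //; cont.
- move=> y _; rewrite sumEFin lee_fin -mulr_suml ler_wpM2r ?Fsq_ge0//.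
  exact: Hw.
Qed.

Lemma coef_sum_waves_ge_level0 g : cont_cs g ->
  (\int[mu]_y (h y ^+ 2 * q g y)%:E <= coef_sum (waves h) g)%E.
Proof.
move=> cg; rewrite coef_sum_waves//; apply: esum_ge; exists [set 0] => //.
rewrite fsbig_set1 le_eqVlt; apply/orP; left; apply/eqP.
by apply: eq_integral => y _; rewrite oppr0 expr0z mul1r.
Qed.

(** The good scale depends on y, so no single scale bounds the sum: the series is moved inside the
    integral before one term is kept at each point. The exceptional point y = 0 is negligible. *)
Lemma coef_sum_waves_ge g A : cont_cs g -> 0 <= A ->
  (forall y, y != 0 -> exists n : int, A <= h ((2 : R) ^ (- n) * y) ^+ 2) ->
  ((A * nsq g)%:E <= coef_sum (waves h) g)%E.
Proof.
move=> cg A0 HA; rewrite coef_sum_waves// (reindex_esum _ _ _ _ int_of_nat_bij).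
have cqg := cq cg.
rewrite -nneseries_esumT; last first.
  by move=> n; apply: integral_ge0 => y _; rewrite lee_fin mulr_ge0 ?sqr_ge0 ?Fsq_ge0.
rewrite -integral_nneseries//; last 2 first.
- move=> n; apply: continuous_EFin_measurable => //.
  by apply: contM; [apply: contX; exact: chl|exact: cq].
- by move=> n y _; rewrite lee_fin mulr_ge0 ?sqr_ge0 ?Fsq_ge0.
rewrite EFinM /nsq -plancherel// -ge0_integralZl//; last 2 first.
- by apply: continuous_EFin_measurable => //; exact: cq.
- by move=> y _; rewrite lee_fin Fsq_ge0.
apply: ae_ge0_le_integral => //.
- by move=> y _; rewrite -EFinM lee_fin mulr_ge0 ?Fsq_ge0.
- under eq_fun do rewrite -EFinM; apply: continuous_EFin_measurable => //.
  by apply: contM; [cont|exact: cq].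
- by move=> y _; apply: nneseries_ge0 => n _ _; rewrite lee_fin mulr_ge0 ?sqr_ge0 ?Fsq_ge0.
- apply: ge0_emeasurable_sum => n *.
    by rewrite lee_fin mulr_ge0 ?sqr_ge0 ?Fsq_ge0.
  apply: continuous_EFin_measurable => //.
  by apply: contM; [apply: contX; exact: chl|exact: cq].
have : mu.-negligible [set 0 : R].
  by exists [set 0]; split=> //; exact: lebesgue_measure_set1.
apply: negligibleS => y /= H; apply/eqP/negPn/negP => y0; apply: H => _.
have [n An] := HA y y0.
rewrite nneseries_esumT; last by move=> k; rewrite lee_fin mulr_ge0 ?sqr_ge0 ?Fsq_ge0.
have [_ _ /(_ n Logic.I)[i _ ni]] := int_of_nat_bij.
apply: esum_ge; exists [set i] => //.
by rewrite fsbig_set1 -EFinM lee_fin ni ler_wpM2r ?Fsq_ge0.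
Qed.

End fixed_generator.

End wave_frames.

(** * Smoothness and rapid decay *)

Section smooth_functions.
Context (R : realType).
Implicit Types (f g h u v : R -> R).

(** Witnessed derivatives, instead of iterates of [derive1], let closure under products, inverses
    and affine substitutions follow by a plain induction on the order; [smoothP] gives the link with
    [smooth]. *)
Fixpoint nsmooth (n : nat) (g : R -> R) : Prop :=
  if n is n'.+1 then
    exists2 g' : R -> R, (forall x : R, is_derive x 1 g (g' x)) & nsmooth n' g'
  else True.

Definition cinfty g := forall n, nsmooth n g.

Lemma is_derive_derive1 g g' : (forall x : R, is_derive x 1 g (g' x)) -> derive1 g = g'.
Proof. by move=> dg; apply/funext => x; rewrite derive1E; have [_ ->] := dg x. Qed.

Lemma smoothP g : smooth g <-> cinfty g.
Proof.
split=> [sg n|sg k x].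
  elim: n g sg => [//|n IH] g sg; exists (derive1 g).
    by move=> x; rewrite derive1E; apply: DeriveDef => //; exact: (sg 0%N).
  by apply: IH => k x; rewrite -derive1Sn; exact: (sg k.+1).
have := sg k.+1; elim: k g {sg} => [|k IH] g [g' dg sg].
  by rewrite derive1n0; have [] := dg x.
by rewrite derive1Sn (is_derive_derive1 dg); exact: IH.
Qed.

Lemma nsmoothS n g : nsmooth n.+1 g -> nsmooth n g.
Proof. by elim: n g => [//|n IH] g [g' dg sg]; exists g' => //; exact: IH. Qed.

Lemma cinfty_continuous g : cinfty g -> continuous g.
Proof.
move=> /(_ 1%N)[g' dg _] x; apply: differentiable_continuous; apply/derivable1_diffP.
by have [] := dg x.
Qed.

Lemma cinfty_derive g g' : cinfty g -> (forall x : R, is_derive x 1 g (g' x)) -> cinfty g'.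
Proof.
move=> sg dg n; have [g'' dg'' sg''] := sg n.+1.
by rewrite -(is_derive_derive1 dg) (is_derive_derive1 dg'').
Qed.

Lemma cinfty_is_derive g : cinfty g -> forall x : R, is_derive x 1 g (derive1 g x).
Proof. by move=> /(_ 1%N)[g' dg _] x; rewrite (is_derive_derive1 dg). Qed.

Lemma cinfty_derive1 g : cinfty g -> cinfty (derive1 g).
Proof. by move=> sg; apply: (cinfty_derive sg); exact: cinfty_is_derive. Qed.

Lemma nsmooth_cst n (k : R) : nsmooth n (fun _ : R => k).
Proof. by elim: n k => [//|n IH] k; exists (fun _ => 0); [move=> x; exact: is_derive_cst|exact: IH]. Qed.

Lemma nsmoothD n f g : nsmooth n f -> nsmooth n g -> nsmooth n (fun x => f x + g x).
Proof.
elim: n f g => [//|n IH] f g [f' df sf] [g' dg sg].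
exists (fun x => f' x + g' x); last exact: IH.
by move=> x; exact: is_deriveD.
Qed.

Lemma nsmoothM n f g : nsmooth n f -> nsmooth n g -> nsmooth n (fun x => f x * g x).
Proof.
elim: n f g => [//|n IH] f g /[dup] sf0 [f' df sf] /[dup] sg0 [g' dg sg].
exists (fun x => f x * g' x + g x * f' x).
  by move=> x; have := is_deriveM (df x) (dg x).
by apply: nsmoothD; apply: IH => //; exact: nsmoothS.
Qed.

Lemma nsmooth_affine n g (s t : R) : nsmooth n g -> nsmooth n (fun x => g (s * x + t)).
Proof.
elim: n g => [//|n IH] g [g' dg sg].
exists (fun x => g' (s * x + t) * s).
  move=> x; apply: (is_derive1_comp (f := g)).
  by apply: is_derive_eq; rewrite addr0 /GRing.scale/= mulr1.
by apply: nsmoothM; [exact: IH|exact: nsmooth_cst].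
Qed.

Lemma nsmoothV n g : (forall x, g x != 0) -> nsmooth n g -> nsmooth n (fun x => (g x)^-1).
Proof.
move=> g0; elim: n => [//|n IH] /[dup] sg0 [g' dg sg].
have sV := IH (nsmoothS sg0).
exists (fun x => (- 1 * ((g x)^-1 * (g x)^-1)) * g' x).
  move=> x; have := is_deriveV (g0 x) (dg x).
  by rewrite -exprVn mulN1r expr2.
by apply: nsmoothM => //; apply: nsmoothM; [exact: nsmooth_cst|exact: nsmoothM].
Qed.

Lemma cinfty_cst (k : R) : cinfty (fun _ : R => k).
Proof. by move=> n; exact: nsmooth_cst. Qed.
Lemma cinftyD f g : cinfty f -> cinfty g -> cinfty (fun x => f x + g x).
Proof. by move=> sf sg n; exact: nsmoothD. Qed.
Lemma cinftyM f g : cinfty f -> cinfty g -> cinfty (fun x => f x * g x).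
Proof. by move=> sf sg n; exact: nsmoothM. Qed.
Lemma cinfty_affine g (s t : R) : cinfty g -> cinfty (fun x => g (s * x + t)).
Proof. by move=> sg n; exact: nsmooth_affine. Qed.
Lemma cinftyV g : (forall x, g x != 0) -> cinfty g -> cinfty (fun x => (g x)^-1).
Proof. by move=> g0 sg n; exact: nsmoothV. Qed.

Lemma cinfty_id : cinfty (fun x : R => x).
Proof.
case=> [//|n]; exists (fun _ => 1); last exact: nsmooth_cst.
by move=> x; exact: is_derive_id.
Qed.

Lemma is_derive_sinl (s x : R) : is_derive x 1 (fun x => sin (s * x)) (cos (s * x) * s).
Proof.
apply: (is_derive1_comp (f := @sin R)).
by apply: is_derive_eq; rewrite /GRing.scale/= mulr1.
Qed.

Lemma is_derive_cosl (s x : R) : is_derive x 1 (fun x => cos (s * x)) (- sin (s * x) * s).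
Proof.
apply: (is_derive1_comp (f := @cos R)).
by apply: is_derive_eq; rewrite /GRing.scale/= mulr1.
Qed.

Lemma cinfty_trig (s : R) n :
  nsmooth n (fun x : R => sin (s * x)) /\ nsmooth n (fun x : R => cos (s * x)).
Proof.
elim: n => [//|n [IHs IHc]]; split.
  exists (fun x => cos (s * x) * s); first by move=> x; exact: is_derive_sinl.
  by apply: nsmoothM => //; exact: nsmooth_cst.
exists (fun x => (- 1 * sin (s * x)) * s).
  by move=> x; rewrite mulN1r; exact: is_derive_cosl.
by apply: nsmoothM; [apply: nsmoothM => //|]; exact: nsmooth_cst.
Qed.

(** A family that contains [exp_cutoff], at p = 1, and is stable under differentiation: each
    derivative only changes the polynomial in 1/x. *)
Definition exp_poly (p : {poly R}) (x : R) : R :=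
  if 0 < x then expR (- (1 / x)) * p.[1 / x] else 0.

(** Multiplying p by X costs one power of x, whence the induction for all k at once; a constant term
    is handled by e^(1/x) >= (1/x)^(k+1) / (k+1)!. *)
Lemma exp_poly_flat (p : {poly R}) k : exists2 C, 0 <= C &
  forall x, 0 < x <= 1 -> `|exp_poly p x| <= C * x ^+ k.
Proof.
elim/poly_ind: p k => [|p r IH] k.
  by exists 0 => // x /andP[x0 _]; rewrite /exp_poly x0 horner0 mulr0 normr0 mul0r.
have [C C0 HC] := IH k.+1.
exists (C + `|r| * (k.+1)`!%:R); first by rewrite addr_ge0// mulr_ge0.
move=> x /[dup] xx /andP[x0 x1].
have := HC x xx; rewrite /exp_poly x0 => H.
rewrite hornerMXaddC mulrDr; apply: le_trans (ler_normD _ _) _; rewrite mulrDl; apply: lerD.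
  rewrite div1r in H *; rewrite mulrA normrM (gtr0_norm (_ : 0 < x^-1)) ?invr_gt0//.
  by rewrite ler_pdivrMr// -mulrA -exprSr.
rewrite normrM mulrC -mulrA ler_wpM2l// gtr0_norm ?expR_gt0//.
have x10 : 0 < 1 / x by rewrite divr_gt0.
have e1 := expR_ge1Dxn k (ltW x10).
rewrite expRN invf_ple ?posrE ?expR_gt0//; last by rewrite mulr_gt0 ?exprn_gt0// ltr0n fact_gt0.
apply: le_trans e1; rewrite invfM.
apply: (@le_trans _ _ ((1 / x) ^+ k.+1 / (k.+1)`!%:R)); last by rewrite lerDr.
rewrite mulrC ler_wpM2r ?invr_ge0 ?ler0n// exprMn expr1n mul1r exprVn.
by rewrite lef_pV2 ?posrE ?exprn_gt0// exprS ler_piMl// exprn_ge0// ltW.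
Qed.

Lemma is_derive_exp_poly (p : {poly R}) (x : R) :
  is_derive x 1 (exp_poly p) (exp_poly ('X^2 * (p - p^`()))%R x).
Proof.
have [x0|x0|->] := ltgtP x 0.
- rewrite /exp_poly ltNge (ltW x0)/=.
  apply: (@near_eq_is_derive R R R (fun _ => 0)).
  near=> y; rewrite ltNge (_ : y <= 0 = true)//.
  by apply/ltW; near: y; exact: lt_nbhsl.
- rewrite [X in is_derive _ _ _ X]/exp_poly x0.
  have xn0 : x != 0 by rewrite gt_eqF.
  have d1 : is_derive x 1 (fun y : R => 1 / y) (- (x ^- 2)).
    have := @is_deriveV R id x 1 1 xn0 (is_derive_id _ _).
    rewrite /GRing.scale/= mulr1; under [X in is_derive _ _ X _]eq_fun do rewrite -div1r.
    by [].
  have d2 : is_derive x 1 (fun y : R => - (1 / y)) (x ^- 2).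
    by have := is_deriveN d1; rewrite opprK.
  have d3 : is_derive x 1 (fun y : R => expR (- (1 / y))) (expR (- (1 / x)) * x ^- 2).
    by apply: (is_derive1_comp (f := @expR R)).
  have d4 : is_derive x 1 (fun y : R => p.[1 / y]) (p^`().[1 / x] * - (x ^- 2)).
    by apply: (is_derive1_comp (f := horner p)).
  have d5 := is_deriveM d3 d4.
  have ne : \forall y \near x, expR (- (1 / y)) * p.[1 / y] = exp_poly p y.
    near=> y; rewrite /exp_poly (_ : 0 < y = true)//.
    by near: y; exact: lt_nbhsr.
  apply: (is_derive_eq (@near_eq_is_derive R R R _ _ _ _ _ ne d5)).
  rewrite /GRing.scale/= hornerM hornerXn hornerD hornerN !div1r exprVn; ring.
- rewrite [X in is_derive _ _ _ X]/exp_poly ltxx.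
  (* Flatness of order 2 makes the difference quotient at 0 at most C h in absolute value. *)
  have [C C0 HC] := exp_poly_flat p 2.
  have cv : h^-1 *: (exp_poly p (h *: 1 + 0) - exp_poly p 0) @[h --> (0 : R)^'] --> (0 : R).
    apply/cvgrPdist_le => e e0.
    near=> h; rewrite sub0r normrN addr0 /GRing.scale/= mulr1 {2}/exp_poly ltxx subr0.
    have [h0|h0] := ltP 0 h; last by rewrite /exp_poly ltNge h0 mulr0 normr0 ltW.
    rewrite normrM normfV (gtr0_norm h0) ler_pdivrMl//.
    have h1 : 0 < h <= 1.
      rewrite h0/=; apply: le_trans (ler_norm h) _.
      near: h; apply: dnbhs0_le; exact: ltr01.
    apply: le_trans (HC h h1) _.
    rewrite expr2 mulrCA ler_pM2l//.
    have : `|h| <= e / (C + 1).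
      near: h; apply: dnbhs0_le; rewrite divr_gt0//; lra.
    rewrite (gtr0_norm h0) ler_pdivlMr; last by lra.
    by apply: le_trans; rewrite mulrC ler_wpM2l ?ltW//; lra.
  apply: DeriveDef; first by apply/cvg_ex; exists 0.
  by rewrite /derive; apply: cvg_lim.
Unshelve. all: by end_near. Qed.

Lemma cinfty_exp_poly (p : {poly R}) : cinfty (exp_poly p).
Proof.
move=> n; elim: n p => [//|n IH] p.
by exists (exp_poly ('X^2 * (p - p^`()))%R); [exact: is_derive_exp_poly|exact: IH].
Qed.

Lemma cinfty_exp_cutoff : cinfty (@exp_cutoff R).
Proof.
have -> : @exp_cutoff R = exp_poly 1; last exact: cinfty_exp_poly.
by apply/funext => x; rewrite /exp_cutoff /exp_poly !hornerE.
Qed.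

End smooth_functions.

(** * Schwartz regularity of Fourier integrals *)

Section schwartz_class.
Context (R : realType).
Local Notation mu := (@lebesgue_measure R).
Implicit Types (f g h u v : R -> R).

Definition smooth_cs u := cinfty u /\ exists c, supported c u.

Lemma smooth_cs_cont u : smooth_cs u -> cont_cs u.
Proof. by move=> [su uc]; split=> //; exact: cinfty_continuous. Qed.

Lemma smooth_csMr u h : smooth_cs u -> cinfty h -> smooth_cs (fun x => u x * h x).
Proof.
move=> [su [c uc]] sh; split; first exact: cinftyM.
by exists c => x /uc ->; rewrite mul0r.
Qed.

Lemma smooth_csZ (k : R) u : smooth_cs u -> smooth_cs (fun x => k * u x).
Proof.
move=> [su [c uc]]; split; first by apply: cinftyM => //; exact: cinfty_cst.
by exists c => x /uc ->; rewrite mulr0.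
Qed.

Lemma smooth_cs_derive1 u : smooth_cs u -> smooth_cs (derive1 u).
Proof.
move=> [su [c uc]]; split; first exact: cinfty_derive1.
exists (c + 1) => x cx.
have H : is_derive x 1 u 0.
  apply: (@near_eq_is_derive R R R (fun _ => 0)).
  near=> y; rewrite uc//.
  have : `|x - y| < 1.
    by near: y; apply: (@cvgr_dist_lt _ _ _ (nbhs x) _ id) => //; exact: cvg_id.
  have := ler_normD (x - y) y; rewrite subrK; lra.
by rewrite derive1E; have [_ ->] := H.
Unshelve. all: by end_near. Qed.

Lemma Rintegral_derive1 u : smooth_cs u -> \int[mu]_x derive1 u x = 0.
Proof.
move=> su; have [_ [d ud]] := smooth_cs_derive1 su.
have [smu /supported_pos[c c0 uc]] := su.
pose C := Num.max c d.
have C0 : 0 < C by rewrite lt_max c0.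
rewrite (@Rintegral_supported _ C); last by apply: supported_le ud; rewrite le_max lexx orbT.
have CC : - C < C by lra.
rewrite (FTC2_C1 CC _ (cinfty_is_derive smu)).
  by rewrite !uc ?subrr// ?normrN gtr0_norm// le_max lexx.
by apply: cinfty_continuous; exact: cinfty_derive1.
Qed.

(** Integration by parts, in the form that the derivative of u(y) cos(s y) has integral zero. *)
Lemma Fcos_derive1 u s : smooth_cs u -> Fcos (derive1 u) s = s * Fsin u s.
Proof.
move=> su.
have csu := smooth_cs_cont su; have csd := smooth_cs_cont (smooth_cs_derive1 su).
have sc : smooth_cs (fun y => u y * cos (s * y)).
  by apply: smooth_csMr => // n; have [] := cinfty_trig s n.
have D : derive1 (fun y => u y * cos (s * y)) =
    (fun y => derive1 u y * cos (s * y) + - s * (u y * sin (s * y))).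
  apply: is_derive_derive1 => y.
  apply: (is_derive_eq (is_deriveM (cinfty_is_derive su.1 y) (is_derive_cosl s y))).
  by rewrite /GRing.scale/=; ring.
have := Rintegral_derive1 sc; rewrite D RintegralD_cs; last 2 first.
- by apply: cont_csMr => //; cont.
- by apply: cont_csZ; apply: cont_csMr => //; cont.
rewrite RintegralZ_cs; last by apply: cont_csMr => //; cont.
by rewrite -/(Fcos _ _) -/(Fsin _ _); lra.
Qed.

Lemma Fsin_derive1 u s : smooth_cs u -> Fsin (derive1 u) s = - (s * Fcos u s).
Proof.
move=> su.
have csu := smooth_cs_cont su; have csd := smooth_cs_cont (smooth_cs_derive1 su).
have sc : smooth_cs (fun y => u y * sin (s * y)).
  by apply: smooth_csMr => // n; have [] := cinfty_trig s n.
have D : derive1 (fun y => u y * sin (s * y)) =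
    (fun y => derive1 u y * sin (s * y) + s * (u y * cos (s * y))).
  apply: is_derive_derive1 => y.
  apply: (is_derive_eq (is_deriveM (cinfty_is_derive su.1 y) (is_derive_sinl s y))).
  by rewrite /GRing.scale/=; ring.
have := Rintegral_derive1 sc; rewrite D RintegralD_cs; last 2 first.
- by apply: cont_csMr => //; cont.
- by apply: cont_csZ; apply: cont_csMr => //; cont.
rewrite RintegralZ_cs; last by apply: cont_csMr => //; cont.
by rewrite -/(Fcos _ _) -/(Fsin _ _); lra.
Qed.

Lemma is_derive_paramint u (k k' : R -> R) (s : R) : cont_cs u ->
  continuous k -> (forall x : R, is_derive x 1 k (k' x)) -> (forall x, `|k' x| <= 1) ->
  is_derive s 1 (fun s => \int[mu]_y (u y * k (s * y))) (\int[mu]_y (u y * y * k' (s * y))).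
Proof.
move=> cu ck dk k'1.
have dky (x y : R) : is_derive x 1 (fun x => u y * k (x * y)) (u y * y * k' (x * y)).
  have d1 : is_derive x 1 (fun x => k (x * y)) (k' (x * y) * y).
    apply: (is_derive1_comp (f := k)).
    by apply: is_derive_eq; rewrite /GRing.scale/=; ring.
  apply: (is_derive_eq (is_deriveM (is_derive_cst _ _ _) d1)).
  by rewrite scaler0 addr0 /GRing.scale/=; ring.
have Is : `](s - 1), (s + 1)[%classic s by rewrite /= in_itv/=; apply/andP; split; lra.
have intf (x : R) : `](s - 1), (s + 1)[%classic x ->
    mu.-integrable setT (EFin \o (fun y => u y * k (x * y))).
  move=> _; apply: cont_cs_integrable; apply: cont_csMr => //.
  by apply: cont_comp => //; cont.
have der (x y : R) : `](s - 1), (s + 1)[%classic x -> setT y ->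
    derivable (fun x : R => u y * k (x * y)) x 1 by move=> _ _; have [] := dky x y.
have G0 (y : R) : 0 <= `|u y * y| by [].
have intG : mu.-integrable setT (EFin \o (fun y => `|u y * y|)).
  by apply: cont_cs_integrable; apply: cont_cs_norm; apply: cont_csMr => //; cont.
have p1 (x y : R) : partial1of2 (fun x y => u y * k (x * y)) x y = u y * y * k' (x * y).
  by rewrite partial1of2E; have [_ ->] := dky x y.
have Gub (x y : R) : `](s - 1), (s + 1)[%classic x -> setT y ->
    `|partial1of2 (fun x y => u y * k (x * y)) x y| <= `|u y * y|.
  by move=> _ _; rewrite p1 normrM ler_piMr.
apply: DeriveDef.
  exact: (derivable_under_integral measurableT Is intf der G0 intG Gub).
rewrite -derive1E (differentiation_under_integral measurableT Is intf der G0 intG Gub).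
by apply: eq_Rintegral => y _; rewrite p1.
Qed.

Lemma is_derive_Fcos u (s : R) : cont_cs u ->
  is_derive s 1 (Fcos u) (- Fsin (fun y => u y * y) s).
Proof.
move=> cu.
have dk (x : R) : is_derive x 1 (@cos R) (- sin x) by exact: is_derive_cos.
have s1 (x : R) : `|- sin x| <= 1 by rewrite normrN; exact: sin_max.
apply: (is_derive_eq (is_derive_paramint s cu (@continuous_cos R) dk s1)).
rewrite /Fsin -RintegralN_cs.
  by apply: eq_Rintegral => y _; rewrite mulrN.
by apply: cont_csMr; [apply: cont_csMr => //|]; cont.
Qed.

Lemma is_derive_Fsin u (s : R) : cont_cs u ->
  is_derive s 1 (Fsin u) (Fcos (fun y => u y * y) s).
Proof.
move=> cu.
have dk (x : R) : is_derive x 1 (@sin R) (cos x) by exact: is_derive_sin.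
exact: (@is_derive_paramint u sin cos s cu (@continuous_sin R) dk (@cos_max R)).
Qed.

Lemma FcosZ k u s : cont_cs u -> Fcos (fun y => k * u y) s = k * Fcos u s.
Proof.
move=> cu; rewrite /Fcos -RintegralZ_cs; last by apply: cont_csMr => //; cont.
by apply: eq_Rintegral => y _; rewrite mulrA.
Qed.

Lemma FsinZ k u s : cont_cs u -> Fsin (fun y => k * u y) s = k * Fsin u s.
Proof.
move=> cu; rewrite /Fsin -RintegralZ_cs; last by apply: cont_csMr => //; cont.
by apply: eq_Rintegral => y _; rewrite mulrA.
Qed.

(* Real Fourier integrals of smooth compactly supported amplitudes: this class is
   stable under differentiation and under multiplication by the variable, and its
   members are bounded, which is all that being a Schwartz function requires. *)
Definition fourier_image g := exists u v, [/\ smooth_cs u, smooth_cs v &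
  g = fun x => Fcos u (2 * pi * x) + Fsin v (2 * pi * x)].

Lemma fourier_image_derive g : fourier_image g ->
  exists2 g', fourier_image g' & forall x : R, is_derive x 1 g (g' x).
Proof.
move=> [u [v [su sv ->]]].
have su' := smooth_csMr su (@cinfty_id R); have sv' := smooth_csMr sv (@cinfty_id R).
have cu := smooth_cs_cont su'; have cv := smooth_cs_cont sv'.
exists (fun x => Fcos (fun y => 2 * pi * (v y * y)) (2 * pi * x) +
  Fsin (fun y => - (2 * pi) * (u y * y)) (2 * pi * x)).
  by eexists; eexists; split; last reflexivity; exact: smooth_csZ.
move=> x.
have dl : is_derive x 1 (fun x : R => 2 * pi * x) (2 * pi).
  by apply: is_derive_eq; rewrite /GRing.scale/= mulr1.
have d1 := is_derive1_comp (is_derive_Fcos (2 * pi * x) (smooth_cs_cont su)) dl.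
have d2 := is_derive1_comp (is_derive_Fsin (2 * pi * x) (smooth_cs_cont sv)) dl.
apply: (is_derive_eq (is_deriveD d1 d2)).
by rewrite FcosZ// FsinZ//; ring.
Qed.

(** Integration by parts read backwards: x times a cosine integral is a sine integral of the
    derivative, so the two amplitudes exchange roles. *)
Lemma fourier_image_mulX g : fourier_image g -> fourier_image (fun x => x * g x).
Proof.
move=> [u [v [su sv ->]]].
have su' := smooth_cs_derive1 su; have sv' := smooth_cs_derive1 sv.
have cu := smooth_cs_cont su'; have cv := smooth_cs_cont sv'.
exists (fun y => (2 * pi)^-1 * derive1 v y), (fun y => - (2 * pi)^-1 * derive1 u y).
split; [exact: smooth_csZ|exact: smooth_csZ|apply/funext => x].
rewrite FcosZ// FsinZ// Fcos_derive1// Fsin_derive1//.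
have p0 : (2 * pi : R) != 0 by rewrite mulf_neq0 ?gt_eqF ?pi_gt0.
by move: (2 * pi) p0 => p p0; field.
Qed.

Lemma fourier_image_bounded g : fourier_image g -> exists C, forall x, `|g x| <= C.
Proof.
move=> [u [v [/smooth_cs_cont cu /smooth_cs_cont cv ->]]].
exists (\int[mu]_y `|u y| + \int[mu]_y `|v y|) => x.
have B (w k : R -> R) : cont_cs w -> continuous k -> (forall y, `|k y| <= 1) ->
    `|\int[mu]_y (w y * k y)| <= \int[mu]_y `|w y|.
  move=> cw ck k1.
  apply: le_trans (normr_Rintegral_cs (cont_csMr cw ck)) _.
  apply: le_Rintegral_cs; [by apply: cont_cs_norm; exact: cont_csMr|exact: cont_cs_norm|].
  by move=> y; rewrite normrM ler_piMr.
apply: le_trans (ler_normD _ _) _; apply: lerD; apply: B => //; try by cont.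
- by move=> y; exact: cos_max.
- by move=> y; exact: sin_max.
Qed.

Lemma fourier_image_smooth g : fourier_image g -> smooth g.
Proof.
move=> gF; apply/smoothP => n; elim: n g gF => [//|n IH] g gF.
by have [g' g'F dg] := fourier_image_derive gF; exists g' => //; exact: IH.
Qed.

Lemma fourier_image_rapidly_decreasing g : fourier_image g -> rapidly_decreasing g.
Proof.
move=> gF j k.
have {gF} : fourier_image (derive1n k g).
  elim: k g gF => [//|k IH] g gF; rewrite derive1Sn; apply: IH.
  by have [g' g'F dg] := fourier_image_derive gF; rewrite (is_derive_derive1 dg).
move: (derive1n k g) => f fF; apply: fourier_image_bounded.
elim: j => [|j IH]; first by under eq_fun do rewrite expr0 mul1r.
under eq_fun do rewrite exprS -mulrA; exact: fourier_image_mulX.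
Qed.

End schwartz_class.

(** * The generator and its dyadic square sum *)

Section cutoffs.
Context (R : realType).
Implicit Types (r s t x y z a m : R).
Local Notation f := (@exp_cutoff R).

Lemma exp_cutoff_gt0 x : 0 < x -> f x = expR (- (1 / x)).
Proof. by rewrite /exp_cutoff => ->. Qed.

Lemma exp_cutoff_le0 x : x <= 0 -> f x = 0.
Proof. by rewrite /exp_cutoff ltNge => ->. Qed.

Lemma exp_cutoff_ge0 x : 0 <= f x.
Proof. by rewrite /exp_cutoff; case: ifP => // _; exact: expR_ge0. Qed.

Lemma exp_cutoff_pos x : 0 < x -> 0 < f x.
Proof. by move=> /exp_cutoff_gt0 ->; exact: expR_gt0. Qed.

Lemma le_exp_cutoff x y : x <= y -> f x <= f y.
Proof.
move=> xy; have [x0|x0] := leP x 0; first by rewrite exp_cutoff_le0// exp_cutoff_ge0.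
have y0 : 0 < y by exact: lt_le_trans xy.
by rewrite !exp_cutoff_gt0// ler_expR lerN2 !div1r lef_pV2 ?posrE.
Qed.

(** The edge of [phi_hat] as a function of the depth t into the support: for r > 0 it rises from 0
    at t = 0 to 1 at t = 2 r. *)
Definition step r t := f t / (f t + f (2 * r - t)).

Lemma step_denom_gt0 r t : 0 < r -> 0 < f t + f (2 * r - t).
Proof.
move=> r0; have [t0|t0] := leP t 0.
  by apply: ltr_wpDl; [exact: exp_cutoff_ge0|apply: exp_cutoff_pos; lra].
by apply: ltr_pwDl; [exact: exp_cutoff_pos|exact: exp_cutoff_ge0].
Qed.

Lemma step_ge0 r t : 0 <= step r t.
Proof. by rewrite divr_ge0 ?addr_ge0 ?exp_cutoff_ge0. Qed.

Lemma step_le1 r t : 0 < r -> step r t <= 1.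
Proof.
by move=> r0; rewrite ler_pdivrMr ?step_denom_gt0// mul1r lerDl exp_cutoff_ge0.
Qed.

Lemma step0 r t : t <= 0 -> step r t = 0.
Proof. by move=> t0; rewrite /step exp_cutoff_le0// mul0r. Qed.

Lemma step1 r t : 0 < r -> 2 * r <= t -> step r t = 1.
Proof.
move=> r0 rt; rewrite /step [f (2 * r - t)]exp_cutoff_le0 ?addr0 ?divff//; last by lra.
by rewrite gt_eqF// exp_cutoff_pos//; lra.
Qed.

Lemma step_sym r t : 0 < r -> step r (2 * r - t) = 1 - step r t.
Proof.
move=> r0; have D0 := step_denom_gt0 t r0.
rewrite /step subKr [f (2 * r - t) + _]addrC.
by field; rewrite gt_eqF.
Qed.

Lemma step_half r : 0 < r -> step r r = 1 / 2.
Proof.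
move=> r0; have := step_sym r r0; rewrite (_ : 2 * r - r = r); last by ring.
by lra.
Qed.

Lemma le_step r s t : 0 < r -> s <= t -> step r s <= step r t.
Proof.
move=> r0 st; have Ds := step_denom_gt0 s r0; have Dt := step_denom_gt0 t r0.
rewrite /step ler_pdivrMr// mulrAC ler_pdivlMr// !mulrDr lerD ?(mulrC (f s) (f t))//.
apply: ler_pM; rewrite ?exp_cutoff_ge0 ?le_exp_cutoff//; lra.
Qed.

Lemma smooth_step r : 0 < r -> cinfty (step r).
Proof.
move=> r0; have sf := cinfty_exp_cutoff R.
have sf2 : cinfty (fun t => f (2 * r - t)).
  have := cinfty_affine (- 1) (2 * r) sf.
  by under [X in cinfty X]eq_fun do rewrite mulN1r addrC.
apply: cinftyM => //; apply: cinftyV; last exact: cinftyD.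
by move=> t; rewrite gt_eqF// step_denom_gt0.
Qed.

Lemma phi_hatE b m x : phi_hat b m x = step (1 / m) (b + 1 / m - `|x|).
Proof. by rewrite /phi_hat /step; congr (_ / (_ + f _)); ring. Qed.

Lemma smooth_phi_hat b m r : r = 1 / m -> 0 < r -> r <= b -> cinfty (phi_hat b m).
Proof.
move=> rE r0 rb.
(* The absolute value is not smooth at 0, so [phi_hat] is rewritten as a product of two one-sided
   steps. Since r <= b, on each half-line one of them is constantly 1. *)
have -> : phi_hat b m = (fun x => step r (-1 * x + (b + r)) * step r (1 * x + (b + r))).
  apply/funext => x; rewrite phi_hatE -rE mulN1r mul1r.
  have [x0|x0] := leP 0 x.
    by rewrite ger0_norm// [X in _ * X]step1 ?mulr1//; [congr step; ring|lra].
  by rewrite ltr0_norm// [X in X * _]step1 ?mul1r//; [congr step; ring|lra].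
by have s := smooth_step r0; apply: cinftyM; exact: cinfty_affine.
Qed.

End cutoffs.

(** * Shape of the generator and its surviving dilates *)

Section generator.
Context (R : realType) (a m r : R).
Context (a0 : 0 < a) (rE : r = 1 / m) (r0 : 0 < r) (ra : r < a / 6).
Implicit Types (t x y z : R).

Ltac slra := have := a0; have := r0; have := ra; lra.

Local Notation psih := (psi_hat a m).

Lemma psi_hatN z : psih (- z) = psih z.
Proof.
rewrite /psi_hat !phi_hatE addrC; congr (step _ (_ - _) + step _ (_ - _)).
  by rewrite -[in RHS]normrN; congr (`|_|); ring.
by rewrite -[in RHS]normrN; congr (`|_|); ring.
Qed.

Lemma psi_hatE z : 0 <= z -> psih z = step r (a / 4 + r - `|z - 3 * a / 4|).
Proof.
move=> z0; rewrite /psi_hat !phi_hatE -rE step0 ?add0r//.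
by rewrite ger0_norm; slra.
Qed.

Lemma psi_hat_norm z : psih `|z| = psih z.
Proof. by have [z0|z0] := leP 0 z; [rewrite ger0_norm|rewrite ltr0_norm// psi_hatN]. Qed.

(** For r < a/6 the lower edge is over before 2a/3, so from that point on only the upper edge
    varies. *)
Lemma psi_hat_upper z : 2 * a / 3 <= z -> psih z = step r (a + r - z).
Proof.
move=> za; rewrite psi_hatE; last by slra.
have [h|h] := leP (3 * a / 4) z; first by rewrite ger0_norm ?subr_ge0//; congr step; slra.
by rewrite ltr0_norm ?subr_lt0// !step1//; slra.
Qed.

Lemma psi_hat_lower z : 0 <= z -> z <= 3 * a / 4 -> psih z = step r (z - a / 2 + r).
Proof.
move=> z0 za; rewrite psi_hatE// ler0_norm ?subr_le0//; congr step; slra.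
Qed.

Lemma psi_hat_supported : supported (a + r) psih.
Proof. by move=> z az; rewrite -psi_hat_norm psi_hat_upper ?step0//; slra. Qed.

Lemma psi_hat_inner z : `|z| <= a / 2 - r -> psih z = 0.
Proof. by move=> za; rewrite -psi_hat_norm psi_hat_lower ?step0//; slra. Qed.

Lemma psi_hat_plateau z : a / 2 + r <= `|z| -> `|z| <= a - r -> psih z = 1.
Proof.
move=> z1 z2; rewrite -psi_hat_norm psi_hatE// step1//.
have [h|h] := leP (3 * a / 4) `|z|; first by rewrite ger0_norm ?subr_ge0//; slra.
by rewrite ltr0_norm ?subr_lt0//; slra.
Qed.

Lemma smooth_cs_psi_hat : smooth_cs psih.
Proof.
split; last by exists (a + r); exact: psi_hat_supported.
have s : cinfty (phi_hat (a / 4) m) by apply: (smooth_phi_hat rE r0); slra.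
have := cinftyD (cinfty_affine 1 (3 * a / 4) s) (cinfty_affine 1 (- (3 * a / 4)) s).
by under [X in cinfty X]eq_fun do rewrite !mul1r.
Qed.

Lemma continuous_psi_hat : continuous psih.
Proof. by have [/cinfty_continuous] := smooth_cs_psi_hat. Qed.

Lemma dyadic_scale y : y != 0 ->
  exists n : int, 2 * a / 3 <= (2 : R) ^ (- n) * `|y| < 4 * a / 3.
Proof.
move=> y0; set c := 2 * a / 3; have c0 : 0 < c by rewrite /c; slra.
have x0 : 0 < `|y| / c by rewrite divr_gt0// normr_gt0.
have l2 : 0 < ln 2 :> R by rewrite ln_gt0// ltr1n.
pose n := Num.floor (ln (`|y| / c) / ln 2).
have E (k : int) : (2 : R) ^ k = expR (k%:~R * ln 2) by rewrite -powR_intmul// /powR gt_eqF.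
have h1 : (2 : R) ^ n <= `|y| / c.
  by rewrite E -[leRHS]lnK ?posrE// ler_expR -ler_pdivlMr// floor_le_tmp.
have h2 : `|y| / c < (2 : R) ^ (n + 1).
  rewrite E -[ltLHS]lnK ?posrE// ltr_expR -ltr_pdivrMr//.
  exact: floorD1_gt.
exists n; rewrite -invr_expz.
have p0 : 0 < (2 : R) ^ n by rewrite exprz_gt0.
rewrite ler_pdivlMl// ltr_pdivrMl// -ler_pdivlMr// h1/=.
move: h2; rewrite expfzDr// expr1z ltr_pdivrMr//.
have cE : 2 * c = 4 * a / 3 by rewrite /c; field.
by rewrite -[(2 : R) ^ n * 2 * c]mulrA cE.
Qed.

(** With z in the octave, 2z >= 4a/3 lies beyond the support and z/4 < a/3 lies in the hole around
    0, both because r < a/6. Only the dilates z and z/2 remain. *)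
Lemma psi_hat_dyadic_sum (D : set int) (n0 : int) y z :
  `|y| = (2 : R) ^ n0 * z -> 2 * a / 3 <= z -> z < 4 * a / 3 ->
  \sum_(n <- fset_set D) psih ((2 : R) ^ (- n) * y) ^+ 2 <= psih z ^+ 2 + psih (z / 2) ^+ 2.
Proof.
move=> yz z1 z2.
have E n : psih ((2 : R) ^ (- n) * y) = psih ((2 : R) ^ (n0 - n) * z).
  rewrite -psi_hat_norm normrM yz gtr0_norm ?exprz_gt0// mulrA -expfzDr//.
  by rewrite addrC.
have V n : n != n0 -> n != n0 + 1 -> psih ((2 : R) ^ (n0 - n) * z) = 0.
  move=> nn0 nn1; have p0 : 0 < (2 : R) ^ (n0 - n) by rewrite exprz_gt0.
  have z0 : 0 < z by slra.
  have [h|h] := ltP n n0.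
    have : (2 : R) ^ (1 : int) <= 2 ^ (n0 - n) by rewrite ler_eXz2l ?ltr1n//; lia.
    rewrite expr1z => /(ler_wpM2r (ltW z0)) h2.
    rewrite psi_hat_supported// ger0_norm ?mulr_ge0 ?ltW//; slra.
  have : (2 : R) ^ (n0 - n) <= 2 ^ (- 2 : int).
    rewrite ler_eXz2l ?ltr1n//.
    by move/eqP: nn0; move/eqP: nn1; lia.
  rewrite (_ : (2 : R) ^ (-2 : int) = 1 / 4); last first.
    by rewrite -invr_expz -exprnP; slra.
  move=> /(ler_wpM2r (ltW z0)) h2.
  rewrite psi_hat_inner// ger0_norm ?mulr_ge0 ?ltW//; slra.
have S (s : seq int) : uniq s ->
    \sum_(n <- s) psih ((2 : R) ^ (n0 - n) * z) ^+ 2 <= psih z ^+ 2 + psih (z / 2) ^+ 2.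
  move=> us.
  have F0 (n : int) : n != n0 -> n != n0 + 1 -> psih ((2 : R) ^ (n0 - n) * z) ^+ 2 = 0.
    by move=> ? ?; rewrite V// expr0n.
  (* [D] may contain both, one or neither of the two surviving scales; indicator terms cover all
     cases at once. *)
  pose G (n k : int) : R := if n == k then psih ((2 : R) ^ (n0 - k) * z) ^+ 2 else 0.
  apply: (@le_trans _ _ (\sum_(n <- s) (G n n0 + G n (n0 + 1)))).
    apply: ler_sum => n _; rewrite /G.
    case: eqVneq => [->|h1].
      by rewrite lerDl; case: ifP => // _; exact: sqr_ge0.
    by case: eqVneq => [->|h2]; rewrite ?add0r// F0.
  rewrite big_split/=.
  have G1 (k : int) : \sum_(n <- s) G n k <= psih ((2 : R) ^ (n0 - k) * z) ^+ 2.
    rewrite /G; have [ks|ks] := boolP (k \in s).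
      by rewrite (bigD1_seq k)//= eqxx big1 ?addr0// => n /negPf ->.
    rewrite big_seq big1 ?sqr_ge0// => n ns; case: eqVneq => // nk.
    by rewrite nk (negbTE ks) in ns.
  apply: le_trans (lerD (G1 n0) (G1 (n0 + 1))) _.
  rewrite subrr expr0z mul1r (_ : n0 - (n0 + 1) = -1); last by ring.
  by rewrite exprN1 mulrC.
under eq_bigr do rewrite E.
exact: S (fset_uniq _).
Qed.

End generator.

(** * Overlap of two consecutive dilates *)

Section overlap.
Context (R : realType).
Implicit Types (r s t u v x y z a m : R).

Lemma step_sigmoid r s : 0 < s -> 0 < 2 * r - s ->
  step r s = (1 + expR (1 / s - 1 / (2 * r - s)))^-1.
Proof.
move=> s0 s1; rewrite /step !exp_cutoff_gt0//.
have e1 := expR_gt0 (- (1 / s)); have e2 := expR_gt0 (- (1 / (2 * r - s))).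
have -> : expR (1 / s - 1 / (2 * r - s)) = expR (- (1 / (2 * r - s))) / expR (- (1 / s)).
  by rewrite -expRN -expRD opprK addrC.
by field; rewrite ?gt_eqF ?addr_gt0//.
Qed.

Lemma expRN_cube x : 0 <= x -> expR (- x) * x ^+ 3 <= 6.
Proof.
move=> x0; have := expR_ge1Dxn 2 x0; rewrite (_ : 3`!%:R = 6 :> R); last by [].
move=> h; rewrite expRN mulrC ler_pdivrMr ?expR_gt0//.
by rewrite mulrC -ler_pdivrMr//; apply: le_trans h; rewrite lerDr.
Qed.

Lemma expRN_sqr x : 0 <= x -> expR (- x) * x ^+ 2 <= 2.
Proof.
move=> x0; have := expR_ge1Dxn 1 x0; rewrite (_ : 2`!%:R = 2 :> R); last by [].
move=> h; rewrite expRN mulrC ler_pdivrMr ?expR_gt0//.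
by rewrite mulrC -ler_pdivrMr//; apply: le_trans h; rewrite lerDr.
Qed.

(** A mean value estimate: the slope of the logistic function at and beyond x is at most e^(-x) in
    absolute value. *)
Lemma sigmoid_diff x y : x <= y ->
  (1 + expR x)^-1 - (1 + expR y)^-1 <= expR (- x) * (y - x).
Proof.
move=> xy.
have P0 := expR_gt0 x; have Q0 := expR_gt0 y.
have PQ : expR x <= expR y by rewrite ler_expR.
have E : (1 + expR x)^-1 - (1 + expR y)^-1 =
    (expR y - expR x) / ((1 + expR x) * (1 + expR y)).
  by field; rewrite ?gt_eqF ?addr_gt0.
rewrite E; apply: (@le_trans _ _ ((expR y - expR x) / (expR x * expR y))).
  rewrite ler_wpM2l ?subr_ge0// lef_pV2 ?posrE ?mulr_gt0 ?addr_gt0//.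
  by rewrite mulrDl mul1r mulrDr mulr1; lra.
have -> : (expR y - expR x) / (expR x * expR y) = expR (- x) * (1 - expR (x - y)).
  by rewrite expRD !expRN; field; rewrite ?gt_eqF.
rewrite ler_wpM2l ?expR_ge0//.
by have := expR_ge1Dx (x - y); lra.
Qed.

(** Write s(x) = 1/(1 + e^x), d = r^2 - u^2/4 and e = r^2 - u^2. For u < r the first step is 1 -
    s(2u/e), and it bounds its own square; the second is s(u/d), with square at most s(2u/d). So the
    excess over 1 is at most s(2u/d) - s(2u/e), where the arguments differ only to third order in u.
    This is used for u <= r/2; beyond, the second square is small enough by itself. *)
Lemma step_pair_le_gt0 r u : 0 < r -> 0 < u ->
  step r (r + u) ^+ 2 + step r (r - u / 2) ^+ 2 <= 1 + 2 * r ^+ 2.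
Proof.
move=> r0 u0.
have p0 := step_ge0 r (r + u); have p1 := step_le1 (r + u) r0.
have pp : step r (r + u) ^+ 2 <= step r (r + u) by rewrite expr2 ler_piMr.
have r2 : 0 <= r ^+ 2 by exact: sqr_ge0.
have [ur|ur] := leP (2 * r) u.
  by rewrite [step r (r - u / 2)]step0 ?expr0n/=; lra.
set d := r ^+ 2 - u ^+ 2 / 4.
have u2 : u ^+ 2 < (2 * r) ^+ 2 by rewrite ltr_pXn2r// ?nnegrE; lra.
have d0 : 0 < d by rewrite /d; move: u2; rewrite exprMn; lra.
have qE : step r (r - u / 2) = (1 + expR (u / d))^-1.
  rewrite step_sigmoid; [|lra|lra].
  rewrite (_ : 1 / (r - u / 2) - _ = u / d)//.
  by rewrite /d; field; apply/and3P; split; rewrite ?gt_eqF//; move: d0; rewrite /d; lra.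
have q2 : step r (r - u / 2) ^+ 2 <= (1 + expR (2 * u / d))^-1.
  rewrite qE exprVn lef_pV2 ?posrE ?exprn_gt0 ?addr_gt0 ?expR_gt0//.
  have -> : 2 * u / d = u / d + u / d by ring.
  by rewrite expRD; have := expR_gt0 (u / d); lra.
have dr : d <= r ^+ 2 by rewrite /d; have := sqr_ge0 u; lra.
have vE : 2 * (u / r ^+ 2) <= 2 * u / d.
  by rewrite -mulrA ler_pM2l// ler_pM2l// lef_pV2// posrE exprn_gt0.
(* When u > r/2, one has 2u/d >= 2u/r^2 >= 1/r, so the second square is at most e^(-1/r), which is
   at most 2 r^2. *)
have [ur2|ur2] := leP u (r / 2); last first.
  apply: le_trans (lerD pp (le_refl _)) _; rewrite addrC.
  have : (1 + expR (2 * u / d))^-1 <= 2 * r ^+ 2.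
    apply: (@le_trans _ _ (expR (- (2 * u / d)))).
      by rewrite expRN lef_pV2 ?posrE ?addr_gt0 ?expR_gt0// lerDr.
    apply: (@le_trans _ _ (expR (- (r^-1)))).
      rewrite ler_expR lerN2; apply: le_trans vE.
      rewrite expr2 invfM !mulrA ler_peMl ?invr_ge0 ?ltW//.
      by rewrite ltr_pdivlMr//; lra.
    have := @expRN_sqr (r^-1); rewrite invr_ge0 (ltW r0) exprVn => /(_ isT).
    by rewrite ler_pdivrMr ?exprn_gt0.
  lra.
set e := r ^+ 2 - u ^+ 2.
have u2r : u ^+ 2 <= r ^+ 2 / 4.
  have : u ^+ 2 <= (r / 2) ^+ 2 by rewrite ler_pXn2r// nnegrE; lra.
  by rewrite exprMn; lra.
have rp : 0 < r ^+ 2 by rewrite exprn_gt0.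
have e0 : 3 / 4 * r ^+ 2 <= e by rewrite /e; lra.
have e1 : 0 < e by lra.
have d1 : 3 / 4 * r ^+ 2 <= d by rewrite /d; lra.
have pE : step r (r + u) = 1 - (1 + expR (2 * u / e))^-1.
  rewrite (_ : r + u = 2 * r - (r - u)); last by ring.
  rewrite step_sym// step_sigmoid; [|lra|lra].
  congr (1 - (1 + expR _)^-1); rewrite /e.
  by field; apply/and3P; split; rewrite ?gt_eqF//; move: e1; rewrite /e; lra.
have ed : e <= d by rewrite /e /d; have := sqr_ge0 u; lra.
have xy : 2 * u / d <= 2 * u / e.
  by rewrite ler_pM2l ?lef_pV2 ?posrE// mulr_gt0.
have D := sigmoid_diff xy.
set v := u / r ^+ 2 in vE.
have v0 : 0 <= v by rewrite divr_ge0// ltW.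
(* The difference is (3/2) u^3 / (e d), and both e and d are at least (3/4) r^2. *)
have De : 2 * u / e - 2 * u / d <= 8 / 3 * r ^+ 2 * v ^+ 3.
  have -> : 2 * u / e - 2 * u / d = 3 / 2 * u ^+ 3 / (e * d).
    rewrite -[3 / 2 * u ^+ 3](_ : 2 * u * (d - e) = _); last by rewrite /d /e; field.
    by field; rewrite ?gt_eqF.
  rewrite ler_pdivrMr ?mulr_gt0//.
  have -> : 3 / 2 * u ^+ 3 = 8 / 3 * r ^+ 2 * v ^+ 3 * (3 / 4 * r ^+ 2 * (3 / 4 * r ^+ 2)).
    by rewrite /v; field; rewrite gt_eqF.
  rewrite ler_wpM2l//.
    by rewrite mulr_ge0 ?exprn_ge0// mulr_ge0//; lra.
  by apply: ler_pM => //; rewrite mulr_ge0.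
(* Since (8/3) v^3 is a third of (2v)^3, the bound 6 on e^(-x) x^3 at x = 2v yields 2 r^2. *)
have B : expR (- (2 * u / d)) * (2 * u / e - 2 * u / d) <= 2 * r ^+ 2.
  apply: (@le_trans _ _ (expR (- (2 * v)) * (8 / 3 * r ^+ 2 * v ^+ 3))).
    apply: ler_pM => //; first by rewrite subr_ge0.
    by rewrite ler_expR lerN2.
  have := @expRN_cube (2 * v); rewrite mulr_ge0// exprMn => /(_ isT) h.
  have -> : expR (- (2 * v)) * (8 / 3 * r ^+ 2 * v ^+ 3) =
    1 / 3 * r ^+ 2 * (expR (- (2 * v)) * (2 ^+ 3 * v ^+ 3)) by field.
  apply: le_trans (ler_wpM2l _ h) _; last by lra.
  by rewrite mulr_ge0.
by rewrite pE in pp; rewrite pE; lra.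
Qed.

(* The two factors are [psi_hat] at [a + t] and at [(a + t) / 2], that is, two
   consecutive dyadic dilates near the edge of the support. *)
Lemma step_pair_le r t : 0 < r ->
  step r (r - t) ^+ 2 + step r (r + t / 2) ^+ 2 <= 1 + 2 * r ^+ 2.
Proof.
move=> r0; have [t0|t0] := leP 0 t; last first.
  have := @step_pair_le_gt0 r (- t) r0; rewrite oppr_gt0 => /(_ t0).
  by rewrite mulNr opprK.
set q := step r (r + t / 2).
have q0 : 0 <= q by exact: step_ge0.
have q1 : q <= 1 by exact: step_le1.
have p0 : 0 <= step r (r - t) by exact: step_ge0.
(* For t >= 0 monotonicity suffices: r - t <= r - t/2, and the step at r - t/2 is the complement of
   [q]. Then (1 - q)^2 + q^2 <= 1. *)
have pq : step r (r - t) <= 1 - q.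
  rewrite /q -step_sym//; apply: le_step => //; lra.
have : step r (r - t) ^+ 2 <= (1 - q) ^+ 2 by rewrite ler_pXn2r// nnegrE; lra.
have : q ^+ 2 <= q by rewrite expr2 ler_piMr.
have := sqr_ge0 r; lra.
Qed.

End overlap.

(** * Bounds on the dyadic square sum *)

Section generator_bounds.
Context (R : realType) (a m r : R).
Context (a0 : 0 < a) (rE : r = 1 / m) (r0 : 0 < r) (ra : r < a / 6).
Implicit Types (t x y z : R).

Ltac slra := have := a0; have := r0; have := ra; lra.

Local Notation psih := (psi_hat a m).

(** Both edges have height 1/2 at their midpoints a/2 and a. In the octave, a point z <= a has not
    passed the middle of the falling edge, and for z > a the point z/2 has passed the middle of the
    rising one. *)
Lemma psi_hat_dyadic_cover y : y != 0 ->
  exists n : int, 1 / 4 <= psih ((2 : R) ^ (- n) * y) ^+ 2.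
Proof.
move=> y0; have [n /andP[z1 z2]] := dyadic_scale a0 r0 ra y0.
set z := (2 : R) ^ (- n) * `|y| in z1 z2.
have H w : 1 / 2 <= psih w -> 1 / 4 <= psih w ^+ 2.
  move=> h; rewrite (_ : 1 / 4 = (1 / 2) ^+ 2); last by field.
  by rewrite ler_pXn2r// nnegrE; lra.
have Z k : psih ((2 : R) ^ k * y) = psih ((2 : R) ^ k * `|y|).
  by rewrite -[LHS]psi_hat_norm normrM gtr0_norm ?exprz_gt0.
have [za|za] := leP z a.
  exists n; apply: H; rewrite Z -/z (psi_hat_upper a0 rE r0 ra)// -(step_half r0).
  by apply: le_step => //; lra.
exists (n + 1); apply: H; rewrite Z opprD expfzDr// exprN1 mulrAC -/z.
rewrite (psi_hat_lower a0 rE r0 ra); [|slra|slra].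
by rewrite -(step_half r0); apply: le_step => //; lra.
Qed.

Lemma psi_hat_pair_le z : 2 * a / 3 <= z -> z < 4 * a / 3 ->
  psih z ^+ 2 + psih (z / 2) ^+ 2 <= 1 + 2 * r ^+ 2.
Proof.
move=> z1 z2; rewrite (psi_hat_upper a0 rE r0 ra)//.
rewrite (psi_hat_lower a0 rE r0 ra); [|slra|slra].
have := step_pair_le (z - a) r0.
rewrite (_ : r - (z - a) = a + r - z); last by ring.
by rewrite (_ : r + (z - a) / 2 = z / 2 - a / 2 + r); last by field.
Qed.

Lemma psi_hat_sum_le (D : set int) y :
  \sum_(n <- fset_set D) psih ((2 : R) ^ (- n) * y) ^+ 2 <= 1 + 2 * r ^+ 2.
Proof.
have [->|y0] := eqVneq y 0.
  rewrite big1; first by have := sqr_ge0 r; lra.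
  move=> n _.
  by rewrite mulr0 (psi_hat_inner a0 rE r0 ra) ?expr0n// normr0; slra.
have [n /andP[z1 z2]] := dyadic_scale a0 r0 ra y0.
apply: le_trans (psi_hat_pair_le z1 z2).
apply: (psi_hat_dyadic_sum a0 rE r0 ra D (n0 := n)) => //.
by rewrite mulrA -expfzDr// subrr expr0z mul1r.
Qed.

Lemma sqr_diff_away (c d y : R) : 0 < c -> d <= `| `|y| - c| -> 0 <= d ->
  (c * d) ^+ 2 <= (y ^+ 2 - c ^+ 2) ^+ 2.
Proof.
move=> c0 h d0.
rewrite -(real_normK (num_real y)) -(real_normK (num_real (_ - c ^+ 2))).
rewrite ler_pXn2r ?nnegrE ?mulr_ge0// ?(ltW c0)//.
rewrite subr_sqr normrM mulrC (ger0_norm (_ : 0 <= `|y| + c)); last by rewrite addr_ge0// ltW.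
by apply: ler_pM => //; [exact: ltW|rewrite lerDr].
Qed.

(** Near |y| = a the two-term sum is continuous with value 1/2 at a; farther away the weight is
    bounded below, and a large multiple of it exceeds the uniform bound on the sum. *)
Lemma psi_hat_sum_near_edge (e : R) : 0 < e -> exists2 C, 0 <= C &
  forall (D : set int) y, \sum_(n <- fset_set D) psih ((2 : R) ^ (- n) * y) ^+ 2 <=
    1 / 2 + e + C * (y ^+ 2 - a ^+ 2) ^+ 2.
Proof.
move=> e0.
have cps := continuous_psi_hat a0 rE r0 ra.
pose k z := psih z ^+ 2 + psih (z / 2) ^+ 2.
have ck : continuous k.
  rewrite /k; apply: contD; apply: contX => //.
  by apply: cont_comp => //; cont.
have ka : k a = 1 / 2.
  rewrite /k (psi_hat_upper a0 rE r0 ra); last by slra.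
  rewrite (psi_hat_lower a0 rE r0 ra); [|slra|slra].
  rewrite subrr add0r addrAC subrr add0r step_half//.
  by field.
have /cvgrPdist_le/(_ e e0)[d /= d0 dP] := ck a.
(* The distance a/3 keeps |y| in the octave, where two dilates account for the whole sum. *)
pose d' := Num.min d (a / 3).
have d'0 : 0 < d' by rewrite lt_min d0/=; slra.
have B0 : 0 <= 1 + 2 * r ^+ 2 by have := sqr_ge0 r; lra.
have ad : 0 < (a * d') ^+ 2 by rewrite exprn_gt0// mulr_gt0.
exists ((1 + 2 * r ^+ 2) / (a * d') ^+ 2).
  by rewrite divr_ge0// ltW.
move=> D y; have [h|h] := ltP `| `|y| - a| d'.
  have [h1 h2] : 2 * a / 3 <= `|y| /\ `|y| < 4 * a / 3.
    have : `| `|y| - a| < a / 3 by apply: lt_le_trans h _; rewrite ge_min lexx orbT.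
    by rewrite ltr_norml => /andP[? ?]; split; slra.
  apply: (@le_trans _ _ (k `|y|)).
    by apply: (psi_hat_dyadic_sum a0 rE r0 ra D (n0 := 0)) => //; rewrite expr0z mul1r.
  have : `|k a - k `|y| | <= e.
    by apply: dP => /=; rewrite distrC (lt_le_trans h)// ge_min lexx.
  rewrite ka ler_norml => /andP[? _].
  have : 0 <= (1 + 2 * r ^+ 2) / (a * d') ^+ 2 * (y ^+ 2 - a ^+ 2) ^+ 2.
    by rewrite mulr_ge0 ?sqr_ge0// divr_ge0// ltW.
  lra.
apply: le_trans (psi_hat_sum_le D y) _.
have S := sqr_diff_away a0 h (ltW d'0).
have : 1 + 2 * r ^+ 2 <= (1 + 2 * r ^+ 2) / (a * d') ^+ 2 * (y ^+ 2 - a ^+ 2) ^+ 2.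
  rewrite mulrAC ler_pdivlMr// ler_pM2l//.
  by have := sqr_ge0 r; lra.
lra.
Qed.

Lemma psi_hat_near_plateau : exists2 C, 0 <= C &
  forall y, 1 - C * (y ^+ 2 - (3 * a / 4) ^+ 2) ^+ 2 <= psih y ^+ 2.
Proof.
(* The half-width of the plateau, whose centre is 3a/4. *)
pose d := a / 4 - r.
have d0 : 0 < d by rewrite /d; slra.
have c0 : 0 < 3 * a / 4 by slra.
have ad : 0 < (3 * a / 4 * d) ^+ 2 by rewrite exprn_gt0// mulr_gt0.
exists (((3 * a / 4 * d) ^+ 2)^-1); first by rewrite invr_ge0 ltW.
move=> y; have [h|h] := leP d `| `|y| - 3 * a / 4|.
  have S := sqr_diff_away c0 h (ltW d0).
  have : 1 <= ((3 * a / 4 * d) ^+ 2)^-1 * (y ^+ 2 - (3 * a / 4) ^+ 2) ^+ 2.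
    by rewrite ler_pdivlMl// mulr1.
  by have := sqr_ge0 (psih y); lra.
have [h1 h2] : a / 2 + r <= `|y| /\ `|y| <= a - r.
  by move: h; rewrite ltr_norml /d => /andP[? ?]; split; lra.
rewrite (psi_hat_plateau a0 rE r0 ra)// expr1n lerBlDr lerDl.
by rewrite mulr_ge0 ?sqr_ge0// invr_ge0 ltW.
Qed.

End generator_bounds.

(** * Test functions concentrated at a frequency *)

Section concentrated_functions.
Context (R : realType).
Local Notation mu := (@lebesgue_measure R).
Implicit Types (f g h u v w : R -> R).

Lemma nsq_scale u (l : R) : 0 < l -> cont_cs u -> nsq (fun x => u (l * x)) = nsq u / l.
Proof.
move=> l0 cu; have [cu1 _] := cu.
have cu2 : cont_cs (fun x => u (l * x)).
  have [c c0 uc] := supported_pos cu.2.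
  split; first by apply: cont_comp => //; cont.
  exists (c / l) => x cx; apply: uc.
  by rewrite normrM (gtr0_norm l0) mulrC -ler_pdivrMr.
have cu3 : continuous (fun x => u x ^+ 2) by cont.
have := integral_scale l0 cu3 (fun x => sqr_ge0 (u x)).
rewrite -EFin_Rintegral//; last by apply: cont_cs_integrable; exact: cont_cs_sqr.
rewrite -EFin_Rintegral//; last by apply: cont_cs_integrable; apply: cont_csZ; exact: cont_cs_sqr.
rewrite RintegralZ_cs; last exact: cont_cs_sqr.
move=> [E]; rewrite /nsq E mulrC mulKf// gt_eqF//.
Qed.

(* The operator [g'' + t^2 g] multiplies the Fourier transform by [t^2 - s^2]; on the
   pair [W cos(t x)], [W sin(t x)] it only involves [W'] and [W'']. *)
Definition freq_defect (t : R) g x := derive1 (derive1 g) x + t ^+ 2 * g x.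

Lemma smooth_cs_freq_defect t g : smooth_cs g -> smooth_cs (freq_defect t g).
Proof.
move=> sg; have [sg2 [c gc]] := smooth_cs_derive1 (smooth_cs_derive1 sg).
have [sg1 [d gd]] := sg.
split; first by apply: cinftyD => //; apply: cinftyM => //; exact: cinfty_cst.
exists (Num.max c d) => x; rewrite ge_max /freq_defect => /andP[/gc -> /gd ->].
by rewrite mulr0 addr0.
Qed.

Lemma Fsq_freq_defect t g s : smooth_cs g ->
  Fsq (freq_defect t g) s = (s ^+ 2 - t ^+ 2) ^+ 2 * Fsq g s.
Proof.
move=> sg; have sg1 := smooth_cs_derive1 sg; have sg2 := smooth_cs_derive1 sg1.
have cg := smooth_cs_cont sg; have cg2 := smooth_cs_cont sg2.
have EC : Fcos (freq_defect t g) s = (t ^+ 2 - s ^+ 2) * Fcos g s.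
  rewrite -[LHS]/(\int[mu]_y (freq_defect t g y * cos (s * y))).
  under eq_Rintegral do rewrite /freq_defect mulrDl.
  rewrite RintegralD_cs; last 2 first.
  - by apply: cont_csMr => //; cont.
  - by apply: cont_csMr; [exact: cont_csZ|cont].
  rewrite -/(Fcos (derive1 (derive1 g)) s) -/(Fcos (fun y => t ^+ 2 * g y) s).
  by rewrite Fcos_derive1// Fsin_derive1// FcosZ//; ring.
have ES : Fsin (freq_defect t g) s = (t ^+ 2 - s ^+ 2) * Fsin g s.
  rewrite -[LHS]/(\int[mu]_y (freq_defect t g y * sin (s * y))).
  under eq_Rintegral do rewrite /freq_defect mulrDl.
  rewrite RintegralD_cs; last 2 first.
  - by apply: cont_csMr => //; cont.
  - by apply: cont_csMr; [exact: cont_csZ|cont].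
  rewrite -/(Fsin (derive1 (derive1 g)) s) -/(Fsin (fun y => t ^+ 2 * g y) s).
  by rewrite Fsin_derive1// Fcos_derive1// FsinZ//; ring.
by rewrite /Fsq EC ES; ring.
Qed.

Lemma derive2_mul_trig w (t : R) : smooth_cs w ->
  freq_defect t (fun x => w x * cos (t * x)) =
    (fun x => derive1 (derive1 w) x * cos (t * x) - 2 * t * derive1 w x * sin (t * x)) /\
  freq_defect t (fun x => w x * sin (t * x)) =
    (fun x => derive1 (derive1 w) x * sin (t * x) + 2 * t * derive1 w x * cos (t * x)).
Proof.
move=> [sw _]; have sw1 := cinfty_derive1 sw.
have d0 := cinfty_is_derive sw; have d1 := cinfty_is_derive sw1.
have C (u u' : R -> R) : (forall x : R, is_derive x 1 u (u' x)) ->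
    derive1 (fun x => u x * cos (t * x)) =
    (fun x => u' x * cos (t * x) + (- t) * (u x * sin (t * x))).
  move=> du; apply: is_derive_derive1 => x.
  apply: (is_derive_eq (is_deriveM (du x) (is_derive_cosl t x))).
  by rewrite /GRing.scale/=; ring.
have S (u u' : R -> R) : (forall x : R, is_derive x 1 u (u' x)) ->
    derive1 (fun x => u x * sin (t * x)) =
    (fun x => u' x * sin (t * x) + t * (u x * cos (t * x))).
  move=> du; apply: is_derive_derive1 => x.
  apply: (is_derive_eq (is_deriveM (du x) (is_derive_sinl t x))).
  by rewrite /GRing.scale/=; ring.
have D (u v u' v' : R -> R) (k : R) : (forall x : R, is_derive x 1 u (u' x)) ->
    (forall x : R, is_derive x 1 v (v' x)) ->
    derive1 (fun x => u x + k * v x) = (fun x => u' x + k * v' x).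
  by move=> du dv; exact: is_derive_derive1.
have sc (u : R -> R) : cinfty u -> cinfty (fun x => u x * cos (t * x)).
  by move=> su; apply: cinftyM => // n; have [] := cinfty_trig t n.
have ss (u : R -> R) : cinfty u -> cinfty (fun x => u x * sin (t * x)).
  by move=> su; apply: cinftyM => // n; have [] := cinfty_trig t n.
have dC (u : R -> R) (su : cinfty u) := cinfty_is_derive (sc u su).
have dS (u : R -> R) (su : cinfty u) := cinfty_is_derive (ss u su).
split; apply/funext => x; rewrite /freq_defect.
- rewrite (C _ _ d0) (D _ _ _ _ (- t) (dC _ sw1) (dS _ sw)) (C _ _ d1) (S _ _ d0).
  by ring.
- rewrite (S _ _ d0) (D _ _ _ _ t (dS _ sw1) (dC _ sw)) (S _ _ d1) (C _ _ d0).
  by ring.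
Qed.

(** Pointwise this is a rotation of the vector (u, v). The cosine and sine test functions are
    treated as a pair because the sum of their norms is explicit. *)
Lemma nsq_rotation u v (t : R) : cont_cs u -> cont_cs v ->
  nsq (fun x => u x * cos (t * x) - v x * sin (t * x)) +
  nsq (fun x => u x * sin (t * x) + v x * cos (t * x)) = nsq u + nsq v.
Proof.
move=> cu cv.
have cc (w : R -> R) : cont_cs w -> cont_cs (fun x => w x * cos (t * x)).
  by move=> cw; apply: cont_csMr => //; cont.
have cs (w : R -> R) : cont_cs w -> cont_cs (fun x => w x * sin (t * x)).
  by move=> cw; apply: cont_csMr => //; cont.
rewrite /nsq -!RintegralD_cs; try by apply: cont_cs_sqr => //.
- apply: eq_Rintegral => x _; rewrite !(sqrrB, sqrrD) !exprMn sin2cos2; ring.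
- by apply: cont_cs_sqr; apply: cont_csB; [exact: cc|exact: cs].
- by apply: cont_cs_sqr; apply: cont_csD; [exact: cs|exact: cc].
Qed.

(** With W(x) = w(l x), each derivative brings l^2 into the squared norm and the dilation itself
    1/l: hence l^3 for W'', l for W' and 1/l for W. *)
Lemma scaled_energy_lt (l k A1 A2 N : R) : 0 < l -> l <= 1 -> 0 <= k -> 0 <= A1 -> 0 <= A2 ->
  l * (A2 + k * A1) < N -> l ^+ 3 * A2 + k * (l * A1) < N / l.
Proof.
move=> l0 l1 k0 A10 A20 h; rewrite ltr_pdivlMr//; apply: le_lt_trans h.
have l4 : l ^+ 4 <= l by rewrite exprS ler_piMr ?(ltW l0)// exprn_ile1// ltW.
have l2 : l ^+ 2 <= l by rewrite expr2 ler_piMr ?(ltW l0).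
have h1 := ler_wpM2r A20 l4.
have h2 := ler_wpM2r (mulr_ge0 k0 A10) l2.
rewrite (_ : _ * l = l ^+ 4 * A2 + l ^+ 2 * (k * A1)); last by ring.
by rewrite mulrDr lerD.
Qed.

(** For a wide dilate W of [w], the defects of W cos(t x) and W sin(t x) have a sum that is small
    against the sum of their norms, so at least one of the two functions has a small defect against
    its own norm. The inequality is kept strict because it also yields 0 < [nsq g]. *)
Lemma frequency_concentration w (c e : R) : smooth_cs w -> 0 < nsq w -> 0 < e ->
  exists g, [/\ cont_cs g, 0 < nsq g,
    continuous (fun y : R => (y ^+ 2 - c ^+ 2) ^+ 2 * Fsq g (2 * pi * y)) &
    (\int[mu]_y ((y ^+ 2 - c ^+ 2) ^+ 2 * Fsq g (2 * pi * y))%:E <= (e * nsq g)%:E)%E].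
Proof.
move=> sw w0 e0; set t := 2 * pi * c.
have p0 : 0 < 2 * pi :> R by rewrite mulr_gt0 ?pi_gt0.
(* The operator acts in the variable 2 pi y, so its squared symbol is (2 pi)^4 times the weight. *)
set e' := (2 * pi) ^+ 4 * e.
have e'0 : 0 < e' by rewrite mulr_gt0// exprn_gt0.
have sw1 := smooth_cs_derive1 sw; have sw2 := smooth_cs_derive1 sw1.
have t4 : 0 <= 4 * t ^+ 2 by rewrite mulr_ge0// sqr_ge0.
set X := nsq (derive1 (derive1 w)) + 4 * t ^+ 2 * nsq (derive1 w).
have X0 : 0 <= X.
  by rewrite addr_ge0 ?nsq_ge0// mulr_ge0 ?nsq_ge0.
pose l := Num.min 1 (e' * nsq w / (X + 1)).
have X1 : 0 < X + 1 by lra.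
have l0 : 0 < l by rewrite lt_min ltr01 divr_gt0// mulr_gt0.
have l1 : l <= 1 by rewrite ge_min lexx.
have lX : l * X < e' * nsq w.
  have h : l * (X + 1) <= e' * nsq w by rewrite -ler_pdivlMr// ge_min lexx orbT.
  by rewrite mulrDr mulr1 in h; lra.
pose W x := w (l * x).
have [sws [cw wc]] := sw.
have dl (x : R) : is_derive x 1 (fun x : R => l * x) l.
  by apply: is_derive_eq; rewrite /GRing.scale/= mulr1.
have dW (u : R -> R) : cinfty u ->
    derive1 (fun x => u (l * x)) = (fun x => l * derive1 u (l * x)).
  move=> su; apply: is_derive_derive1 => x.
  apply: (is_derive_eq (is_derive1_comp (cinfty_is_derive su (l * x)) (dl x))).
  by rewrite mulrC.
have sW : smooth_cs W.
  split.
    have := cinfty_affine l 0 sws.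
    by under [X in cinfty X]eq_fun do rewrite addr0.
  exists (cw / l) => x cx; apply: wc.
  by rewrite normrM (gtr0_norm l0) mulrC -ler_pdivrMr.
have W1 : derive1 W = (fun x => l * derive1 w (l * x)) by rewrite /W dW.
have sl : cinfty (fun x : R => l * derive1 w x).
  by apply: cinftyM; [exact: cinfty_cst|case: sw1].
have W2 : derive1 (derive1 W) = (fun x => l ^+ 2 * derive1 (derive1 w) (l * x)).
  rewrite W1 (dW (fun x => l * derive1 w x))//; apply/funext => x.
  rewrite expr2 -mulrA; congr (_ * _).
  have : derive1 (fun x => l * derive1 w x) = (fun x => l * derive1 (derive1 w) x).
    apply: is_derive_derive1 => z.
    apply: (is_derive_eq (is_deriveM (is_derive_cst l z 1) (cinfty_is_derive sw1.1 z))).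
    by rewrite /GRing.scale/= mulr0 addr0.
  by move=> ->.
have nZ (k : R) (u : R -> R) : cont_cs u -> nsq (fun x => k * u x) = k ^+ 2 * nsq u.
  move=> cu; rewrite /nsq -RintegralZ_cs; last exact: cont_cs_sqr.
  by apply: eq_Rintegral => x _; rewrite exprMn.
have cS (u : R -> R) : smooth_cs u -> cont_cs (fun x => u (l * x)).
  move=> su; apply: smooth_cs_cont; split.
    have := cinfty_affine l 0 su.1.
    by under [X in cinfty X]eq_fun do rewrite addr0.
  have [_ [d ud]] := su; exists (d / l) => x cx; apply: ud.
  by rewrite normrM (gtr0_norm l0) mulrC -ler_pdivrMr.
have n1 : nsq (derive1 W) = l * nsq (derive1 w).
  rewrite W1 (nZ _ (fun x => derive1 w (l * x))); last exact: cS.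
  transitivity (l ^+ 2 * (nsq (derive1 w) / l)).
    by congr (_ * _); exact: (nsq_scale l0 (smooth_cs_cont sw1)).
  by field; rewrite gt_eqF.
have n2 : nsq (derive1 (derive1 W)) = l ^+ 3 * nsq (derive1 (derive1 w)).
  rewrite W2 (nZ _ (fun x => derive1 (derive1 w) (l * x))); last exact: cS.
  transitivity (l ^+ 2 ^+ 2 * (nsq (derive1 (derive1 w)) / l)).
    by congr (_ * _); exact: (nsq_scale l0 (smooth_cs_cont sw2)).
  by field; rewrite gt_eqF.
have n0 : nsq W = nsq w / l by exact: (nsq_scale l0 (smooth_cs_cont sw)).
pose gc x := W x * cos (t * x); pose gs x := W x * sin (t * x).
have sgc : smooth_cs gc by apply: smooth_csMr => // n; have [] := cinfty_trig t n.
have sgs : smooth_cs gs by apply: smooth_csMr => // n; have [] := cinfty_trig t n.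
have [Dc Ds] := derive2_mul_trig t sW.
have cW := smooth_cs_cont sW.
have cW1 := smooth_cs_cont (smooth_cs_derive1 sW).
have cW2 := smooth_cs_cont (smooth_cs_derive1 (smooth_cs_derive1 sW)).
have ND : nsq (freq_defect t gc) + nsq (freq_defect t gs) =
    nsq (derive1 (derive1 W)) + 4 * t ^+ 2 * nsq (derive1 W).
  rewrite /gc /gs Dc Ds nsq_rotation//; last exact: cont_csZ.
  by rewrite nZ// exprMn (_ : 2 ^+ 2 = 4 :> R)//; ring.
have NG : nsq gc + nsq gs = nsq W.
  have z0 : cont_cs (fun _ : R => 0 : R) by split; [exact: cont_cst|exists 0].
  have := nsq_rotation t cW z0.
  under [X in nsq X + _ = _ -> _]eq_fun do rewrite mul0r subr0.
  under [X in _ + nsq X = _ -> _]eq_fun do rewrite mul0r addr0.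
  rewrite -/gc -/gs => ->.
  by rewrite /nsq [X in _ + X](_ : _ = 0) ?addr0// expr0n/= Rintegral_cst// mul0r.
have small : nsq (freq_defect t gc) + nsq (freq_defect t gs) < e' * (nsq gc + nsq gs).
  rewrite ND NG n0 n1 n2 mulrA; apply: scaled_energy_lt => //; exact: nsq_ge0.
have main g : smooth_cs g -> nsq (freq_defect t g) < e' * nsq g ->
  [/\ cont_cs g, 0 < nsq g,
    continuous (fun y : R => (y ^+ 2 - c ^+ 2) ^+ 2 * Fsq g (2 * pi * y)) &
    (\int[mu]_y ((y ^+ 2 - c ^+ 2) ^+ 2 * Fsq g (2 * pi * y))%:E <= (e * nsq g)%:E)%E].
  move=> sg hg; have cg := smooth_cs_cont sg.
  have cF : continuous (fun y : R => Fsq g (2 * pi * y)).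
    by apply: cont_comp; [exact: continuous_Fsq|cont].
  have cI : continuous (fun y : R => (y ^+ 2 - c ^+ 2) ^+ 2 * Fsq g (2 * pi * y)) by cont.
  split=> //.
    have : 0 < e' * nsq g by apply: le_lt_trans hg; exact: nsq_ge0.
    by rewrite pmulr_rgt0.
  have p4 : 0 < (2 * pi) ^+ 4 :> R by rewrite exprn_gt0.
  rewrite -(@lee_pmul2l _ ((2 * pi) ^+ 4)%:E) ?lte_fin//.
  rewrite -ge0_integralZl//; last 3 first.
  - exact: continuous_EFin_measurable.
  - by move=> y _; rewrite lee_fin mulr_ge0 ?sqr_ge0 ?Fsq_ge0.
  - by rewrite lee_fin ltW.
  apply: (@le_trans _ _ (\int[mu]_y (Fsq (freq_defect t g) (2 * pi * y))%:E)%E).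
    rewrite le_eqVlt; apply/orP; left; apply/eqP; apply: eq_integral => y _.
    rewrite -EFinM Fsq_freq_defect// /t; congr EFin; ring.
  rewrite plancherel; last exact: (smooth_cs_cont (smooth_cs_freq_defect t sg)).
  by rewrite -EFinM lee_fin mulrA ltW.
have [h|h] := ltP (nsq (freq_defect t gc)) (e' * nsq gc); first by exists gc; exact: main.
exists gs; apply: main => //.
rewrite ltNge; apply/negP => h'; move: small; rewrite ltNge mulrDr => /negP; apply.
exact: lerD.
Qed.

End concentrated_functions.

(** * Frame bounds *)

Section wavelet_systems.
Context (R : realType).
Local Notation mu := (@lebesgue_measure R).
Implicit Types (f g h u v w : R -> R).

(** Square-integrability comes from Plancherel: the dominating function is a rescaled [Fsq u], with
    finite integral. *)
Lemma sqint_le_Fsq u g (l : R) : cont_cs u -> continuous g -> 0 < l ->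
  (forall x, g x ^+ 2 <= Fsq u (2 * pi * (l * x))) -> sqint g.
Proof.
move=> cu cg l0 gu.
have cF : continuous (fun y : R => Fsq u (2 * pi * y)).
  by apply: cont_comp; [exact: continuous_Fsq|cont].
have cFl : continuous (fun y : R => l * Fsq u (2 * pi * (l * y))).
  by apply: contM; [cont|apply: cont_comp; [exact: continuous_Fsq|cont]].
have iF : mu.-integrable setT (EFin \o (fun y : R => l * Fsq u (2 * pi * (l * y)))).
  apply/integrableP; split; first exact: continuous_EFin_measurable.
  under eq_integral do rewrite /= ger0_norm ?mulr_ge0 ?Fsq_ge0 ?(ltW l0)//.
  rewrite -(integral_scale l0 cF) ?plancherel ?ltry// => x; exact: Fsq_ge0.
apply: (sqint_dominated _ (integrableZ_EFin l^-1 iF)); last first.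
  by move=> x; rewrite mulKf ?gt_eqF.
exact: continuous_measurable_fun.
Qed.

Lemma sqint_wave h n k : cont_cs h -> sqint (wave h n k).
Proof.
move=> ch; apply: sqintZ.
pose t : R := - (2 * pi * k%:~R).
have E (x : R) : 2 * pi * ((2 : R) ^ n * x - k%:~R) = 2 * pi * ((2 : R) ^ n * x) + t.
  by rewrite /t; ring.
have cu : cont_cs (fun y => h y * cos (t * y)) by apply: cont_csMr => //; cont.
have cv : cont_cs (fun y => - (h y * sin (t * y))).
  by apply: cont_csN; apply: cont_csMr => //; cont.
have l0 : 0 < (2 : R) ^ n by rewrite exprz_gt0.
have cl : continuous (fun x : R => 2 * pi * ((2 : R) ^ n * x)) by cont.
under eq_fun do rewrite E Fcos_add//.
apply: sqintD.
- apply: (sqint_le_Fsq cu _ l0); first exact: (cont_comp (continuous_Fcos cu) cl).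
  by move=> x; rewrite lerDl sqr_ge0.
- apply: (sqint_le_Fsq cv _ l0); first exact: (cont_comp (continuous_Fsin cv) cl).
  by move=> x; rewrite lerDr sqr_ge0.
Qed.

(** The optimal bounds are the supremum of the lower bounds and the infimum of the upper ones. The
    nonzero [g] makes any lower bound at most any upper bound, even from different pairs, so both
    extremes are finite. *)
Lemma optimal_frame_bounds (J : choiceType) (E : J -> R -> R[i]) (e : J -> R -> R) g :
  (forall j x, E j x = (e j x)%:C%C) -> sqint g -> 0 < nsq g ->
  (exists A B, frame_bounds E A B) ->
  (exists A, is_lower_frame_bound E A) /\ (exists B, is_upper_frame_bound E B).
Proof.
move=> Ee sg g0 [A0 [B0 F0]].
pose L : set R := [set A | exists B, frame_bounds E A B].
pose U : set R := [set B | exists A, frame_bounds E A B].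
have LU A B : L A -> U B -> A <= B.
  move=> [B1 /(frame_boundsP _ _ Ee)[_ _ H1]] [A1 /(frame_boundsP _ _ Ee)[_ _ H2]].
  have /andP[h1 _] := H1 _ sg; have /andP[_ h2] := H2 _ sg.
  by have := le_trans h1 h2; rewrite lee_fin ler_pM2r.
have LA : L A0 by exists B0.
have UB : U B0 by exists A0.
have [A00 AB H0] := (frame_boundsP _ _ Ee).1 F0.
have supL : has_sup L by split; [exists A0|exists B0 => A; move=> /LU; apply].
have infU : has_inf U by split; [exists B0|exists A0 => B; exact: LU].
have A0s : A0 <= sup L by apply: ub_le_sup => //; case: supL.
have B0s : inf U <= B0 by apply: ge_inf => //; case: infU.
have sB : sup L <= B0 by apply: ge_sup; [case: supL|move=> A /LU; exact].
have Ai : A0 <= inf U by apply: lb_le_inf; [case: infU|move=> B; exact: LU].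
(* The coefficient sum of v is finite, so the bounds it satisfies pass to the limit. *)
have fin v : sqint v -> exists2 s, coef_sum e v = s%:E & A0 * nsq v <= s.
  move=> sv; have /andP[h1 h2] := H0 _ sv.
  by case: (coef_sum e v) h1 h2 => [s h1 _|//|//]; exists s.
split.
- exists (sup L); split; last by move=> A' B' F; apply: ub_le_sup; [case: supL|exists B'].
  exists B0; apply/(frame_boundsP _ _ Ee); split=> //; first exact: lt_le_trans A0s.
  move=> v sv; have /andP[h1 h2] := H0 _ sv; rewrite h2 andbT.
  have [s sE As] := fin _ sv; rewrite sE lee_fin.
  have := nsq_ge0 v; rewrite le_eqVlt => /orP[/eqP v0|v0].
    by move: As; rewrite -v0 !mulr0.
  rewrite -ler_pdivlMr//; apply: ge_sup; first by case: supL.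
  move=> A [B /(frame_boundsP _ _ Ee)[_ _ HA]]; have /andP[h _] := HA _ sv.
  by rewrite ler_pdivlMr// -lee_fin -sE.
- exists (inf U); split; last by move=> A' B' F; apply: ge_inf; [case: infU|exists A'].
  exists A0; apply/(frame_boundsP _ _ Ee); split=> //.
  move=> v sv; have /andP[h1 h2] := H0 _ sv; rewrite h1/=.
  have [s sE As] := fin _ sv; move: h2; rewrite sE !lee_fin => h2.
  have := nsq_ge0 v; rewrite le_eqVlt => /orP[/eqP v0|v0].
    by move: h2; rewrite -v0 !mulr0.
  rewrite -ler_pdivrMr//; apply: lb_le_inf; first by case: infU.
  move=> B [A /(frame_boundsP _ _ Ee)[_ _ HA]]; have /andP[_ h] := HA _ sv.
  by rewrite ler_pdivrMr// -lee_fin -sE.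
Qed.


Context (a m r : R).
Context (a0 : 0 < a) (rE : r = 1 / m) (r0 : 0 < r) (ra : r < a / 6) (ra1 : a + r < 1 / 2).
Local Notation psih := (psi_hat a m).

Let s_psih : smooth_cs psih. Proof. exact: (smooth_cs_psi_hat a0 rE r0 ra). Qed.
Let c_psih : cont_cs psih. Proof. exact: smooth_cs_cont. Qed.
Let supp_psih : supported (a + r) psih. Proof. exact: psi_hat_supported. Qed.

Lemma psi_real x : psi a m x = (Fcos psih (2 * pi * x))%:C%C.
Proof.
rewrite /psi /inverse_fourier /cintegral /Fcos; congr Complex => /=.
  by apply: eq_Rintegral => y _; rewrite mul0r subr0.
under eq_Rintegral do rewrite mul0r addr0.
apply: Rintegral_odd => [|y]; first by apply: cont_csMr => //; cont.
by rewrite psi_hatN mulrN sinN mulrN.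
Qed.

Lemma schwartz_psi : schwartz (psi a m).
Proof.
have cst0 : smooth_cs (fun _ : R => 0 : R) by split; [exact: cinfty_cst|exists 0].
have F0 (s : R) : Fcos (fun _ : R => 0 : R) s = 0 /\ Fsin (fun _ : R => 0 : R) s = 0.
  rewrite /Fcos /Fsin; under eq_Rintegral do rewrite mul0r.
  under [X in _ /\ X = _]eq_Rintegral do rewrite mul0r.
  by rewrite Rintegral_cst// mul0r.
have fr : fourier_image (fun x => Re (psi a m x)).
  exists psih, (fun=> 0); split=> //; apply/funext => x.
  by rewrite psi_real (F0 _).2 addr0.
have fi : fourier_image (fun x => Im (psi a m x)).
  exists (fun=> 0), (fun=> 0); split=> //; apply/funext => x.
  by rewrite psi_real (F0 _).1 (F0 _).2 addr0.
split; [exact: fourier_image_smooth|exact: fourier_image_smooth|..];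
  exact: fourier_image_rapidly_decreasing.
Qed.

Lemma smooth_compact_support_psi_hat : smooth_compact_support psih.
Proof.
split; first by apply/smoothP; case: s_psih.
apply: (@subclosed_compact _ _ `[- (a + r), a + r]%classic).
- exact: closed_closure.
- exact: segment_compact.
rewrite [X in _ `<=` X](closure_id _).1; last exact: interval_closed.
apply: closureS => x /= x0; rewrite in_itv/= -ler_norml leNgt; apply/negP => xr.
by move: x0; rewrite supp_psih ?eqxx// (ltW xr).
Qed.

Lemma wavelet_systemE (nk : int * int) (x : R) :
  wavelet_system (psi a m) nk x = (waves psih nk x)%:C%C.
Proof. by rewrite /wavelet_system psi_real -rmorphM. Qed.

Let ap0 : 0 <= a + r. Proof. by rewrite addr_ge0 ?(ltW a0) ?(ltW r0). Qed.

Lemma psi_frame_bounds : frame_bounds (wavelet_system (psi a m)) (1 / 4) (1 + 2 * r ^+ 2).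
Proof.
apply/(frame_boundsP _ _ wavelet_systemE).
have r2 : 0 <= r ^+ 2 by exact: sqr_ge0.
have B0 : 0 <= 1 + 2 * r ^+ 2 by lra.
have A0 : 0 <= 1 / 4 :> R by lra.
have se j : sqint (waves psih j) by exact: sqint_wave.
have even y := psi_hatN a m y.
have up v : cont_cs v -> (coef_sum (waves psih) v <= ((1 + 2 * r ^+ 2) * nsq v)%:E)%E.
  move=> cv; apply: le_trans
    (coef_sum_waves_le c_psih.1 supp_psih ap0 ra1 even cv (@cont_cst R (1 + 2 * r ^+ 2)) _) _.
    by move=> D y _; exact: psi_hat_sum_le.
  under eq_integral do rewrite EFinM.
  rewrite ge0_integralZl//; last 2 first.
  - apply: continuous_EFin_measurable => //.
    by apply: cont_comp; [exact: continuous_Fsq|cont].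
  - by move=> y _; rewrite lee_fin Fsq_ge0.
  by rewrite plancherel.
have low v : cont_cs v -> ((1 / 4 * nsq v)%:E <= coef_sum (waves psih) v)%E.
  move=> cv; apply: (coef_sum_waves_ge c_psih.1 supp_psih ap0 ra1 even cv A0) => y y0.
  exact: (psi_hat_dyadic_cover a0 rE r0 ra y0).
split; [lra|lra|move=> g sg].
rewrite (coef_sum_upper se B0 up sg) andbT.
by apply: (coef_sum_lower se A0 B0) sg => v cv; rewrite low// up.
Qed.

Lemma nsq_psi_hat_gt0 : 0 < nsq psih.
Proof.
have := a0; have := r0; have := ra => ra' r0' a0'.
have I : a / 2 + r < a - r by lra.
rewrite -lte_fin -nsq_integral; last exact: cont_cs_sqint.
apply: (@lt_le_trans _ _ (\int[mu]_(x in `[(a / 2 + r)%R, (a - r)%R]) (1%:E))%E).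
  rewrite integral_cst//= lebesgue_measure_itv/= lte_fin I mul1e -EFinB lte_fin; lra.
have P x : (a / 2 + r <= x <= a - r)%R -> psih x = 1.
  by move=> /andP[x1 x2]; apply: (psi_hat_plateau a0 rE r0 ra); rewrite ger0_norm//; lra.
have cp : continuous (fun x => psih x ^+ 2) by apply: contX; exact: c_psih.1.
apply: (@le_trans _ _ (\int[mu]_(x in `[(a / 2 + r)%R, (a - r)%R]) (psih x ^+ 2)%:E)%E).
  rewrite le_eqVlt; apply/orP; left; apply/eqP; apply: eq_integral => x.
  by rewrite inE/= in_itv/= => /P ->; rewrite expr1n.
apply: ge0_subset_integral => //.
- exact: continuous_EFin_measurable.
- by move=> x _; rewrite lee_fin sqr_ge0.
Qed.

Let cq g : cont_cs g -> continuous (fun y : R => Fsq g (2 * pi * y)).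
Proof. by move=> cg; apply: cont_comp; [exact: continuous_Fsq|cont]. Qed.

Lemma integral_weight (k C : R) d g : cont_cs g -> 0 <= k -> 0 <= C -> (forall y, 0 <= d y) ->
  continuous (fun y : R => d y * Fsq g (2 * pi * y)) ->
  (\int[mu]_y ((k + C * d y) * Fsq g (2 * pi * y))%:E =
   (k * nsq g)%:E + C%:E * \int[mu]_y (d y * Fsq g (2 * pi * y))%:E)%E.
Proof.
move=> cg k0 C0 d0 cd; have cqg := cq cg.
transitivity (\int[mu]_y (k%:E * (Fsq g (2 * pi * y))%:E +
    C%:E * (d y * Fsq g (2 * pi * y))%:E))%E.
  by apply: eq_integral => y _; rewrite -!EFinM -EFinD mulrDl mulrA.
rewrite ge0_integralD//.
- rewrite ge0_integralZl//.
  + rewrite ge0_integralZl//.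
    * by rewrite plancherel.
    * exact: continuous_EFin_measurable.
    * by move=> y _; rewrite lee_fin mulr_ge0 ?Fsq_ge0.
  + exact: continuous_EFin_measurable.
  + by move=> y _; rewrite lee_fin Fsq_ge0.
- by move=> y _; rewrite mule_ge0// lee_fin Fsq_ge0.
- by under eq_fun do rewrite -EFinM; apply: continuous_EFin_measurable => //; cont.
- by move=> y _; rewrite mule_ge0// lee_fin mulr_ge0 ?Fsq_ge0.
- under eq_fun do rewrite -EFinM; apply: continuous_EFin_measurable => //.
  by apply: contM => //; exact: cont_cst.
Qed.

Lemma lower_frame_bound_le A B : frame_bounds (wavelet_system (psi a m)) A B -> A <= 1 / 2.
Proof.
move=> /(frame_boundsP _ _ wavelet_systemE)[_ _ H].
apply/ler_addgt0Pr => e e0.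
have e20 : 0 < e / 2 by lra.
have [C C0 HC] := psi_hat_sum_near_edge a0 rE r0 ra e20.
have C1 : 0 < C + 1 by lra.
(* [psi_hat] itself serves as the window. The tolerance (e/2)/(C + 1) makes the weighted term at
   most e/2, so the coefficient sum is at most (1/2 + e) [nsq g]. *)
have [g [cg g0 cI Ig]] :=
  frequency_concentration a s_psih nsq_psi_hat_gt0 (divr_gt0 e20 C1).
have cw : continuous (fun y : R => 1 / 2 + e / 2 + C * (y ^+ 2 - a ^+ 2) ^+ 2) by cont.
have /andP[h _] := H _ (cont_cs_sqint cg).
have even y := psi_hatN a m y.
have h2 := coef_sum_waves_le c_psih.1 supp_psih ap0 ra1 even cg cw (fun D y _ => HC D y).
move: {h h2} (le_trans h h2); rewrite integral_weight//; [|lra|by move=> y; exact: sqr_ge0].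
have le : (C%:E * \int[mu]_y ((y ^+ 2 - a ^+ 2) ^+ 2 * Fsq g (2 * pi * y))%:E <=
    (e / 2 * nsq g)%:E)%E.
  apply: le_trans (lee_wpmul2l _ Ig) _; rewrite -?EFinM lee_fin//.
  rewrite mulrA ler_pM2r// mulrCA ler_piMr ?(ltW e20)//.
  by rewrite ler_pdivrMr// mul1r lerDl.
move=> /le_trans/(_ (leeD2l _ le)); rewrite -EFinD lee_fin -mulrDl ler_pM2r//; lra.
Qed.

(** Scale 0 alone nearly reaches the full norm, since [psi_hat] is 1 around 3a/4, where the spectrum
    concentrates. *)
Lemma upper_frame_bound_ge A B : frame_bounds (wavelet_system (psi a m)) A B -> 1 <= B.
Proof.
move=> /(frame_boundsP _ _ wavelet_systemE)[_ _ H].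
apply/ler_addgt0Pr => e e0.
have [C C0 HC] := psi_hat_near_plateau a0 rE r0 ra.
have C1 : 0 < C + 1 by lra.
have [g [cg g0 cI Ig]] :=
  frequency_concentration (3 * a / 4) s_psih nsq_psi_hat_gt0 (divr_gt0 e0 C1).
have /andP[_ h] := H _ (cont_cs_sqint cg).
have even y := psi_hatN a m y.
have h2 := coef_sum_waves_ge_level0 c_psih.1 supp_psih ap0 ra1 even cg.
move: {h h2} (le_trans h2 h) => h.
have cqg := cq cg; have cp := c_psih.1.
have le : (C%:E * \int[mu]_y ((y ^+ 2 - (3 * a / 4) ^+ 2) ^+ 2 * Fsq g (2 * pi * y))%:E <=
    (e * nsq g)%:E)%E.
  apply: le_trans (lee_wpmul2l _ Ig) _; rewrite -?EFinM lee_fin//.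
  rewrite mulrA ler_pM2r// mulrCA ler_piMr ?(ltW e0)//.
  by rewrite ler_pdivrMr// mul1r lerDl.
suff : (\int[mu]_y (Fsq g (2 * pi * y))%:E <= (B * nsq g)%:E + (e * nsq g)%:E)%E.
  by rewrite plancherel// -/(nsq g) -EFinD lee_fin -mulrDl -[leLHS]mul1r ler_pM2r.
apply: le_trans (leeD h le).
rewrite -ge0_integralZl//; last 2 first.
- exact: continuous_EFin_measurable.
- by move=> y _; rewrite lee_fin mulr_ge0 ?Fsq_ge0 ?sqr_ge0.
rewrite -ge0_integralD//; last 4 first.
- by move=> y _; rewrite lee_fin mulr_ge0 ?Fsq_ge0 ?sqr_ge0.
- by apply: continuous_EFin_measurable => //; cont.
- by move=> y _; rewrite mule_ge0// lee_fin mulr_ge0 ?Fsq_ge0 ?sqr_ge0.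
- by under eq_fun do rewrite -EFinM; apply: continuous_EFin_measurable => //; cont.
apply: ge0_le_integral => //.
- by move=> y _; rewrite lee_fin Fsq_ge0.
- exact: continuous_EFin_measurable.
- under eq_fun do rewrite -EFinM -EFinD.
  by apply: continuous_EFin_measurable => //; apply: contD; cont.
- move=> y _; rewrite -EFinM -EFinD lee_fin mulrA -mulrDl -[leLHS]mul1r ler_wpM2r ?Fsq_ge0//.
  by have := HC y; rewrite lerBlDr.
Qed.

End wavelet_systems.

Theorem theorem22 (R : realType) (a : R) (ha0 : 0 < a) (ha1 : a < 1 / 2) :
  exists A B : R -> R,
    (forall m : R, Num.max (6 / a) (2 / (1 - 2 * a)) < m ->
       [/\ smooth_compact_support (psi_hat a m),
           schwartz (psi a m),
           is_frame (wavelet_system (psi a m)),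
           is_lower_frame_bound (wavelet_system (psi a m)) (A m) /\
           is_upper_frame_bound (wavelet_system (psi a m)) (B m) &
           A m <= 1 / 2]) /\
    B m @[m --> +oo] --> (1 : R).
Proof.
(* The condition 6/a < m is 1/m < a/6, and 2/(1 - 2a) < m is 1/m < (1 - 2a)/2. *)
have H (m : R) : Num.max (6 / a) (2 / (1 - 2 * a)) < m ->
    [/\ 0 < 1 / m, 1 / m < a / 6 & a + 1 / m < 1 / 2].
  rewrite gt_max => /andP[h1 h2].
  have m0 : 0 < m by apply: lt_trans h1; rewrite divr_gt0.
  have b0 : 0 < 1 - 2 * a by lra.
  split; first by rewrite divr_gt0.
    by move: h1; rewrite ltr_pdivrMr// ltr_pdivrMr//; lra.
  suff : 1 / m < (1 - 2 * a) / 2 by lra.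
  by move: h2; rewrite ltr_pdivrMr// ltr_pdivrMr//; lra.
(* The optimal bounds become functions of m by choice; up to the threshold the pair (0, 0) is a
   dummy value. *)
have opt (m : R) : exists AB : R * R, Num.max (6 / a) (2 / (1 - 2 * a)) < m ->
    is_lower_frame_bound (wavelet_system (psi a m)) AB.1 /\
    is_upper_frame_bound (wavelet_system (psi a m)) AB.2.
  have [hm|_] := ltP (Num.max (6 / a) (2 / (1 - 2 * a))) m; last by exists (0, 0).
  have [r0 ra ra1] := H _ hm.
  have F := psi_frame_bounds ha0 erefl r0 ra ra1.
  have cp := smooth_cs_cont (smooth_cs_psi_hat ha0 erefl r0 ra).
  have [[A HA] [B HB]] := optimal_frame_bounds (wavelet_systemE ha0 erefl r0 ra)
    (cont_cs_sqint cp) (nsq_psi_hat_gt0 ha0 erefl r0 ra) (ex_intro _ _ (ex_intro _ _ F)).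
  by exists (A, B).
have {opt}[AB HAB] := choice opt.
exists (fun m => (AB m).1), (fun m => (AB m).2); split.
  move=> m hm; have [r0 ra ra1] := H _ hm; have [HA HB] := HAB _ hm.
  split=> //.
  - exact: smooth_compact_support_psi_hat ha0 erefl r0 ra.
  - exact: schwartz_psi ha0 erefl r0 ra.
  - split; last by do 2 eexists; exact: psi_frame_bounds ha0 erefl r0 ra ra1.
    move=> j; apply/L2_sqint.
    have -> : (fun x => Re (wavelet_system (psi a m) j x)) = waves (psi_hat a m) j.
      by apply/funext => x; rewrite (wavelet_systemE ha0 erefl r0 ra).
    have -> : (fun x => Im (wavelet_system (psi a m) j x)) = (fun=> 0).
      by apply/funext => x; rewrite (wavelet_systemE ha0 erefl r0 ra).
    split.
      by apply: sqint_wave; exact: smooth_cs_cont (smooth_cs_psi_hat ha0 erefl r0 ra).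
    by apply: cont_cs_sqint; split; [exact: cont_cst|exists 0].
  - by have [[B F] _] := HA; exact: (lower_frame_bound_le ha0 erefl r0 ra ra1 F).
apply/cvgrPdist_le => e e0; near=> m.
have hm : Num.max (6 / a) (2 / (1 - 2 * a)) < m by near: m; apply: nbhs_pinfty_gt; exact: num_real.
have m1 : 1 <= m by near: m; apply: nbhs_pinfty_ge; exact: num_real.
have me : 2 / e <= m by near: m; apply: nbhs_pinfty_ge; exact: num_real.
have [r0 ra ra1] := H _ hm; have [_ [[A F] HB]] := HAB _ hm.
have h1 := upper_frame_bound_ge ha0 erefl r0 ra ra1 F.
have h2 := HB _ _ (psi_frame_bounds ha0 erefl r0 ra ra1).
have m0 : 0 < m by lra.
(* The optimal upper bound lies in [1, 1 + 2 r^2] with r = 1/m <= 1, and 2 r^2 <= 2/m <= e. *)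
rewrite distrC ger0_norm ?subr_ge0// lerBlDl; apply: le_trans h2 _.
rewrite lerD2l; apply: (@le_trans _ _ (2 * (1 / m))).
  by rewrite ler_pM2l// expr2 ler_piMr ?(ltW r0)// ler_pdivrMr// mul1r.
by rewrite mulrA mulr1 ler_pdivrMr// mulrC -ler_pdivrMr.
Unshelve. all: by end_near. Qed.
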